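(* Let $\mathcal L=\mathcal L(\sigma,r_1,r_2)$ and $\tilde{\mathcal L}=\mathcal L(\tilde\sigma,\tilde r_1,\tilde r_2)$ be two boundary value problems of the form described in the context, with $\sigma,\tilde\sigma\in L_2(0,\pi)$ complex-valued, $(r_1,r_2)\in\mathcal N$ and $(\tilde r_1,\tilde r_2)\in\mathcal N$, and let $M(\lambda)$ and $\tilde M(\lambda)$ be their Weyl functions. If $M(\lambda)=\tilde M(\lambda)$, then $\sigma(x)=\tilde\sigma(x)$ a.e. on $(0,\pi)$ and $r_j(\lambda)\equiv\tilde r_j(\lambda)$ for $j=1,2$.
   Context: For a complex-valued $\sigma\in L_2(0,\pi)$ put $y^{[1]}:=y'-\sigma y$ (quasi-derivative) and $\ell y:=-(y^{[1]})'-\sigma y^{[1]}-\sigma^2y$; this represents $-y''+qy$ with $q=\sigma'\in W_2^{-1}(0,\pi)$ in the sense of distributions. Solutions of $\ell y=\lambda y$ are functions $y$ such that $y$ and $y^{[1]}$ are absolutely continuous on $[0,\pi]$ and the equation holds a.e. on $(0,\pi)$. The problem $\mathcal L(\sigma,r_1,r_2)$ is $$\ell y=\lambda y,\quad x\in(0,\pi),\qquad y^{[1]}(0)=0,\qquad r_1(\lambda)y^{[1]}(\pi)+r_2(\lambda)y(\pi)=0,$$ where $r_1,r_2$ are relatively prime polynomials with complex coefficients, $r_1(\lambda)=\sum_{n=0}^{M_1}c_n\lambda^n$, $r_2(\lambda)=\sum_{n=0}^{M_2}d_n\lambda^n$, $M_1,M_2\ge0$. Normalization: $(r_1,r_2)\in\mathcal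 N$ means the following. If $\deg r_1\ge\deg r_2$, then $M_1=M_2$ and $c_{M_1}=1$ ($d_{M_2}$ may be zero). If $\deg r_1<\deg r_2$, then $M_1=M_2-1$ and $d_{M_2}=1$ ($c_{M_1}$ may be zero). Let $\psi(x,\lambda)$ be the solution of $\ell y=\lambda y$ with $\psi(\pi,\lambda)=r_1(\lambda)$, $\psi^{[1]}(\pi,\lambda)=-r_2(\lambda)$. The Weyl function of $\mathcal L$ is the meromorphic function $M(\lambda)=-\dfrac{\psi(0,\lambda)}{\psi^{[1]}(0,\lambda)}$. The objects of $\tilde{\mathcal L}$ are defined in the same way, with the quasi-derivative $y'-\tilde\sigma y$. *)

(* Defs.v *)
From HB Require Import structures.
From mathcomp Require Export all_boot all_order all_algebra.
From mathcomp Require Export all_classical all_reals all_analysis.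
From mathcomp Require Export complex.

Set Implicit Arguments.
Unset Strict Implicit.
Unset Printing Implicit Defensive.

Import Order.TTheory GRing.Theory Num.Theory.
Import numFieldNormedType.Exports.

Local Open Scope classical_set_scope.
Local Open Scope ring_scope.
Local Open Scope complex_scope.

(* The complex numbers are R[i] with R : realType.  Measurability, absolute
   continuity and differentiability of maps R -> R[i] are taken componentwise. *)

Section SturmLiouville.
Context {R : realType}.
Notation mu := (@lebesgue_measure R).

(* The complex space L_2(0, pi); values outside ]0, pi[ are irrelevant. *)
Definition L2_0pi (sigma : R -> R[i]) : Prop :=
  [/\ measurable_fun `]0, pi[%classic (fun x => complex.Re (sigma x)),
      measurable_fun `]0, pi[%classic (fun x => complex.Im (sigma x)) &
      (\int[mu]_(x in `]0%R, pi[)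
         ((complex.Re (sigma x) ^+ 2 + complex.Im (sigma x) ^+ 2)%:E) < +oo)%E].

Definition abs_continuous (a b : R) (f : R -> R) : Prop :=
  forall e : R, 0 < e -> exists2 d : R, 0 < d &
    forall (n : nat) (s t : 'I_n -> R),
      (forall i, [/\ a <= s i, s i <= t i & t i <= b]) ->
      trivIset setT (fun i => `]s i, t i[%classic) ->
      \sum_(i < n) (t i - s i) < d ->
      \sum_(i < n) `|f (t i) - f (s i)| < e.

Definition cabs_continuous (a b : R) (f : R -> R[i]) : Prop :=
  abs_continuous a b (fun x => complex.Re (f x)) /\
  abs_continuous a b (fun x => complex.Im (f x)).

Definition is_cderive (f : R -> R[i]) (x : R) (df : R[i]) : Prop :=
  is_derive x 1 (fun t => complex.Re (f t)) (complex.Re df) /\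
  is_derive x 1 (fun t => complex.Im (f t)) (complex.Im df).

(* y1 = y' - sigma y a.e.: as y' is defined only a.e., the quasi-derivative is
   represented by a second function, which [solution] requires to be absolutely
   continuous, hence to be determined everywhere on [0, pi]. *)
Definition quasi_derivative (sigma y y1 : R -> R[i]) : Prop :=
  {ae mu, forall x, x \in `]0, pi[ ->
    exists2 dy : R[i], is_cderive y x dy & y1 x = dy - sigma x * y x}.

(* y, with quasi-derivative y1, solves
   - y1' - sigma y1 - sigma^2 y = lambda y. *)
Definition solution (sigma : R -> R[i]) (lambda : R[i]) (y y1 : R -> R[i])
    : Prop :=
  [/\ cabs_continuous 0 pi y,
      cabs_continuous 0 pi y1,
      quasi_derivative sigma y y1 &
      {ae mu, forall x, x \in `]0, pi[ ->
        exists2 dy1 : R[i], is_cderive y1 x dy1 &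
          - dy1 - sigma x * y1 x - sigma x ^+ 2 * y x = lambda * y x}].

(* Formal degrees M1, M2 >= 0 are natural numbers.  The zero polynomial has
   size 0, so that its degree is below that of any nonzero constant. *)
Definition normalized (r1 r2 : {poly R[i]}) : Prop :=
  exists M1 M2 : nat,
    [/\ (size r1 <= M1.+1)%N,
        (size r2 <= M2.+1)%N,
        (size r2 <= size r1)%N -> M1 = M2 /\ r1`_M1 = 1 &
        (size r1 < size r2)%N -> M2 = M1.+1 /\ r2`_M2 = 1].

Definition is_psi (sigma : R -> R[i]) (r1 r2 : {poly R[i]})
    (psi psi1 : R -> R[i] -> R[i]) : Prop :=
  forall lambda : R[i],
    [/\ solution sigma lambda (psi^~ lambda) (psi1^~ lambda),
        psi pi lambda = r1.[lambda] &
        psi1 pi lambda = - r2.[lambda]].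

(* The Weyl function, meaningful where psi1 0 lambda != 0.  When r1 and r2 are
   coprime, psi 0 and psi1 0 have no common zero (the solution would vanish
   identically), so the poles are exactly the zeros of psi1 0. *)
Definition weyl (psi psi1 : R -> R[i] -> R[i]) (lambda : R[i]) : R[i] :=
  - (psi 0 lambda / psi1 0 lambda).

(* Equality of Weyl functions as meromorphic functions: they agree at every
   point that is a pole of neither. *)
Definition weyl_equal (psi psi1 psit psit1 : R -> R[i] -> R[i]) : Prop :=
  forall lambda : R[i], psi1 0 lambda != 0 -> psit1 0 lambda != 0 ->
    weyl psi psi1 lambda = weyl psit psit1 lambda.

End SturmLiouville.

(* Main.v *)
Require Import Defs.
From mathcomp Require Import measurable_realfun ring lra.

(** Write the equation as the first-order system [y' = sigma y + y1],
    [y1' = - sigma y1 - sigma^2 y - lambda y].  Let [T] be its fundamental matrix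
    with [T = 1] at [x = 0], with columns [(C, C1)] and [(S, S1)], let [Tt] be the
    one for [sigmat], and let [Q = Tt T^-1].  The heart of the proof is that the
    entry [Q12 = St C - Ct S] vanishes for all [x] and [lambda].

    For fixed [x], [Q12] is an entire function of [lambda], of growth
    [exp (A sqrt |lambda|)].  On the positive half-axis [C] is bounded and [S] is
    [O(|lambda|^(-1/2))], so [Q12] tends to 0.  Elsewhere the Weyl functions come
    in.  Since [psi = psi(0) C + psi1(0) S], the quotient [w = psi / psi1(0)] is
    [S - M C], and equality of the Weyl functions gives [Q12 = wt C - Ct w].  With
    [lambda = - kappa^2] and [k = Re kappa] large, [C] is [O(exp (k x))], whereas
    [w] is [O(exp (- k x) / |kappa|)] ([psi_quotient_decays]); so [Q12] tends to 0
    along the negative and both imaginary half-axes too.  An entire function of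
    such growth that tends to 0 along the four half-axes is 0, by
    Phragmen-Lindelof in the four quadrants and Liouville ([entire_vanish]).

    The differential equation [Q' = At Q - Q A] then determines [Q]: [Q12 = 0]
    forces [Q11 = Q22], and with [det Q = 1] both are 1; then [Q21 = sigma - sigmat]
    has derivative 0 and vanishes at 0 ([eq_potentials_of_transfer_vanish]).  Once
    the potentials agree, [psi] and [psit] solve the same equation with
    proportional data at 0, so [r1 rt2 = r2 rt1] ([boundary_polynomials]), and
    coprimality with the normalisation gives equality of the polynomials.

    Two choices keep the analysis elementary.  Functions are handled through
    pairs of an absolutely continuous function and its almost everywhere
    derivative, and all estimates on solutions are energy inequalities for the
    components [y1 + kappa y] and [y1 - kappa y], resting on the fact that an
    absolutely continuous function with nonnegative derivative almost everywhere
    is nondecreasing ([ae_derive_ge0_nondecreasing]).  Entire functions are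
    locally uniform limits of polynomials, which is what Picard iteration yields
    ([picard_entire]); the maximum principle is needed for polynomials only. *)

Set Implicit Arguments.
Unset Strict Implicit.
Unset Printing Implicit Defensive.

Import Order.TTheory GRing.Theory Num.Theory.
Import numFieldNormedType.Exports.

Local Open Scope classical_set_scope.
Local Open Scope ring_scope.
Local Open Scope complex_scope.

(** * Absolutely continuous functions with an almost everywhere nonnegative derivative *)
Section Monotonicity.
Context {R : realType}.
Notation mu := (@lebesgue_measure R).

Lemma lebesgue_measure_oo (u v : R) : u <= v ->
  (mu (`]u, v[ : set R) = (v - u)%:E)%E.
Proof.
move=> uv; rewrite lebesgue_measure_itv/= lte_fin.
case: ltP => [_|vu]; first by rewrite -EFinD.
by rewrite (le_anti (introT andP (conj uv vu))) subrr.
Qed.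

(** The intervals come as a list in decreasing order because they are collected
    from left to right, the newest at the head; their total length is at most
    the measure of the open set that contains them. *)
Lemma abs_continuous_seq (a b e d : R) (F : R -> R) (U : set R)
    (l : seq (R * R)) :
  (forall (n : nat) (s t : 'I_n -> R),
      (forall i, [/\ a <= s i, s i <= t i & t i <= b]) ->
      trivIset setT (fun i => `]s i, t i[%classic) ->
      \sum_(i < n) (t i - s i) < d ->
      \sum_(i < n) `|F (t i) - F (s i)| < e) ->
  open U -> (mu U < d%:E)%E ->
  (forall p, p \in l ->
     [/\ a <= p.1, p.1 <= p.2, p.2 <= b & `]p.1, p.2[ `<=` U]) ->
  pairwise (fun p q : R * R => q.2 <= p.1) l ->
  \sum_(p <- l) `|F p.2 - F p.1| < e.
Proof.
move=> ac oU mU lP lpw.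
pose s (i : 'I_(size l)) := (nth (0, 0) l i).1.
pose t (i : 'I_(size l)) := (nth (0, 0) l i).2.
have stP (i : 'I_(size l)) :
    [/\ a <= s i, s i <= t i, t i <= b & `]s i, t i[ `<=` U].
  by apply: lP; rewrite mem_nth.
have tr : trivIset setT (fun i => `]s i, t i[%classic).
  apply/trivIsetP => i j _ _.
  wlog ij : i j / (i < j)%N.
    move=> H ne; case: (ltngtP i j) => [ij|ji|/val_inj E]; first exact: H.
      by rewrite setIC; apply: H => //; rewrite eq_sym.
    by rewrite E eqxx in ne.
  move=> _; rewrite -subset0 => x /= [].
  have tjsi : t j <= s i.
    by move/(pairwiseP (0, 0)): lpw => /(_ i j (ltn_ord i) (ltn_ord j) ij).
  rewrite !in_itv/= => /andP[six _] /andP[_ xtj].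
  by move: (lt_le_trans (lt_trans six xtj) tjsi); rewrite ltxx.
have -> : \sum_(p <- l) `|F p.2 - F p.1| = \sum_i `|F (t i) - F (s i)|.
  by rewrite (big_nth (0, 0)) big_mkord.
apply: ac => //; first by move=> i; case: (stP i).
rewrite -lte_fin; apply: le_lt_trans mU.
have -> : (\sum_(i < size l) (t i - s i))%:E =
    mu (\big[setU/set0]_(i < size l) `]s i, t i[%classic).
  rewrite measure_bigsetU_ord// -sumEFin; apply: eq_bigr => i _.
  by case: (stP i) => _ st _ _; exact/esym/lebesgue_measure_oo.
apply: le_measure; rewrite ?inE.
- by apply: bigsetU_measurable => i _; exact: measurable_itv.
- exact: open_measurable.
- elim/big_ind: _ => [//|A B|i _]; first by rewrite subUset => *; split.
  by case: (stP i).
Qed.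

(** Induction along a segment: around every point there is a scale below which
    the property is passed from the left of the point to its right.  It plays
    the role of the existence of a fine tagged partition. *)
Lemma real_induction (u v : R) (S : R -> Prop) :
  u <= v -> S u ->
  (forall x, u <= x <= v -> exists2 r, 0 < r &
    forall p q, u <= p <= x -> x <= q <= v -> q - p < r -> S p -> S q) ->
  S v.
Proof.
move=> uv Su step.
pose A := [set x | u <= x <= v /\ S x].
have Au : A u by split=> //; rewrite lexx.
have Asup : has_sup A by split; [exists u|exists v => x [/andP[]]].
set s := sup A.
have us : u <= s by exact: (ub_le_sup Asup.2).
have sv : s <= v by apply: ge_sup => //; [exists u|move=> x [/andP[]]].
have [|r r0 rP] := step s; first by rewrite us.
have r20 : 0 < r / 2 by rewrite divr_gt0.
have [p [/andP[up pv] Sp] sp] := sup_adherent r20 Asup.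
have ps : p <= s by apply: (ub_le_sup Asup.2); split=> //; rewrite up.
pose q := Num.min v (s + r / 2).
have sq : s <= q by rewrite le_min sv lerDl ltW.
have qv : q <= v by rewrite ge_min lexx.
have Sq : S q.
  apply: (rP p) => //; rewrite ?up ?sq //.
  have : q <= s + r / 2 by rewrite ge_min lexx orbT.
  move: sp; rewrite -/s; lra.
have qs : q <= s by apply: (ub_le_sup Asup.2); split=> //; rewrite (le_trans us).
have : q = v.
  rewrite /q; case: (leP v (s + r / 2)) => // h.
  move: qs; rewrite /q min_r ?(ltW h)//; lra.
by move=> <-.
Qed.

Lemma is_derive_eps (F : R -> R) (x d : R) : is_derive x 1 F d ->
  forall eps, 0 < eps -> exists2 r : R, 0 < r &
    forall y, `|y - x| < r -> `|F y - F x - d * (y - x)| <= eps * `|y - x|.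
Proof.
move=> dF eps eps0.
have Fd := @ex_derive _ _ _ _ _ _ _ dF.
have dE := @derive_val _ _ _ _ _ _ _ dF.
have : h^-1 *: (F (h *: 1 + x) - F x) @[h --> 0^'] --> d by rewrite -dE; exact: Fd.
move=> /cvgrPdist_lt /(_ _ eps0) /= [r /= r0 rP].
exists r => // y yx.
have [->|ne] := eqVneq y x; first by rewrite !subrr mulr0 subr0 normr0 mulr0.
have h0 : y - x != 0 by rewrite subr_eq0.
have := rP (y - x); rewrite /ball_/= sub0r normrN => /(_ yx h0) => /ltW.
have -> : (y - x) *: (1 : R) + x = y by rewrite /GRing.scale/= mulr1 subrK.
move=> H; rewrite -ler_pdivrMr ?normr_gt0// -normf_div; apply: le_trans H.
rewrite le_eqVlt; apply/orP; left; apply/eqP; rewrite -normrN; congr `|_|.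
by rewrite /GRing.scale/=; field.
Qed.

Lemma derive_ge_local (F : R -> R) (x d eta : R) :
  is_derive x 1 F d -> 0 <= d -> 0 < eta ->
  exists2 r : R, 0 < r & forall p q, p <= x -> x <= q -> q - p < r ->
    F p <= F q + eta * (q - p).
Proof.
move=> /is_derive_eps dF d0 eta0.
have [r r0 rP] := dF _ eta0.
exists r => // p q px xq qp.
have := rP p; have := rP q.
rewrite (ger0_norm (_ : 0 <= q - x)) ?subr_ge0// (ler0_norm (_ : p - x <= 0)) ?subr_le0//.
move=> Hq Hp.
have : q - x < r by lra.
move=> /Hq; rewrite ler_norml => /andP[q1 _].
have : - (p - x) < r by lra.
move=> /Hp; rewrite ler_norml => /andP[_ p1].
have := mulr_ge0 d0 (_ : 0 <= q - x); rewrite subr_ge0 => /(_ xq).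
have := mulr_ge0 d0 (_ : 0 <= x - p); rewrite subr_ge0 => /(_ px).
nra.
Qed.

(** Cover the null set where the derivative is missing or negative by an open
    set [U] so small that absolute continuity makes the total variation over
    disjoint intervals of [U] less than [e / 2].  Moving from [u] to [v] by
    steps, a step around a good point loses at most [eta] times its length, and
    a step around a bad point stays in [U]; so [F] drops by at most [e]. *)
Theorem ae_derive_ge0_nondecreasing (a b : R) (F : R -> R) :
  abs_continuous a b F ->
  {ae mu, forall x, x \in `]a, b[ -> exists2 d, is_derive x 1 F d & 0 <= d} ->
  forall u v, a <= u -> u <= v -> v <= b -> F u <= F v.
Proof.
move=> ac [N [mN N0 NP]] u v au uv vb.
apply/ler_addgt0Pr => e e0.
have e20 : 0 < e / 2 by rewrite divr_gt0.
have [d d0 dP] := ac _ e20.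
pose N' := N `|` [set a] `|` [set b].
have mN' : measurable N' by do 2 apply: measurableU => //.
have N'0 : mu N' = 0.
  apply: null_set_setU => //; last by rewrite /= lebesgue_measure_set1.
    exact: measurableU.
  by apply: null_set_setU => //; rewrite /= lebesgue_measure_set1.
have [|U [oU N'U muU]] := lebesgue_regularity_outer mN' _ d0; first by rewrite [X in (X < _)%E]N'0.
have Ud : (mu U < d%:E)%E.
  apply: le_lt_trans muU.
  have mU : measurable U by exact: open_measurable.
  have := @measureU2 _ _ _ mu (U `\` N') N' (measurableD mU mN') mN'.
  rewrite [X in (_ <= _ + X)%E]N'0 adde0; apply: le_trans.
  apply: le_measure; rewrite ?inE//; first by apply: measurableU => //; exact: measurableD.
  by rewrite setDE setUIl setvU setIT; left.
pose eta := e / 2 / (v - u + 1).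
have vu0 : 0 < v - u + 1 by lra.
have eta0 : 0 < eta by rewrite divr_gt0.
pose S x := u <= x <= v /\ exists l : seq (R * R),
  [/\ forall p, p \in l -> [/\ a <= p.1, p.1 <= p.2, p.2 <= x & `]p.1, p.2[ `<=` U],
     pairwise (fun p q : R * R => q.2 <= p.1) l &
     F u <= F x + eta * (x - u) + \sum_(p <- l) `|F p.2 - F p.1|].
have [||_ [l [lP lpw lF]]] := @real_induction u v S uv.
- split; first by rewrite lexx.
  by exists [::]; split => //; rewrite big_nil subrr mulr0 !addr0.
- move=> x /andP[ux xv].
  have good r : 0 < r -> (forall p q, p <= x -> x <= q -> q - p < r ->
       F p <= F q + eta * (q - p) \/ `]p, q[ `<=` U) ->
      exists2 r, 0 < r &
      forall p q, u <= p <= x -> x <= q <= v -> q - p < r -> S p -> S q.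
    move=> r0 rP; exists r => // p q /andP[up px] /andP[xq qv] qpr.
    move=> [_ [l [lP lpw lF]]].
    split; first by rewrite qv andbT (le_trans ux).
    have [h|h] := rP p q px xq qpr.
      exists l; split=> // [w /lP[? ? wp ?]|].
        by split=> //; rewrite (le_trans wp)// (le_trans px).
      move: lF h; lra.
    exists ((p, q) :: l); split => [w||].
    + rewrite inE => /predU1P[->|/lP[? ? wp ?]]; split => //=.
      * exact: le_trans up.
      * exact: le_trans xq.
      * by rewrite (le_trans wp)// (le_trans px).
    + by rewrite /= lpw andbT; apply/allP => w /lP[].
    + rewrite big_cons/=.
      have : F p - F q <= `|F q - F p| by rewrite distrC ler_norm.
      have : 0 <= eta * (q - p) by rewrite mulr_ge0 ?(ltW eta0)// subr_ge0 (le_trans px).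
      move: lF; lra.
  have [Ux|nUx] := pselect (U x).
    have /nbhs_ballP[r /= r0 rU] : nbhs x U by exact: open_nbhs_nbhs.
    apply: (good r r0) => p q px xq qp; right=> y /=; rewrite in_itv/= => /andP[py yq].
    by apply: rU; rewrite /ball/= ltr_distl; apply/andP; split; lra.
  have nN'x : ~ N' x by move=> /N'U.
  have xab : x \in `]a, b[.
    rewrite in_itv/= !lt_neqAle (le_trans au ux) (le_trans xv vb) !andbT.
    apply/andP; split; apply/eqP => h; apply: nN'x; first by left; right; rewrite h.
    by right.
  have [dd dF dd0] : exists2 d, is_derive x 1 F d & 0 <= d.
    by apply: contrapT => h; apply: nN'x; left; left; apply: NP => /= /(_ xab).
  have [r r0 rP] := derive_ge_local dF dd0 eta0.
  by apply: (good r r0) => p q px xq qp; left; exact: rP.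
- have lb p : p \in l ->
      [/\ a <= p.1, p.1 <= p.2, p.2 <= b & `]p.1, p.2[ `<=` U].
    by move=> /lP[? ? pv ?]; split=> //; rewrite (le_trans pv).
  have := abs_continuous_seq dP oU Ud lb lpw.
  have : eta * (v - u) <= e / 2.
    rewrite /eta -mulrA ler_piMr ?(ltW e20)// mulrC ler_pdivrMr ?mul1r//; lra.
  move: lF; lra.
Qed.

End Monotonicity.

(** * Absolutely continuous primitives *)
Section AbsolutelyContinuous.
Context {R : realType}.
Notation mu := (@lebesgue_measure R).

(** Two majorants cover sums and products; the exponential uses it with
    [F = G]. *)
Lemma abs_continuous_lip2 (a b K : R) (F G H : R -> R) :
  abs_continuous a b F -> abs_continuous a b G -> 0 <= K ->
  (forall x y, a <= x <= b -> a <= y <= b ->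
     `|H y - H x| <= K * (`|F y - F x| + `|G y - G x|)) ->
  abs_continuous a b H.
Proof.
move=> acF acG K0 HK e e0.
have K1 : 0 < K + 1 by lra.
have e20 : 0 < e / 2 / (K + 1) by rewrite !divr_gt0.
have [d1 d10 d1P] := acF _ e20; have [d2 d20 d2P] := acG _ e20.
exists (Num.min d1 d2) => [|n s t stP tr]; first by rewrite lt_min d10.
rewrite lt_min => /andP[/(d1P _ _ _ stP tr) F1 /(d2P _ _ _ stP tr) G1].
apply: (@le_lt_trans _ _
    (K * (\sum_(i < n) `|F (t i) - F (s i)| + \sum_(i < n) `|G (t i) - G (s i)|))).
  rewrite -big_split mulr_sumr; apply: ler_sum => i _.
  have [h1 h2 h3] := stP i.
  by apply: HK; rewrite ?h1 ?h3 ?(le_trans h1) ?(le_trans h2).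
apply: (@le_lt_trans _ _ (K * (e / (K + 1)))).
  by apply: ler_wpM2l => //; move: F1 G1; rewrite mulrAC; lra.
by rewrite mulrCA gtr_pMr// ltr_pdivrMr//; lra.
Qed.

Lemma abs_continuous_unif (a b e : R) (F : R -> R) :
  abs_continuous a b F -> 0 < e -> exists2 d, 0 < d &
  forall x y, a <= x -> x <= y -> y <= b -> y - x < d -> `|F y - F x| < e.
Proof.
move=> acF e0; have [d d0 dP] := acF _ e0; exists d => // x y ax xy yb yx.
have := dP 1%N (fun=> x) (fun=> y); rewrite !big_ord1; apply => //.
by apply/trivIsetP => i j _ _; rewrite !ord1.
Qed.

Lemma abs_continuous_bounded (a b : R) (F : R -> R) : a <= b ->
  abs_continuous a b F ->
  exists2 M, 0 <= M & forall x, a <= x <= b -> `|F x| <= M.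
Proof.
move=> ab /abs_continuous_unif /(_ ltr01)[d d0 dP].
have : exists2 M, 0 <= M & forall y, a <= y <= b -> `|F y| <= M.
  pose S x := a <= x <= b /\ exists2 M, 0 <= M & forall y, a <= y <= x -> `|F y| <= M.
  have [||//] := @real_induction _ a b S ab.
  - split; first by rewrite lexx.
    exists `|F a| => // y /andP[h1 h2].
    by rewrite (le_anti (introT andP (conj h1 h2))).
  - move=> x _; exists d => // p q /andP[ap px] /andP[xq qb] qp [_ [M M0 MP]].
    split; first by rewrite qb (le_trans ap)// (le_trans px).
    exists (M + 1) => [|y /andP[ay yq]]; first lra.
    have [yp|py] := leP y p; first by have := MP y; rewrite ay yp => /(_ isT); lra.
    have Fp : `|F p| <= M by apply: MP; rewrite ap lexx.
    have : `|F y - F p| < 1 by apply: dP => //; [exact: ltW|exact: le_trans qb|lra].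
    have := ler_normD (F y - F p) (F p); rewrite subrK; lra.
by [].
Qed.

Lemma abs_continuous_continuous (a b : R) (F : R -> R) :
  abs_continuous a b F -> {in `]a, b[%classic, continuous F}.
Proof.
move=> acF x; rewrite inE/= in_itv/= => /andP[ax xb].
apply/cvgrPdist_lt => e e0.
have [d d0 dP] := abs_continuous_unif acF e0.
near=> y.
have [ya yb] : a < y /\ y < b.
  by split; near: y; [exact: lt_nbhsr|exact: lt_nbhsl].
have : `|y - x| < d.
  by rewrite distrC; near: y; exact: (@cvgr_dist_lt _ _ _ _ _ id x cvg_id _ d0).
rewrite ltr_norml => /andP[h1 h2].
have [xy|yx] := leP x y.
  by rewrite distrC; apply: dP => //; exact: ltW.
by apply: dP; rewrite ?(ltW ax) ?(ltW yx) ?(ltW xb) ?(ltW ya)//; lra.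
Unshelve. all: by end_near. Qed.

Lemma abs_continuous_measurable (a b : R) (F : R -> R) :
  abs_continuous a b F -> measurable_fun `]a, b[%classic F.
Proof.
move=> acF; apply: open_continuous_measurable_fun => //.
exact: abs_continuous_continuous acF.
Qed.

(** By the monotonicity theorem [f] determines [F] up to a constant, so that
    comparing integrals amounts to comparing primitives, and the estimates below
    need no integral. *)
Definition primitive (a b : R) (F f : R -> R) : Prop :=
  abs_continuous a b F /\
  {ae mu, forall x, x \in `]a, b[ -> is_derive x 1 F (f x)}.

Lemma ae_imply (P Q : R -> Prop) : (forall x, P x -> Q x) ->
  {ae mu, forall x, P x} -> {ae mu, forall x, Q x}.
Proof. by move=> PQ; apply: filterS; first exact: (ae_filter_ringOfSetsType mu). Qed.

Lemma ae_imply2 (P1 P2 Q : R -> Prop) : (forall x, P1 x -> P2 x -> Q x) ->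
  {ae mu, forall x, P1 x} -> {ae mu, forall x, P2 x} -> {ae mu, forall x, Q x}.
Proof. by move=> PQ; apply: filterS2; first exact: (ae_filter_ringOfSetsType mu). Qed.

Lemma primitive_ge0 (a b : R) (F f : R -> R) : primitive a b F f ->
  {ae mu, forall x, x \in `]a, b[ -> 0 <= f x} ->
  forall u v, a <= u -> u <= v -> v <= b -> F u <= F v.
Proof.
move=> [acF dF] f0; apply: (ae_derive_ge0_nondecreasing acF).
by apply: ae_imply2 dF f0 => x h1 h2 xab; exists (f x); [exact: h1|exact: h2].
Qed.

Lemma primitive_ae_eq (a b : R) (F f g : R -> R) : primitive a b F f ->
  {ae mu, forall x, x \in `]a, b[ -> f x = g x} -> primitive a b F g.
Proof.
move=> [acF dF] fg; split=> //.
by apply: ae_imply2 dF fg => x h1 h2 xab; rewrite -h2//; exact: h1.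
Qed.

Lemma primitive_eq (a b : R) (F f g : R -> R) : primitive a b F f ->
  (forall x, x \in `]a, b[ -> f x = g x) -> primitive a b F g.
Proof. by move=> pF fg; apply: primitive_ae_eq pF _; exact: aeW. Qed.

Lemma primitive_cst (a b c : R) : primitive a b (fun=> c) (fun=> 0).
Proof.
split; last by apply: aeW => x _; exact: is_derive_cst.
move=> e e0; exists 1 => // n s t _ _ _.
by rewrite big1// => i _; rewrite subrr normr0.
Qed.

Lemma primitive_id (a b : R) : primitive a b id (fun=> 1).
Proof.
split; last by apply: aeW => x _; exact: is_derive_id.
move=> e e0; exists e => // n s t st _; apply: le_lt_trans.
apply: ler_sum => i _; have [_ h _] := st i.
by rewrite ger0_norm// subr_ge0.
Qed.

Lemma primitiveD (a b : R) (F f G g : R -> R) :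
  primitive a b F f -> primitive a b G g ->
  primitive a b (fun x => F x + G x) (fun x => f x + g x).
Proof.
move=> [acF dF] [acG dG]; split.
  apply: (abs_continuous_lip2 acF acG ler01) => x y _ _; rewrite mul1r.
  by rewrite opprD addrACA ler_normD.
by apply: ae_imply2 dF dG => x h1 h2 xab; apply: is_deriveD; [exact: h1|exact: h2].
Qed.

Lemma primitiveM (a b : R) (F f G g : R -> R) : a <= b ->
  primitive a b F f -> primitive a b G g ->
  primitive a b (fun x => F x * G x) (fun x => f x * G x + F x * g x).
Proof.
move=> ab [acF dF] [acG dG]; split.
  have [M M0 MP] := abs_continuous_bounded ab acF.
  have [N N0 NP] := abs_continuous_bounded ab acG.
  apply: (abs_continuous_lip2 acF acG (addr_ge0 M0 N0)) => x y xab yab.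
  have -> : F y * G y - F x * G x = (F y - F x) * G y + F x * (G y - G x) by ring.
  apply: le_trans (ler_normD _ _) _; rewrite !normrM mulrDr lerD//.
    by rewrite mulrC ler_wpM2r// (le_trans (NP _ yab))// lerDr.
  by rewrite ler_wpM2r// (le_trans (MP _ xab))// lerDl.
apply: ae_imply2 dF dG => x h1 h2 xab.
apply: is_derive_eq (is_deriveM (h1 xab) (h2 xab)) _.
by rewrite /GRing.scale/=; ring.
Qed.

Lemma primitiveZ (a b c : R) (F f : R -> R) : a <= b ->
  primitive a b F f -> primitive a b (fun x => c * F x) (fun x => c * f x).
Proof.
move=> ab pF; apply: (primitive_eq (primitiveM ab (primitive_cst a b c) pF)).
by move=> x _; rewrite mul0r add0r.
Qed.

Lemma primitiveB (a b : R) (F f G g : R -> R) : a <= b ->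
  primitive a b F f -> primitive a b G g ->
  primitive a b (fun x => F x - G x) (fun x => f x - g x).
Proof.
move=> ab pF /(primitiveZ (-1) ab) /(primitiveD pF) pH.
rewrite (_ : (fun x => F x - G x) = fun x => F x + -1 * G x); last first.
  by apply/funext => x; rewrite mulN1r.
by apply: primitive_eq pH _ => x _; rewrite mulN1r.
Qed.

Lemma expR_lip (M x y : R) : x <= M -> y <= M ->
  `|expR y - expR x| <= expR M * `|y - x|.
Proof.
wlog xy : x y / x <= y.
  move=> H xM yM; case: (leP x y) => [|/ltW] h; first exact: H.
  by rewrite distrC (distrC y); exact: H.
move=> xM yM; rewrite !ger0_norm ?subr_ge0 ?ler_expR//.
have : expR x = expR y * expR (x - y) by rewrite -expRD addrC subrK.
move=> ->; have := expR_ge1Dx (x - y); have := expR_gt0 y.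
have : expR y <= expR M by rewrite ler_expR.
move=> h1 h2 h3.
apply: (@le_trans _ _ (expR y * (y - x))); last by rewrite ler_wpM2r ?subr_ge0.
by nra.
Qed.

Lemma primitive_expR (a b : R) (F f : R -> R) : a <= b ->
  primitive a b F f ->
  primitive a b (fun x => expR (F x)) (fun x => f x * expR (F x)).
Proof.
move=> ab [acF dF]; split.
  have [M M0 MP] := abs_continuous_bounded ab acF.
  apply: (abs_continuous_lip2 acF acF (ltW (expR_gt0 M))) => x y xab yab.
  have Fle z : a <= z <= b -> F z <= M by move=> /MP; apply: le_trans; exact: ler_norm.
  apply: le_trans (expR_lip (Fle _ xab) (Fle _ yab)) _.
  by rewrite ler_wpM2l ?expR_ge0// lerDl.
apply: ae_imply dF => x h xab; have dFx := h xab.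
have := @is_derive1_comp _ expR F x _ _ (is_derive_expR (F x)) dFx.
by rewrite mulrC.
Qed.

(** Absolute continuity of the integral gives the first half, Lebesgue's
    differentiation theorem the second.  Extending [f] by 0 makes it integrable
    on the whole line, so that integrals from minus infinity can be used. *)
Lemma primitive_exists (a b : R) (f : R -> R) : a < b ->
  mu.-integrable `]a, b[%classic (EFin \o f) ->
  exists F, primitive a b F f /\ F a = 0.
Proof.
move=> ab intf.
pose g := f \_ `]a, b[%classic.
have mab : measurable (`]a, b[%classic : set R) by exact: measurable_itv.
have ig : mu.-integrable setT (EFin \o g).
  by rewrite -restrict_EFin -integrable_mkcond.
exists (fun x => \int[mu]_(t in `]-oo, x]) g t - \int[mu]_(t in `]-oo, a]) g t).
split; last by rewrite subrr.
apply: (@primitive_eq _ _ _ (fun x => f x - 0)); last by move=> x _; rewrite subr0.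
apply: (primitiveB (ltW ab)); last exact: primitive_cst.
have igS A : measurable A -> mu.-integrable A (EFin \o g).
  by move=> mA; apply: integrableS ig.
split.
  move=> e e0; have [d [d0 dP]] := integral_normr_continuous ig e0.
  exists d => // n s t st tr std.
  pose A := \big[setU/set0]_(i < n) `]s i, t i[%classic.
  have mA : measurable A by apply: bigsetU_measurable => i _; exact: measurable_itv.
  have /dP : (mu A < d%:E)%E.
    rewrite /A measure_bigsetU_ord//; 
    apply: le_lt_trans (_ : ((\sum_(i < n) (t i - s i))%:E < _)%E).
      rewrite -sumEFin; apply: lee_sum => i _.
      by case: (st i) => _ h _; rewrite [leLHS]lebesgue_measure_oo.
    by rewrite lte_fin.
  move=> /(_ mA); apply: le_lt_trans.
  have -> : \int[mu]_(x in A) `|g x| = \sum_(i < n) \int[mu]_(x in `]s i, t i[) `|g x|.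
    rewrite /Rintegral integral_bigsetU_EFin//=; last 3 first.
    - exact: index_enum_uniq.
    - by apply: sub_trivIset tr.
    - by have /integrableP[] := integrable_norm (igS _ mA).
    rewrite -sum_fine// => i _; apply: integrable_fin_num => //.
    by have := integrable_norm (igS _ (measurable_itv `]s i, t i[)).
  apply: ler_sum => i _.
  have [_ sti _] := st i.
  rewrite Rintegral_itvB//; last first.
    exact: igS.
  apply: le_trans (le_normr_Rintegral _ _) _ => //; first exact: igS.
  rewrite -Rintegral_itv_bndo_bndc// /comp/=.
  by have := integrable_norm (igS _ (measurable_itv `]s i, t i[)).
have locg : locally_integrable setT g.
  by apply: open_integrable_locally => //; exact: openT.
have := FTC1Ny (fun y => igS _ (measurable_itv _)) locg.
apply: ae_imply => x [dx dE] xab.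
have -> : f x = g x by rewrite /g patchE mem_set.
by rewrite -dE derive1E; apply/derivableP.
Qed.

End AbsolutelyContinuous.

Local Notation cabs := (@ComplexField.Normc.normc _).
Local Notation re := (@complex.Re _).
Local Notation im := (@complex.Im _).

(** * Complex modulus and complex-valued primitives *)
Section Modulus.
Context {R : realType}.
Implicit Types z w : R[i].

Lemma reD z w : re (z + w) = re z + re w. Proof. by case: z w => ? ? []. Qed.
Lemma imD z w : im (z + w) = im z + im w. Proof. by case: z w => ? ? []. Qed.
Lemma reN z : re (- z) = - re z. Proof. by case: z. Qed.
Lemma imN z : im (- z) = - im z. Proof. by case: z. Qed.
Lemma reM z w : re (z * w) = re z * re w - im z * im w.
Proof. by case: z w => ? ? []. Qed.
Lemma imM z w : im (z * w) = re z * im w + im z * re w.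
Proof. by case: z w => ? ? []. Qed.
Definition reimE := (reD, imD, reN, imN, reM, imM).

Lemma complexP z w : re z = re w -> im z = im w -> z = w.
Proof. by case: z w => a b [c d] /= -> ->. Qed.

Lemma cabs_ge0 z : 0 <= cabs z.
Proof. by case: z => a b; rewrite sqrtr_ge0. Qed.

Lemma cabs_sqr z : cabs z ^+ 2 = re z ^+ 2 + im z ^+ 2.
Proof. by case: z => a b; rewrite sqr_sqrtr// addr_ge0// sqr_ge0. Qed.

Lemma cabsM z w : cabs (z * w) = cabs z * cabs w.
Proof. exact: ComplexField.Normc.normcM. Qed.

Lemma cabsV z : cabs z^-1 = (cabs z)^-1.
Proof. exact: ComplexField.Normc.normcV. Qed.

Lemma cabsD z w : cabs (z + w) <= cabs z + cabs w.
Proof. exact: le_normcD. Qed.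

Lemma cabsN z : cabs (- z) = cabs z.
Proof. exact: normcN. Qed.

Lemma cabsB z w : cabs (z - w) <= cabs z + cabs w.
Proof. by rewrite -(cabsN w) cabsD. Qed.

Lemma cabs_distC z w : cabs (z - w) = cabs (w - z).
Proof. by rewrite -cabsN opprB. Qed.

Lemma cabs_lowerB z w : cabs z - cabs w <= cabs (z - w).
Proof. by have := cabsD (z - w) w; rewrite subrK; lra. Qed.

Lemma cabs_lowerD z w : cabs z - cabs w <= cabs (z + w).
Proof. by have := cabs_lowerB z (- w); rewrite opprK cabsN. Qed.

Lemma cabs0 : cabs (0 : R[i]) = 0. Proof. exact: ComplexField.Normc.normc0. Qed.
Lemma cabs1 : cabs (1 : R[i]) = 1. Proof. exact: ComplexField.Normc.normc1. Qed.

Lemma cabs_eq0 z : (cabs z == 0) = (z == 0).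
Proof.
apply/eqP/eqP => [/ComplexField.Normc.eq0_normc//|->]; exact: cabs0.
Qed.

Lemma cabs_gt0 z : (0 < cabs z) = (z != 0).
Proof. by rewrite lt_neqAle cabs_ge0 andbT eq_sym cabs_eq0. Qed.

Lemma cabsX z n : cabs (z ^+ n) = cabs z ^+ n.
Proof. by elim: n => [|n IH]; rewrite ?expr0 ?cabs1// !exprS cabsM IH. Qed.

Lemma cabs_real (x : R) : cabs x%:C = `|x|.
Proof. by rewrite /= expr0n addr0 sqrtr_sqr. Qed.

Lemma ler_re_cabs z : `|re z| <= cabs z.
Proof.
rewrite -(@ler_pXn2r _ 2)// ?nnegrE ?cabs_ge0// cabs_sqr real_normK ?num_real//.
by rewrite lerDl sqr_ge0.
Qed.

Lemma ler_im_cabs z : `|im z| <= cabs z.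
Proof.
rewrite -(@ler_pXn2r _ 2)// ?nnegrE ?cabs_ge0// cabs_sqr real_normK ?num_real//.
by rewrite lerDr sqr_ge0.
Qed.

Lemma cabs_le_reim z : cabs z <= `|re z| + `|im z|.
Proof.
rewrite -(@ler_pXn2r _ 2)// ?nnegrE ?cabs_ge0 ?addr_ge0// cabs_sqr.
rewrite sqrrD !real_normK ?num_real//.
by have := normr_ge0 (re z); have := normr_ge0 (im z); nra.
Qed.

(** The real scalar product of the plane, that is, half of the derivative of the
    squared modulus at [z] in the direction [w]. *)
Definition cdot z w : R := re z * re w + im z * im w.

Lemma cdot_le z w : `|cdot z w| <= cabs z * cabs w.
Proof.
rewrite -(@ler_pXn2r _ 2)// ?nnegrE ?mulr_ge0 ?cabs_ge0//.
rewrite real_normK ?num_real// exprMn !cabs_sqr /cdot.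
have := sqr_ge0 (re z * im w - im z * re w); nra.
Qed.

Lemma cdotxx z : cdot z z = cabs z ^+ 2.
Proof. by rewrite cabs_sqr. Qed.

Lemma cdotDr z w v : cdot z (w + v) = cdot z w + cdot z v.
Proof. by rewrite /cdot !reimE; ring. Qed.
Lemma cdotNr z w : cdot z (- w) = - cdot z w.
Proof. by rewrite /cdot !reimE; ring. Qed.

End Modulus.

Section ComplexPrimitive.
Context {R : realType}.
Notation mu := (@lebesgue_measure R).
Variables (a b : R).
Hypothesis ab : a <= b.
Implicit Types (F G f g : R -> R[i]).

Definition cprimitive F f : Prop :=
  cabs_continuous a b F /\
  {ae mu, forall x, x \in `]a, b[ -> is_cderive F x (f x)}.

Lemma cprimitiveP F f : cprimitive F f <->
  primitive a b (fun x => re (F x)) (fun x => re (f x)) /\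
  primitive a b (fun x => im (F x)) (fun x => im (f x)).
Proof.
split=> [[[ac1 ac2] d]|[[ac1 d1] [ac2 d2]]].
  by split; split=> //; apply: ae_imply d => x h /h[].
by split=> //; apply: ae_imply2 d1 d2 => x h1 h2 h; split; [exact: h1|exact: h2].
Qed.

Lemma cprimitive_ae_eq F f g : cprimitive F f ->
  {ae mu, forall x, x \in `]a, b[ -> f x = g x} -> cprimitive F g.
Proof.
move=> [ac d] fg; split=> //.
by apply: ae_imply2 d fg => x h1 h2 h; rewrite -h2//; exact: h1.
Qed.

Lemma cprimitive_eq F f g : cprimitive F f ->
  (forall x, x \in `]a, b[ -> f x = g x) -> cprimitive F g.
Proof. by move=> pF fg; apply: cprimitive_ae_eq pF _; exact: aeW. Qed.

Lemma cprimitive_cst (c : R[i]) : cprimitive (fun=> c) (fun=> 0).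
Proof. by apply/cprimitiveP; split; exact: primitive_cst. Qed.

Lemma cprimitiveD F f G g : cprimitive F f -> cprimitive G g ->
  cprimitive (fun x => F x + G x) (fun x => f x + g x).
Proof.
move=> /cprimitiveP[F1 F2] /cprimitiveP[G1 G2]; apply/cprimitiveP.
rewrite (funext (fun x => reD (F x) (G x))) (funext (fun x => imD (F x) (G x))).
rewrite (funext (fun x => reD (f x) (g x))) (funext (fun x => imD (f x) (g x))).
by split; exact: primitiveD.
Qed.

Lemma cprimitiveM F f G g : cprimitive F f -> cprimitive G g ->
  cprimitive (fun x => F x * G x) (fun x => f x * G x + F x * g x).
Proof.
move=> /cprimitiveP[F1 F2] /cprimitiveP[G1 G2]; apply/cprimitiveP.
rewrite (funext (fun x => reM (F x) (G x))) (funext (fun x => imM (F x) (G x))).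
split.
  apply: primitive_eq (primitiveB ab (primitiveM ab F1 G1) (primitiveM ab F2 G2)) _.
  by move=> x _; rewrite !reimE; ring.
apply: primitive_eq (primitiveD (primitiveM ab F1 G2) (primitiveM ab F2 G1)) _.
by move=> x _; rewrite !reimE; ring.
Qed.

Lemma cprimitiveZ (c : R[i]) F f : cprimitive F f ->
  cprimitive (fun x => c * F x) (fun x => c * f x).
Proof.
move=> pF; apply: (cprimitive_eq (cprimitiveM (cprimitive_cst c) pF)).
by move=> x _; rewrite mul0r add0r.
Qed.

Lemma cprimitiveB F f G g : cprimitive F f -> cprimitive G g ->
  cprimitive (fun x => F x - G x) (fun x => f x - g x).
Proof.
move=> pF /(cprimitiveZ (-1)) /(cprimitiveD pF).
rewrite (funext (fun x => congr1 (+%R (F x)) (mulN1r (G x)))).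
by rewrite (funext (fun x => congr1 (+%R (f x)) (mulN1r (g x)))).
Qed.

Lemma cprimitive_sqr F f : cprimitive F f ->
  primitive a b (fun x => cabs (F x) ^+ 2) (fun x => 2 * cdot (F x) (f x)).
Proof.
move=> /cprimitiveP[F1 F2]; rewrite (funext (fun x => cabs_sqr (F x))).
apply: primitive_eq (primitiveD (primitiveM ab F1 F1) (primitiveM ab F2 F2)) _.
by move=> x _; rewrite /cdot; ring.
Qed.

(** Projecting [F] on the direction of its increment [F v - F u] reduces the
    mean value inequality to the monotonicity of a real primitive. *)
Lemma cprimitive_le F f (H h : R -> R) : cprimitive F f -> primitive a b H h ->
  {ae mu, forall x, x \in `]a, b[ -> cabs (f x) <= h x} ->
  forall u v, a <= u -> u <= v -> v <= b -> cabs (F v - F u) <= H v - H u.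
Proof.
move=> /cprimitiveP[F1 F2] pH fh u v au uv vb.
set w := F v - F u.
have p := primitiveB ab (primitiveZ (cabs w) ab pH)
  (primitiveD (primitiveZ (re w) ab F1) (primitiveZ (im w) ab F2)).
have /(primitive_ge0 p) : {ae mu, forall x, x \in `]a, b[ ->
    0 <= cabs w * h x - (re w * re (f x) + im w * im (f x))}.
  apply: ae_imply fh => x h1 /h1 fx; rewrite subr_ge0.
  apply: le_trans (ler_norm _) _; apply: le_trans (cdot_le w (f x)) _.
  by rewrite ler_wpM2l// cabs_ge0.
move=> /(_ u v au uv vb).
have := cabs_ge0 w; rewrite le_eqVlt => /predU1P[<- |w0].
  rewrite !mul0r.
  move: (primitive_ge0 pH) => /(_ _ u v au uv vb) HH _.
  rewrite subr_ge0; apply: HH.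
  by apply: ae_imply fh => x h1 /h1; apply: le_trans; exact: cabs_ge0.
have := cdotxx w; rewrite {2}/w cdotDr cdotNr /cdot => wE E.
by rewrite -(ler_pM2l w0) -expr2 -wE; move: E; lra.
Qed.

Lemma cprimitive_eq0 F f : cprimitive F f ->
  {ae mu, forall x, x \in `]a, b[ -> f x = 0} ->
  forall x, a <= x -> x <= b -> F x = F a.
Proof.
move=> pF f0 x ax xb; apply/eqP; rewrite -subr_eq0 -cabs_eq0 eq_le cabs_ge0 andbT.
have := cprimitive_le pF (primitive_cst a b 0) _ (lexx a) ax xb.
rewrite subrr; apply.
by apply: ae_imply f0 => y h /h ->; rewrite cabs0.
Qed.

Lemma cprimitive_bounded F f : cprimitive F f ->
  exists2 M, 0 <= M & forall x, a <= x <= b -> cabs (F x) <= M.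
Proof.
move=> [[ac1 ac2] _].
have [M M0 MP] := abs_continuous_bounded ab ac1.
have [N N0 NP] := abs_continuous_bounded ab ac2.
exists (M + N) => [|x xab]; first exact: addr_ge0.
by apply: le_trans (cabs_le_reim _) _; rewrite lerD ?MP ?NP.
Qed.

End ComplexPrimitive.

(** * The maximum principle for polynomials *)
Section MaximumPrinciple.
Context {R : realType}.
Implicit Types (p q : {poly R[i]}) (z w : R[i]).

(** Continuity is that of the real and imaginary parts in the two real
    coordinates. *)
Lemma poly_continuous_plane p :
  continuous (fun u : R * R => re p.[u.1 +i* u.2]) /\
  continuous (fun u : R * R => im p.[u.1 +i* u.2]).
Proof.
elim/poly_ind: p => [|p c [cre cim]].
  by rewrite (funext (fun u => congr1 re (horner0 _)))
    (funext (fun u => congr1 im (horner0 _))); split=> u; exact: cvg_cst.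
have E u : (p * 'X + c%:P).[u] = p.[u] * u + c by rewrite hornerMXaddC.
split=> u; under eq_fun do rewrite E !reimE/=.
  by apply: cvgD; last exact: cvg_cst; apply: cvgB; apply: cvgM;
    [exact: cre|exact: cvg_fst|exact: cim|exact: cvg_snd].
by apply: cvgD; last exact: cvg_cst; apply: cvgD; apply: cvgM;
    [exact: cre|exact: cvg_snd|exact: cim|exact: cvg_fst].
Qed.

Lemma poly_bounded p L : exists2 M, 0 <= M & forall z, cabs z <= L -> cabs p.[z] <= M.
Proof.
elim/poly_ind: p => [|p c [M M0 MP]].
  by exists 0 => // z _; rewrite horner0 cabs0.
exists (M * `|L| + cabs c) => [|z zL].
  by rewrite addr_ge0 ?cabs_ge0// mulr_ge0.
rewrite hornerMXaddC; apply: le_trans (cabsD _ _) _; rewrite lerD2r cabsM.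
apply: ler_pM; rewrite ?cabs_ge0 ?MP//.
exact: le_trans (ler_norm _).
Qed.

Lemma parallelogram z w :
  cabs (z + w) ^+ 2 + cabs (z - w) ^+ 2 = 2 * (cabs z ^+ 2 + cabs w ^+ 2).
Proof. by rewrite !cabs_sqr !reimE; ring. Qed.

(** The four points form a square centred at [z].  Summing [|c + a h + b h^2|^2]
    over its corners, the parallelogram law kills the linear and the quadratic
    terms and leaves a sum of squares, so only the cubic Taylor remainder can
    make the average of [|p|^2] smaller than its value at the centre. *)
Lemma four_point p z : exists2 K, 0 <= K & forall h : R, 0 < h -> h <= 1 ->
  4 * cabs p.[z] ^+ 2 - K * h ^+ 3 <=
  cabs p.[z + h%:C] ^+ 2 + cabs p.[z - h%:C] ^+ 2 +
  cabs p.[z + 'i * h%:C] ^+ 2 + cabs p.[z - 'i * h%:C] ^+ 2.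
Proof.
pose T := p \Po ('X + z%:P).
pose r := drop_poly 3 T.
have TE w : p.[z + w] = T`_0 + T`_1 * w + T`_2 * w ^+ 2 + r.[w] * w ^+ 3.
  have -> : p.[z + w] = T.[w].
    by rewrite horner_comp hornerD hornerX hornerC addrC.
  rewrite -{1}(poly_take_drop 3 T) hornerD hornerM hornerXn; congr (_ + _).
  by rewrite horner_poly !big_ord_recr big_ord0/= !expr0 !expr1 mulr1 add0r.
have pz : p.[z] = T`_0.
  by rewrite -{1}(addr0 z) TE !expr0n/= !mulr0 !addr0.
set c := T`_0 in TE pz; set a := T`_1 in TE; set b := T`_2 in TE.
have [M M0 MP] := poly_bounded r 1.
pose B := cabs c + cabs a + cabs b.
have B0 : 0 <= B by rewrite !addr_ge0 ?cabs_ge0.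
have key w (h : R) : cabs w = h -> 0 < h -> h <= 1 ->
    cabs (c + a * w + b * w ^+ 2) ^+ 2 - 2 * B * M * h ^+ 3 <= cabs p.[z + w] ^+ 2.
  move=> wh h0 h1; rewrite TE; set s := c + _ + _; set t := _ * w ^+ 3.
  have sB : cabs s <= B.
    apply: le_trans (cabsD _ _) _; apply: lerD.
      apply: le_trans (cabsD _ _) _; rewrite lerD2l cabsM wh.
      by rewrite ler_piMr ?cabs_ge0.
    by rewrite cabsM cabsX wh ler_piMr ?cabs_ge0// expr_le1 // ltW.
  have tM : cabs t <= M * h ^+ 3.
    by rewrite cabsM cabsX wh ler_wpM2r ?exprn_ge0 ?(ltW h0)// MP// wh.
  have := cabs_lowerD s t; have := cabs_ge0 s; have := cabs_ge0 t.
  have := cabs_ge0 (s + t).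
  move: (cabs s) (cabs t) (cabs (s + t)) sB tM => s' t' st sB tM st0 t0 s0 st1.
  have : s' * t' <= B * (M * h ^+ 3) by rewrite ler_pM.
  have [ts|st2] := leP t' s'; last by nra.
  have : (s' - t') ^+ 2 <= st ^+ 2 by rewrite ler_sqr ?nnegrE ?subr_ge0//.
  nra.
exists (8 * B * M) => [|h h0 h1]; first by rewrite !mulr_ge0.
have ch : cabs (h%:C : R[i]) = h by rewrite cabs_real gtr0_norm.
have ci : cabs ('i * h%:C) = h.
  by rewrite cabsM ch /= expr0n expr1n/= add0r sqrtr1 mul1r.
have k1 := key h%:C h ch h0 h1.
have k2 := key (- h%:C) h (etrans (cabsN _) ch) h0 h1.
have k3 := key ('i * h%:C) h ci h0 h1.
have k4 := key (- ('i * h%:C)) h (etrans (cabsN _) ci) h0 h1.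
have sqi (w : R[i]) : ('i * w) ^+ 2 = - w ^+ 2 by rewrite exprMn sqr_i mulN1r.
rewrite sqrrN mulrN in k2.
rewrite sqi mulrN in k3.
rewrite sqrrN sqi !mulrN in k4.
have p1 := parallelogram (c + b * h%:C ^+ 2) (a * h%:C).
have p2 := parallelogram (c - b * h%:C ^+ 2) (a * ('i * h%:C)).
have p3 := parallelogram c (b * h%:C ^+ 2).
rewrite [c + _ + _]addrAC in k1.
rewrite [c + _ + _]addrAC in k2.
rewrite [c + _ + _]addrAC in k3.
rewrite [c + _ + _]addrAC in k4.
rewrite pz.
have q1 := sqr_ge0 (cabs (a * h%:C)); have q2 := sqr_ge0 (cabs (a * ('i * h%:C))).
have q3 := sqr_ge0 (cabs (b * h%:C ^+ 2)).
clear - k1 k2 k3 k4 p1 p2 p3 q1 q2 q3; lra.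
Qed.

Lemma segment_lt (a b c : R) : a < c -> c < b -> a <= c <= b.
Proof. by move=> ac cb; rewrite !ltW. Qed.

Lemma segment_step (a b c h : R) : 0 < h -> h <= c - a -> h <= b - c ->
  a <= c + h <= b /\ a <= c - h <= b.
Proof. by move=> h0 ha hb; split; apply/andP; split; lra. Qed.

(** At an interior maximum of [v = |p|^2 + eps (x^2 + y^2)] the average of [v]
    over a small square exceeds [v] at the centre by [eps h^2 - O(h^3)], which
    is impossible; hence [v] is maximal on the boundary, and [eps] tends to
    0. *)
Lemma max_principle p (x0 x1 y0 y1 C : R) :
  (forall x y, x0 <= x <= x1 -> y0 <= y <= y1 ->
     [|| x == x0, x == x1, y == y0 | y == y1] -> cabs p.[x +i* y] <= C) ->
  forall x y, x0 <= x <= x1 -> y0 <= y <= y1 -> cabs p.[x +i* y] <= C.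
Proof.
move=> bd x y xx yy.
have C0 : 0 <= C.
  apply: le_trans (bd x0 y _ yy _); rewrite ?cabs_ge0 ?eqxx//.
  by rewrite lexx; case/andP: xx => /le_trans; apply.
pose D := `|x0| + `|x1| + `|y0| + `|y1|.
have D0 : 0 <= D by rewrite !addr_ge0.
rewrite -(@ler_pXn2r _ 2)// ?nnegrE ?cabs_ge0//.
apply/ler_addgt0Pr => e e0.
pose eps := e / (2 * D ^+ 2 + 1).
have DD : 0 < 2 * D ^+ 2 + 1 by have := sqr_ge0 D; lra.
have eps0 : 0 < eps by rewrite divr_gt0.
have epsD : eps * (2 * D ^+ 2) <= e.
  rewrite /eps mulrAC ler_pdivrMr//; have := sqr_ge0 D; nra.
pose v (u : R * R) : R := (re p.[u.1 +i* u.2] ^+ 2 + im p.[u.1 +i* u.2] ^+ 2) +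
   eps * (u.1 ^+ 2 + u.2 ^+ 2).
have vE u : v u = cabs p.[u.1 +i* u.2] ^+ 2 + eps * (u.1 ^+ 2 + u.2 ^+ 2).
  by rewrite /v cabs_sqr.
have cv : continuous v.
  have [c1 c2] := poly_continuous_plane p.
  move=> u; apply: cvgD; first by apply: cvgD; rewrite expr2; apply: cvgM;
    [exact: c1|exact: c1|exact: c2|exact: c2].
  apply: cvgM; first exact: cvg_cst.
  by apply: cvgD; rewrite expr2; apply: cvgM; (exact: cvg_fst || exact: cvg_snd).
have cK := compact_setX (@segment_compact _ x0 x1) (@segment_compact _ y0 y1).
set K := _ `*` _ in cK.
have Kxy : K (x, y) by split; rewrite /= in_itv.
have [||[cx cy] + cmax] := compact_EVT_max _ cK (_ : {within K, continuous v}).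
- by exists (x, y).
- exact: continuous_subspaceT.
rewrite inE => -[/=]; rewrite !in_itv/= => cxx cyy.
have vxy : v (x, y) <= v (cx, cy) by apply: cmax; rewrite inE.
have step1 : cabs p.[x +i* y] ^+ 2 <= v (cx, cy).
  apply: le_trans vxy; rewrite vE lerDl mulr_ge0 ?(ltW eps0)//.
  by rewrite addr_ge0 ?sqr_ge0.
apply: le_trans step1 _.
have [cb|ncb] := boolP [|| cx == x0, cx == x1, cy == y0 | cy == y1].
  rewrite vE/=; apply: lerD.
    by rewrite ler_sqr ?nnegrE ?cabs_ge0// bd.
  apply: le_trans epsD; rewrite ler_wpM2l ?(ltW eps0)//.
  have bnd (s t r : R) : s <= r <= t -> `|s| + `|t| <= D -> r ^+ 2 <= D ^+ 2.
    move=> /andP[sr rt] stD.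
    rewrite -(real_normK (num_real r)) ler_sqr ?nnegrE//.
    apply: le_trans stD; rewrite ler_norml.
    have := ler_norm t; have := ler_norm (- s); rewrite normrN.
    have := normr_ge0 s; have := normr_ge0 t.
    by move=> ? ? ? ?; apply/andP; split; lra.
  rewrite mulr_natl mulr2n; apply: lerD.
    apply: bnd cxx _; rewrite /D -addrA lerDl addr_ge0//.
  by apply: bnd cyy _; rewrite /D -addrA lerDr addr_ge0.
exfalso; move: ncb; rewrite !negb_or => /and4P[n1 n2 n3 n4].
have {}cxx : x0 < cx < x1.
  by case/andP: cxx => ? ?; rewrite !lt_neqAle eq_sym n1 n2; apply/andP.
have {}cyy : y0 < cy < y1.
  by case/andP: cyy => ? ?; rewrite !lt_neqAle eq_sym n3 n4; apply/andP.
have [K0 K00 K0P] := four_point p (cx +i* cy).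
case/andP: cxx => cx0 cx1; case/andP: cyy => cy0 cy1.
pose h := Num.min (Num.min (Num.min (cx - x0) (x1 - cx)) (Num.min (cy - y0) (y1 - cy)))
   (Num.min 1 (eps / (K0 + 1))).
have h0 : 0 < h.
  by rewrite !lt_min !subr_gt0 cx0 cx1 cy0 cy1 ltr01 divr_gt0// ltr_wpDl.
have : h <= h by [].
rewrite {2}/h !le_min => /andP[/andP[/andP[hx0 hx1] /andP[hy0 hy1]] /andP[h1 he]].
have hK : K0 * h < eps.
  have : (K0 + 1) * h <= eps by rewrite mulrC -ler_pdivlMr// ltr_wpDl.
  by lra.
have := K0P h h0 h1.
have zE1 : (cx +i* cy) + h%:C = (cx + h) +i* cy by apply: complexP => /=; rewrite ?addr0.
have zE2 : (cx +i* cy) - h%:C = (cx - h) +i* cy by apply: complexP => /=; rewrite ?oppr0 ?addr0.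
have zE3 : (cx +i* cy) + 'i * h%:C = cx +i* (cy + h).
  by apply: complexP; rewrite !reimE/=; ring.
have zE4 : (cx +i* cy) - 'i * h%:C = cx +i* (cy - h).
  by apply: complexP; rewrite !reimE/=; ring.
rewrite zE1 zE2 zE3 zE4.
have inK a b : x0 <= a <= x1 -> y0 <= b <= y1 -> v (a, b) <= v (cx, cy).
  by move=> axx byy; apply: cmax; rewrite inE; split; rewrite /= in_itv.
have [bx1 bx2] := segment_step h0 hx0 hx1; have [by1 by2] := segment_step h0 hy0 hy1.
have bx := segment_lt cx0 cx1; have by0 := segment_lt cy0 cy1.
have m1 := inK _ _ bx1 by0; have m2 := inK _ _ bx2 by0.
have m3 := inK _ _ bx by1; have m4 := inK _ _ bx by2.
have e1 : K0 * h ^+ 3 < eps * h ^+ 2.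
  by rewrite exprS mulrA ltr_pM2r ?exprn_gt0.
have e2 : 0 < eps * h ^+ 2 by rewrite mulr_gt0 ?exprn_gt0.
move: m1 m2 m3 m4; rewrite !vE/=; clear - e1 e2 => m1 m2 m3 m4 fp; lra.
Qed.

End MaximumPrinciple.

(** * Entire functions: Phragmen-Lindelof and Liouville *)
Section Entire.
Context {R : realType}.
Implicit Types (p q : {poly R[i]}) (z w : R[i]) (f : R[i] -> R[i]).

(** Locally uniform limits of polynomials are exactly the entire functions, by
    their Taylor series.  In this form the maximum principle for polynomials is
    enough, and Picard iteration produces such functions directly. *)
Definition entire f : Prop := forall L e : R, 0 < e ->
  exists p : {poly R[i]}, forall z, cabs z <= L -> cabs (f z - p.[z]) <= e.

Lemma entire_bounded f : entire f -> forall L, exists2 M, 0 <= M &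
  forall z, cabs z <= L -> cabs (f z) <= M.
Proof.
move=> fe L; have [p pP] := fe L 1 ltr01; have [M M0 MP] := poly_bounded p L.
exists (1 + M) => [|z zL]; first by rewrite addr_ge0.
by rewrite -(subrK p.[z] (f z)) (le_trans (cabsD _ _))// lerD ?pP ?MP.
Qed.

Lemma entireB f g : entire f -> entire g -> entire (fun z => f z - g z).
Proof.
move=> fe ge L e e0; have e2 : 0 < e / 2 by rewrite divr_gt0.
have [p pP] := fe L _ e2; have [q qP] := ge L _ e2.
exists (p - q) => z zL; rewrite hornerD hornerN.
rewrite (_ : _ - _ = (f z - p.[z]) - (g z - q.[z])); last by ring.
by apply: le_trans (cabsB _ _) _; have := pP z zL; have := qP z zL; lra.
Qed.

Lemma entireM f g : entire f -> entire g -> entire (fun z => f z * g z).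
Proof.
move=> fe ge L e e0.
have [M M0 MP] := entire_bounded fe L; have [N N0 NP] := entire_bounded ge L.
pose d := Num.min 1 (e / (M + N + 1)).
have MN : 0 < M + N + 1 by lra.
have d0 : 0 < d by rewrite lt_min ltr01 divr_gt0.
have : d <= d by [].
rewrite {2}/d le_min => /andP[d1]; rewrite ler_pdivlMr// => de.
have [p pP] := fe L _ d0; have [q qP] := ge L _ d0.
exists (p * q) => z zL; rewrite hornerM.
rewrite (_ : _ - _ = f z * (g z - q.[z]) + (f z - p.[z]) * g z
  - (f z - p.[z]) * (g z - q.[z])); last by ring.
apply: le_trans (cabsB _ _) _.
have h1 : cabs (f z * (g z - q.[z])) <= M * d by rewrite cabsM ler_pM ?cabs_ge0 ?MP ?qP.
have h2 : cabs ((f z - p.[z]) * g z) <= d * N by rewrite cabsM ler_pM ?cabs_ge0 ?NP ?pP.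
have h3 : cabs ((f z - p.[z]) * (g z - q.[z])) <= d * d by rewrite cabsM ler_pM ?cabs_ge0 ?pP ?qP.
have h4 : d * d <= d by rewrite ler_piMr// ltW.
have := cabsD (f z * (g z - q.[z])) ((f z - p.[z]) * g z).
lra.
Qed.

Lemma entire_scale f w : entire f -> entire (fun z => f (w * z)).
Proof.
move=> fe L e e0; have [p pP] := fe (cabs w * L) e e0.
exists (p \Po (w *: 'X)) => z zL.
rewrite horner_comp hornerZ hornerX; apply: pP.
by rewrite cabsM ler_wpM2l ?cabs_ge0.
Qed.

Lemma cabs_reim_le (x y : R) : cabs (x +i* y) <= `|x| + `|y|.
Proof. exact: (cabs_le_reim (x +i* y)). Qed.

Lemma expR_half_small (d : R) : 0 <= d -> d <= 1 / 2 -> expR d <= 1 + 2 * d.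
Proof.
move=> d0 d1; have := expR_ge1Dx (- d); rewrite expRN => h.
have h1 : 0 < 1 - d by lra.
have : expR d <= (1 - d)^-1.
  by rewrite -[expR d]invrK lef_pV2// posrE invr_gt0 expR_gt0.
move/le_trans; apply; rewrite -div1r ler_pdivrMr//; nra.
Qed.

(** The polynomials [(1 - t (1 - i) z / n)^n] approximate [exp (- t (1 - i) z)],
    whose modulus [exp (- t (x + y))] decays exponentially in the first
    quadrant.  They serve as multipliers that stay within polynomials. *)
Lemma damping_upper (t x y : R) (n : nat) : (0 < n)%N -> 
  cabs ((1 - (t / n%:R)%:C * (1 -i* 1) * (x +i* y)) ^+ n) <=
  expR (- t * (x + y) + t ^+ 2 * (x ^+ 2 + y ^+ 2) / n%:R).
Proof.
move=> n0; rewrite cabsX; have n0' : n%:R != 0 :> R by rewrite pnatr_eq0 -lt0n.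
have np : 0 < n%:R :> R by rewrite ltr0n.
pose a := - t * (x + y) + t ^+ 2 * (x ^+ 2 + y ^+ 2) / n%:R.
rewrite -/a (_ : expR a = expR (a / n%:R) ^+ n); last first.
  by rewrite -expRM_natl -mulr_natl mulrCA divff// mulr1.
apply: lerXn2r; rewrite ?nnegrE ?cabs_ge0 ?expR_ge0//.
rewrite -(@ler_pXn2r _ 2)// ?nnegrE ?cabs_ge0 ?expR_ge0//.
rewrite -expRM_natl cabs_sqr !reimE/=.
apply: le_trans (expR_ge1Dx _).
by rewrite le_eqVlt; apply/orP; left; apply/eqP; rewrite /a; field.
Qed.

Lemma damping_lower (t : R) z (n : nat) : 0 <= t -> 2 * t * cabs z <= n%:R -> (0 < n)%N ->
  1 - 2 * t * cabs z <= cabs ((1 - (t / n%:R)%:C * (1 -i* 1) * z) ^+ n).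
Proof.
move=> t0 tn n0; rewrite cabsX.
have np : 0 < n%:R :> R by rewrite ltr0n.
have h : cabs ((t / n%:R)%:C * (1 -i* 1) * z) <= 2 * t * cabs z / n%:R.
  rewrite !cabsM cabs_real ger0_norm ?divr_ge0 ?(ltW np)//.
  have := cabs_reim_le 1 (-1); rewrite normrN !normr1 => c2.
  rewrite (_ : 2 * t * cabs z / n%:R = t / n%:R * (1 + 1) * cabs z); last by field; lra.
  by rewrite ler_wpM2r ?cabs_ge0// ler_wpM2l// divr_ge0// ltW.
set u := 2 * t * cabs z / n%:R in h.
have u1 : u <= 1 by rewrite ler_pdivrMr ?mul1r.
have -> : 2 * t * cabs z = n%:R * u by rewrite /u; field; rewrite gt_eqF.
apply: (@le_trans _ _ ((1 - u) ^+ n)).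
  have bern m : 1 - m%:R * u <= (1 - u) ^+ m.
    elim: m => [|m IH]; first by rewrite mul0r subr0 expr0.
    rewrite exprS; have : 0 <= u by apply: le_trans h; rewrite cabs_ge0.
    rewrite -natr1 => u0; have : 0 <= 1 - u by lra.
    move=> v0; have := ler_wpM2l v0 IH.
    have : 0 <= m%:R * u * u by rewrite mulr_ge0// mulr_ge0// ler0n.
    lra.
  exact: bern.
apply: lerXn2r; rewrite ?nnegrE ?cabs_ge0 ?subr_ge0//.
have := cabs_lowerB 1 ((t / n%:R)%:C * (1 -i* 1) * z); rewrite cabs1; lra.
Qed.

(** Multiply [f] by a damping factor of rate [t].  On a square [[0, L]^2] the
    product is at most [C], up to a factor close to 1: on the axes by the
    hypothesis, and on the two far sides, when [L] is large, because [f] grows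
    slower than [exp (t / 2 |z|)].  The maximum principle gives the bound at
    [z], where the damping factor is at least [1 - 2 t |z|]; let [t] tend
    to 0. *)
Lemma phragmen_lindelof_quadrant f (C : R) : entire f -> 0 < C ->
  (forall s, 0 < s -> exists B, forall z, cabs (f z) <= B * expR (s * cabs z)) ->
  (forall x : R, 0 <= x -> cabs (f x%:C) <= C) ->
  (forall x : R, 0 <= x -> cabs (f ('i * x%:C)) <= C) ->
  forall x y, 0 <= x -> 0 <= y -> cabs (f (x +i* y)) <= C.
Proof.
move=> fe C0 growth fx fy x y x0 y0.
set z := x +i* y.
(* The error [e] absorbs the approximation of [f] by a polynomial and that of
   the exponential by a power. *)
have main (t e : R) : 0 < t -> 0 < e -> e <= 1 -> 
    cabs (f z) * (1 - 2 * t * cabs z) <= (C + e) * (1 + e) + e * (1 + e).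
  move=> t0 e0 e1.
  have t20 : 0 < t / 2 by rewrite divr_gt0.
  have [B0 BP0] := growth _ t20.
  pose B := `|B0|.
  have BP w : cabs (f w) <= B * expR (t / 2 * cabs w).
    by apply: le_trans (BP0 w) _; rewrite ler_wpM2r ?expR_ge0// ler_norm.
  pose L := Num.max (Num.max x y) (2 * B / (t * C)).
  have Lx : x <= L by rewrite !le_max lexx.
  have Ly : y <= L by rewrite !le_max lexx orbT.
  have LB : B <= C * (t / 2 * L).
    have : 2 * B / (t * C) <= L by rewrite !le_max lexx !orbT.
    by rewrite ler_pdivrMr ?mulr_gt0//; lra.
  have L0 : 0 <= L by exact: le_trans Lx.
  have [p pP] := fe (2 * L) e e0.
  have [n nP] : exists n : nat, 2 * t ^+ 2 * L ^+ 2 <= (e / 2) * n%:R /\ 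
      2 * t * cabs z <= n%:R /\ (0 < n)%N.
    have e20 : 0 < e / 2 by rewrite divr_gt0.
    pose M := Num.max (2 * t ^+ 2 * L ^+ 2 / (e / 2)) (2 * t * cabs z).
    exists (Num.truncn M).+1; have := truncnS_gt M => /ltW.
    by rewrite ge_max ler_pdivrMr// => /andP[h1 h2]; split; [rewrite [leRHS]mulrC|].
  case: nP => n1 [n2 n3].
  have np : 0 < n%:R :> R by rewrite ltr0n.
  pose m : {poly R[i]} := (1 - ((t / n%:R)%:C * (1 -i* 1)) *: 'X) ^+ n.
  have mE w : m.[w] = (1 - (t / n%:R)%:C * (1 -i* 1) * w) ^+ n.
    by rewrite /m horner_exp hornerD hornerN hornerZ hornerX hornerC.
  have mup a b : 0 <= a <= L -> 0 <= b <= L ->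
      cabs m.[a +i* b] <= expR (- t * (a + b)) * (1 + e).
    move=> /andP[a0 aL] /andP[b0 bL]; rewrite mE.
    apply: le_trans (damping_upper t a b n3) _; rewrite expRD ler_wpM2l ?expR_ge0//.
    apply: (@le_trans _ _ (expR (e / 2))).
      rewrite ler_expR ler_pdivrMr//; apply: le_trans n1.
      have : a ^+ 2 <= L ^+ 2 by rewrite ler_sqr ?nnegrE.
      have : b ^+ 2 <= L ^+ 2 by rewrite ler_sqr ?nnegrE.
      move=> ? ?; rewrite -mulrA [leRHS]mulrCA ler_wpM2l ?sqr_ge0//; lra.
    by apply: le_trans (expR_half_small _ _) _; lra.
  have inL a b : 0 <= a <= L -> 0 <= b <= L -> cabs (a +i* b) <= 2 * L.
    move=> /andP[a0 aL] /andP[b0 bL]; apply: le_trans (cabs_reim_le _ _) _.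
    by rewrite !ger0_norm//; lra.
  have pbd a b : 0 <= a <= L -> 0 <= b <= L ->
      [|| a == 0, a == L, b == 0 | b == L] ->
      cabs (f (a +i* b)) * expR (- t * (a + b)) <= C.
    move=> /andP[a0 aL] /andP[b0 bL].
    have axis w : cabs (f w) <= C -> cabs (f w) * expR (- t * (a + b)) <= C.
      move=> fw; rewrite -[leRHS]mulr1 ler_pM ?cabs_ge0 ?expR_ge0//.
      rewrite -expR0 ler_expR mulNr oppr_le0 mulr_ge0 ?(ltW t0)// addr_ge0//.
    have far : L <= a + b -> cabs (f (a +i* b)) * expR (- t * (a + b)) <= C.
      move=> Lab.
      apply: (@le_trans _ _ (B * expR (t / 2 * (a + b)) * expR (- t * (a + b)))).
        rewrite ler_wpM2r ?expR_ge0// (le_trans (BP _))// ler_wpM2l ?normr_ge0//.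
        rewrite ler_expR ler_wpM2l ?(ltW t20)// (le_trans (cabs_reim_le _ _))//.
        by rewrite !ger0_norm.
      rewrite -mulrA -expRD.
      rewrite (_ : t / 2 * (a + b) + - t * (a + b) = - (t / 2 * (a + b))); last by field.
      rewrite expRN ler_pdivrMr ?expR_gt0//; apply: le_trans LB _.
      rewrite ler_wpM2l ?(ltW C0)//; apply: (@le_trans _ _ (t / 2 * (a + b))).
        by rewrite ler_wpM2l// ltW.
      by have := expR_ge1Dx (t / 2 * (a + b)); lra.
    case/or4P => /eqP E.
    - apply: axis; rewrite E (_ : 0 +i* b = 'i * b%:C) ?fy//.
      by apply: complexP; rewrite !reimE/=; ring.
    - by apply: far; lra.
    - by apply: axis; rewrite E -/(real_complex _ _) fx.
    - by apply: far; lra.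
  have := @max_principle _ (p * m) 0 L 0 L ((C + e) * (1 + e)) _ x y.
  rewrite x0 y0 Lx Ly => /(_ _ isT isT) mp.
  have {mp} : cabs (p * m).[z] <= (C + e) * (1 + e).
    apply: mp => a b aL bL abb; rewrite hornerM cabsM.
    have h1 := mup a b aL bL; have h2 := pbd a b aL bL abb.
    have h3 := pP _ (inL a b aL bL).
    have E1 : expR (- t * (a + b)) <= 1.
      rewrite -expR0 ler_expR mulNr oppr_le0 mulr_ge0 ?(ltW t0)// addr_ge0//.
        by case/andP: aL. by case/andP: bL.
    apply: (@le_trans _ _ ((cabs (f (a +i* b)) + e) * (expR (- t * (a + b)) * (1 + e)))).
      apply: ler_pM; rewrite ?cabs_ge0//.
      have := cabsB (f (a +i* b)) (f (a +i* b) - p.[a +i* b]).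
      by rewrite subKr; lra.
    rewrite mulrA ler_wpM2r//; first lra.
    rewrite mulrDl lerD// ler_piMr// ltW//.
  rewrite hornerM cabsM => pm.
  have zL : cabs z <= 2 * L by apply: inL; rewrite ?x0 ?y0 ?Lx ?Ly.
  have fm : cabs (f z) * cabs m.[z] <= (C + e) * (1 + e) + e * (1 + e).
    have := pP z zL => h3.
    apply: (@le_trans _ _ ((cabs p.[z] + e) * cabs m.[z])).
      rewrite ler_wpM2r ?cabs_ge0//.
      have := cabsD (f z - p.[z]) p.[z]; rewrite subrK; lra.
    rewrite mulrDl lerD// ler_wpM2l ?(ltW e0)//.
    apply: le_trans (mup x y _ _) _; rewrite ?x0 ?y0 ?Lx ?Ly//.
    rewrite -[leRHS]mul1r ler_wpM2r//; first lra.
    rewrite -expR0 ler_expR mulNr oppr_le0 mulr_ge0 ?(ltW t0)// addr_ge0//.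
  apply: le_trans fm; rewrite ler_wpM2l ?cabs_ge0// mE.
  exact: damping_lower (ltW t0) n2 n3.
apply/ler_addgt0Pr => d d0.
pose A := cabs (f z) * (2 * cabs z) + 1.
have A0 : 0 < A by rewrite ltr_wpDl// mulr_ge0 ?cabs_ge0// mulr_ge0 ?cabs_ge0.
pose t := d / (2 * A).
have t0 : 0 < t by rewrite divr_gt0// mulr_gt0.
pose e := Num.min 1 (d / (2 * (C + 4))).
have C4 : 0 < C + 4 by lra.
have e0 : 0 < e by rewrite lt_min ltr01 divr_gt0// mulr_gt0.
have : e <= e by [].
rewrite {2}/e le_min => /andP[e1]; rewrite ler_pdivlMr ?mulr_gt0// => de.
have := main t e t0 e0 e1.
have : t * A <= d / 2.
  by rewrite /t invfM mulrA mulfVK// gt_eqF.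
have : e * e <= e by rewrite ler_piMr// ltW.
rewrite /A; nra.
Qed.

Definition axis_directions : seq R[i] := [:: 1; 'i; - 1; - 'i].

Lemma cabs_i : cabs ('i : R[i]) = 1.
Proof. by rewrite /= expr0n expr1n/= add0r sqrtr1. Qed.

Lemma cabs_axis u : u \in axis_directions -> cabs u = 1.
Proof.
by rewrite !inE => /or4P[] /eqP->; rewrite ?cabsN ?cabs_i ?cabs1.
Qed.

Lemma phragmen_lindelof f (C : R) : entire f -> 0 < C ->
  (forall s, 0 < s -> exists B, forall z, cabs (f z) <= B * expR (s * cabs z)) ->
  (forall u x, u \in axis_directions -> 0 <= x -> cabs (f (u * x%:C)) <= C) ->
  forall z, cabs (f z) <= C.
Proof.
move=> fe C0 growth ax.
have quad u x y : u \in axis_directions -> 'i * u \in axis_directions ->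
    0 <= x -> 0 <= y -> cabs (f (u * (x +i* y))) <= C.
  move=> uax iuax; apply: (phragmen_lindelof_quadrant (entire_scale u fe) C0).
  - move=> s s0; have [B BP] := growth _ s0; exists B => z.
    by apply: le_trans (BP _) _; rewrite cabsM cabs_axis// mul1r.
  - by move=> a a0; exact: ax.
  - by move=> a a0; rewrite mulrA [u * _]mulrC; exact: ax.
have i2 : 'i * 'i = -1 :> R[i] by rewrite -expr2 sqr_i.
move=> [x y]; have [x0|x0] := leP 0 x; have [y0|y0] := leP 0 y.
- by rewrite -[x +i* y]mul1r; apply: quad; rewrite // ?mulr1 !inE eqxx ?orbT.
- rewrite (_ : x +i* y = - 'i * ((- y) +i* x)); last first.
    by apply: complexP; rewrite !reimE/=; ring.
  by apply: quad; rewrite ?oppr_ge0 ?(ltW y0)// ?mulrN ?i2 ?opprK !inE eqxx ?orbT.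
- rewrite (_ : x +i* y = 'i * (y +i* (- x))); last first.
    by apply: complexP; rewrite !reimE/=; ring.
  by apply: quad; rewrite ?oppr_ge0 ?(ltW x0)// ?i2 !inE eqxx ?orbT.
- rewrite (_ : x +i* y = - 1 * ((- x) +i* (- y))); last first.
    by apply: complexP; rewrite !reimE/=; ring.
  by apply: quad; rewrite ?oppr_ge0 ?(ltW x0) ?(ltW y0)// ?mulrN ?mulr1 !inE eqxx ?orbT.
Qed.

(** [(f - f 0) / z] is of size [O(1 / L)] on the boundary of [[- L, L]^2], hence
    inside.  It is again a locally uniform limit of polynomials, since [p - p 0]
    is divisible by ['X]. *)
Lemma liouville f (C : R) : entire f -> (forall z, cabs (f z) <= C) ->
  forall z, f z = f 0.
Proof.
move=> fe fC z.
have C0 : 0 <= C by apply: le_trans (fC 0); rewrite cabs_ge0.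
have main (L e : R) : cabs z < L -> 0 < e ->
    cabs (f z - f 0) <= cabs z * ((2 * C + 2 * e) / L) + 2 * e.
  move=> zL e0.
  have L0 : 0 < L by apply: le_lt_trans zL; rewrite cabs_ge0.
  have [p pP] := fe (2 * L) e e0.
  pose q := drop_poly 1 p.
  have pE w : p.[w] = p`_0 + q.[w] * w.
    rewrite -{1}(poly_take_drop 1 p) hornerD hornerM hornerXn expr1; congr (_ + _).
    by rewrite horner_poly big_ord1 expr0 mulr1.
  have p0E : p.[0] = p`_0 by rewrite pE mulr0 addr0.
  have f0p : cabs (f 0 - p.[0]) <= e.
    by apply: pP; rewrite cabs0 mulr_ge0// ltW.
  have inL x y : - L <= x <= L -> - L <= y <= L -> cabs (x +i* y) <= 2 * L.
    rewrite -!ler_norml => hx hy.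
    by apply: le_trans (cabs_reim_le _ _) _; lra.
  have qb x y : - L <= x <= L -> - L <= y <= L ->
      [|| x == - L, x == L, y == - L | y == L] ->
      cabs q.[x +i* y] <= (2 * C + 2 * e) / L.
    move=> hx hy bd; set w := x +i* y.
    have wL : L <= cabs w.
      have hr : `|x| <= cabs w := ler_re_cabs w.
      have hi : `|y| <= cabs w := ler_im_cabs w.
      have nL : `|L| = L by rewrite gtr0_norm.
      by case/or4P: bd => /eqP E; rewrite E ?normrN nL in hr hi.
    rewrite ler_pdivlMr//; apply: (@le_trans _ _ (cabs q.[w] * cabs w)).
      by rewrite ler_wpM2l ?cabs_ge0.
    rewrite -cabsM (_ : q.[w] * w = p.[w] - p.[0]); last by rewrite pE p0E addrC addKr.
    rewrite (_ : _ - _ = (f w - f 0) - ((f w - p.[w]) - (f 0 - p.[0]))); last by ring.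
    have := cabsB (f w - f 0) ((f w - p.[w]) - (f 0 - p.[0])).
    have := cabsB (f w) (f 0); have := cabsB (f w - p.[w]) (f 0 - p.[0]).
    have := pP w (inL _ _ hx hy); have := fC w; have := fC 0; lra.
  have hz : - L <= re z <= L /\ - L <= im z <= L.
    by rewrite -!ler_norml !(le_trans _ (ltW zL)) ?ler_re_cabs ?ler_im_cabs.
  have := max_principle qb hz.1 hz.2.
  rewrite (_ : re z +i* im z = z); last by case: (z).
  move=> qz.
  rewrite (_ : f z - f 0 = z * q.[z] + ((f z - p.[z]) - (f 0 - p.[0]))); last first.
    by rewrite p0E pE; ring.
  apply: le_trans (cabsD _ _) _; rewrite cabsM lerD ?ler_wpM2l ?cabs_ge0//.
  apply: le_trans (cabsB _ _) _.
  by have := pP z (_ : _ <= 2 * L) => /(_ ltac:(lra)); lra.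
apply/eqP; rewrite -subr_eq0 -cabs_eq0 eq_le cabs_ge0 andbT.
apply/ler_addgt0Pr => d d0; rewrite add0r.
pose e := Num.min 1 (d / 4).
have e0 : 0 < e by rewrite lt_min ltr01 divr_gt0.
have : e <= e by []. rewrite {2}/e le_min => /andP[e1 ed].
have z0 := cabs_ge0 z.
pose L := cabs z + 1 + 2 * cabs z * (2 * C + 2) / d.
have zC : 0 <= 2 * cabs z * (2 * C + 2) by rewrite mulr_ge0//; lra.
have zL : cabs z < L.
  have : 0 <= 2 * cabs z * (2 * C + 2) / d by rewrite divr_ge0 ?(ltW d0).
  rewrite /L; lra.
have L0 : 0 < L by lra.
apply: le_trans (main L e zL e0) _.
have : cabs z * ((2 * C + 2 * e) / L) <= d / 2.
  rewrite mulrA ler_pdivrMr//.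
  have : 2 * cabs z * (2 * C + 2) <= d * L.
    by rewrite -ler_pdivrMl// /L mulrC; lra.
  have : cabs z * (2 * C + 2 * e) <= cabs z * (2 * C + 2) by rewrite ler_wpM2l//; lra.
  lra.
lra.
Qed.

(** Phragmen-Lindelof makes [f] bounded, hence constant.  Growth matters:
    [exp (- z ^ 4)] tends to 0 along the four half-axes. *)
Theorem entire_vanish f : entire f ->
  (forall s, 0 < s -> exists B, forall z, cabs (f z) <= B * expR (s * cabs z)) ->
  (forall e, 0 < e -> exists r, forall u x, u \in axis_directions -> r <= x ->
     cabs (f (u * x%:C)) <= e) ->
  forall z, f z = 0.
Proof.
move=> fe growth decay z.
have [r rP] := decay 1 ltr01.
have [M M0 MP] := entire_bounded fe r.
have bd : forall w, cabs (f w) <= M + 1.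
  apply: phragmen_lindelof growth _ => //; first lra.
  move=> u x uax x0; have [rx|xr] := leP r x.
    by have := rP u x uax rx; lra.
  have := MP (u * x%:C); rewrite cabsM cabs_axis// mul1r cabs_real ger0_norm//.
  by move=> /(_ (ltW xr)); lra.
have fE := liouville fe bd.
apply/eqP; rewrite fE -cabs_eq0 eq_le cabs_ge0 andbT.
apply/ler_addgt0Pr => e e0; rewrite add0r.
have [s sP] := decay e e0.
by rewrite -(fE (1 * s%:C)); apply: sP; rewrite // !inE eqxx.
Qed.

End Entire.

(** * Picard iteration with polynomial dependence on the spectral parameter *)
Section Picard.
Context {R : realType}.
Notation mu := (@lebesgue_measure R).
Local Notation pi := (@pi R).
Implicit Types (f h : R -> R[i]).

Let pi0 : 0 < pi. Proof. exact: pi_gt0. Qed.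
Let pi0' : 0 <= pi. Proof. exact: ltW. Qed.

Definition cmeasurable h : Prop :=
  measurable_fun `]0, pi[%classic (fun x => re (h x)) /\
  measurable_fun `]0, pi[%classic (fun x => im (h x)).

Lemma cmeasurableD f h : cmeasurable f -> cmeasurable h ->
  cmeasurable (fun x => f x + h x).
Proof.
move=> [f1 f2] [h1 h2]; split.
  by rewrite (funext (fun x => reD (f x) (h x))); exact: measurable_funD.
by rewrite (funext (fun x => imD (f x) (h x))); exact: measurable_funD.
Qed.

Lemma cmeasurableM f h : cmeasurable f -> cmeasurable h ->
  cmeasurable (fun x => f x * h x).
Proof.
move=> [f1 f2] [h1 h2]; split.
  rewrite (funext (fun x => reM (f x) (h x))).
  by apply: measurable_funB; exact: measurable_funM.
rewrite (funext (fun x => imM (f x) (h x))).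
by apply: measurable_funD; exact: measurable_funM.
Qed.

Lemma cmeasurable_cst (c : R[i]) : cmeasurable (fun=> c).
Proof. by split; exact: measurable_cst. Qed.

Lemma cprimitive_measurable F f : cprimitive 0 pi F f -> cmeasurable F.
Proof. by move=> [[a1 a2] _]; split; exact: abs_continuous_measurable. Qed.

Variable s : R -> R[i].
Hypothesis sL2 : L2_0pi s.

(** Dominates every coefficient of the first-order system, as
    [2 |s| <= 1 + |s|^2]. *)
Definition weight (x : R) : R := 1 + cabs (s x) ^+ 2.

Lemma potential_measurable : cmeasurable s. Proof. by case: sL2. Qed.

Lemma integrable_weight : mu.-integrable `]0, pi[%classic (EFin \o weight).
Proof.
have [m1 m2] := potential_measurable.
have mi : measurable (`]0, pi[%classic : set R) by exact: measurable_itv.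
have isq : mu.-integrable `]0, pi[%classic (EFin \o (fun x => cabs (s x) ^+ 2)).
  apply/integrableP; split.
    apply/measurable_EFinP; rewrite (funext (fun x => cabs_sqr (s x))).
    by apply: measurable_funD; apply: measurable_funX.
  case: sL2 => _ _; apply: le_lt_trans.
  rewrite le_eqVlt; apply/orP; left; apply/eqP.
  apply: eq_integral => x _; rewrite /= ger0_norm ?sqr_ge0// cabs_sqr//.
have i1 : mu.-integrable `]0, pi[%classic (EFin \o (fun=> 1)).
  apply/integrableP; split; first exact/measurable_EFinP.
  rewrite /= integral_cst// normr1 mul1e [X in (X < _)%E]lebesgue_measure_oo//.
  by rewrite ltry.
pose g1 : R -> \bar R := EFin \o (fun=> 1).
pose g2 : R -> \bar R := EFin \o (fun x => cabs (s x) ^+ 2).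
suff : mu.-integrable `]0, pi[%classic (fun x => g1 x + g2 x)%E by [].
by apply: integrableD.
Qed.

Lemma cprimitive_exists f (c : R) : cmeasurable f ->
  (forall x, x \in `]0, pi[ -> cabs (f x) <= c * weight x) ->
  exists F, cprimitive 0 pi F f /\ F 0 = 0.
Proof.
move=> [m1 m2] fw.
have mi : measurable (`]0, pi[%classic : set R) by exact: measurable_itv.
have ic : mu.-integrable `]0, pi[%classic (EFin \o (fun x => c * weight x)).
  suff : mu.-integrable `]0, pi[%classic
    (fun x => c%:E * (EFin \o weight) x)%E by [].
  by apply: integrableZl => //; exact: integrable_weight.
have dom (g : R -> R) : measurable_fun `]0, pi[%classic g ->
    (forall x, `|g x| <= cabs (f x)) -> exists F, primitive 0 pi F g /\ F 0 = 0.
  move=> mg gf; apply: primitive_exists => //.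
  apply: le_integrable ic => //; first exact/measurable_EFinP.
  move=> x xi /=; rewrite lee_fin; apply: le_trans (gf x) _.
  by apply: le_trans (fw x xi) _; exact: ler_norm.
have [F1 [p1 F10]] := dom _ m1 (fun x => ler_re_cabs (f x)).
have [F2 [p2 F20]] := dom _ m2 (fun x => ler_im_cabs (f x)).
exists (fun x => F1 x +i* F2 x); split; last by apply: complexP.
by apply/cprimitiveP.
Qed.

Lemma cprimitive_sum n (F f : nat -> R -> R[i]) :
  (forall j, (j < n)%N -> cprimitive 0 pi (F j) (f j)) ->
  cprimitive 0 pi (fun x => \sum_(j < n) F j x) (fun x => \sum_(j < n) f j x).
Proof.
elim: n => [|n IH] H.
  rewrite (funext (fun x => big_ord0 _ _ _ _)) (funext (fun x => big_ord0 _ _ _ _)).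
  exact: cprimitive_cst.
rewrite (funext (fun x => big_ord_recr _ _)) (funext (fun x => big_ord_recr _ _)).
apply: cprimitiveD; last exact: H.
by apply: IH => j jn; apply: H; rewrite ltnS ltnW.
Qed.

Definition bounded_measurable h : Prop := cmeasurable h /\
  exists2 M, 0 <= M & forall x, x \in `]0, pi[ -> cabs (h x) <= M.

Lemma bounded_measurable_cst (c : R[i]) : bounded_measurable (fun=> c).
Proof. by split; [exact: cmeasurable_cst|exists (cabs c); rewrite ?cabs_ge0]. Qed.

Lemma cprimitive_bounded_measurable F f : cprimitive 0 pi F f -> bounded_measurable F.
Proof.
move=> pF; split; first exact: cprimitive_measurable pF.
have [M M0 MP] := cprimitive_bounded pi0' pF; exists M => // x.
by rewrite in_itv/= => /andP[x0 x1]; apply: MP; rewrite !ltW.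
Qed.

(** A total operator, so that the Picard iterates can be defined by recursion
    before the existence of the primitives is known. *)
Definition chosen_primitive f : R -> R[i] :=
  xget (fun=> 0) [set F | cprimitive 0 pi F f /\ F 0 = 0].

Lemma chosen_primitiveP f : (exists F, cprimitive 0 pi F f /\ F 0 = 0) ->
  cprimitive 0 pi (chosen_primitive f) f /\ chosen_primitive f 0 = 0.
Proof. by move=> /(xgetPex (fun=> 0)). Qed.

(** The right-hand sides of [y' = s y + y1], [y1' = - s y1 - s^2 y - lambda y],
    which is the equation [l y = lambda y].  The last term has its own argument
    [w]: the coefficient of [lambda ^ j] in [lambda y] is not that of [y] but
    the preceding one. *)
Definition rhs1 (u v : R -> R[i]) x := s x * u x + v x.
Definition rhs2 (u v w : R -> R[i]) x := - (s x * v x) - s x ^+ 2 * u x - w x.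

Lemma cabs_le_weight x : cabs (s x) <= weight x.
Proof. rewrite /weight; have := sqr_ge0 (cabs (s x) - 1); nra. Qed.

Lemma rhs1_le (u v : R -> R[i]) x (M : R) :
  cabs (u x) <= M -> cabs (v x) <= M -> cabs (rhs1 u v x) <= 2 * M * weight x.
Proof.
move=> uM vM; apply: le_trans (cabsD _ _) _; rewrite cabsM.
have M0 : 0 <= M by apply: le_trans uM; rewrite cabs_ge0.
have := cabs_le_weight x; have := cabs_ge0 (s x) => s0 sw.
have w1 : 1 <= weight x by rewrite /weight lerDl sqr_ge0.
have : cabs (s x) * cabs (u x) <= weight x * M by rewrite ler_pM ?cabs_ge0.
nra.
Qed.

Lemma rhs2_le (u v w : R -> R[i]) x (M L : R) : 0 <= L ->
  cabs (u x) <= M -> cabs (v x) <= M -> cabs (w x) <= L * M ->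
  cabs (rhs2 u v w x) <= (2 + L) * M * weight x.
Proof.
move=> L0 uM vM wM.
have M0 : 0 <= M by apply: le_trans uM; rewrite cabs_ge0.
apply: le_trans (cabsB _ _) _.
have := cabsB (- (s x * v x)) (s x ^+ 2 * u x).
rewrite cabsN (cabsM (s x) (v x)) (cabsM (s x ^+ 2)) cabsX.
have := cabs_le_weight x; have := cabs_ge0 (s x) => s0 sw.
have w1 : 1 <= weight x by rewrite /weight lerDl sqr_ge0.
have s2w : cabs (s x) ^+ 2 <= weight x by rewrite /weight lerDr.
have : cabs (s x) * cabs (v x) <= weight x * M by rewrite ler_pM ?cabs_ge0.
have : cabs (s x) ^+ 2 * cabs (u x) <= weight x * M.
  by rewrite ler_pM ?cabs_ge0 ?sqr_ge0.
have : L * M <= L * M * weight x by rewrite ler_peMr// mulr_ge0.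
nra.
Qed.

Lemma chosen_primitive_rhs1 (u v : R -> R[i]) : bounded_measurable u -> bounded_measurable v ->
  cprimitive 0 pi (chosen_primitive (rhs1 u v)) (rhs1 u v) /\ chosen_primitive (rhs1 u v) 0 = 0.
Proof.
move=> [mu1 [M M0 MP]] [mv [N N0 NP]]; apply: chosen_primitiveP.
apply: (@cprimitive_exists _ (2 * (M + N))).
  by apply: cmeasurableD => //; apply: cmeasurableM => //; exact: potential_measurable.
move=> x xi; apply: rhs1_le.
  by apply: le_trans (MP _ xi) _; rewrite lerDl.
by apply: le_trans (NP _ xi) _; rewrite lerDr.
Qed.

Lemma chosen_primitive_rhs2 (u v w : R -> R[i]) :
  bounded_measurable u -> bounded_measurable v -> bounded_measurable w ->
  cprimitive 0 pi (chosen_primitive (rhs2 u v w)) (rhs2 u v w) /\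
  chosen_primitive (rhs2 u v w) 0 = 0.
Proof.
move=> [mu1 [M M0 MP]] [mv [N N0 NP]] [mw [K K0 KP]].
apply: chosen_primitiveP.
have ms := potential_measurable.
have mN h : cmeasurable h -> cmeasurable (fun x => - h x).
  move=> mh; rewrite (funext (fun x => esym (mulN1r (h x)))).
  by apply: cmeasurableM => //; exact: cmeasurable_cst.
apply: (@cprimitive_exists _ ((2 + 1) * (M + N + K))).
  apply: cmeasurableD; last exact: mN.
  apply: cmeasurableD; apply: mN; apply: cmeasurableM => //.
  by rewrite (funext (fun x => expr2 (s x))); exact: cmeasurableM.
move=> x xi; apply: rhs2_le => //; rewrite ?mul1r.
- by apply: le_trans (MP _ xi) _; lra.
- by apply: le_trans (NP _ xi) _; lra.
- by apply: le_trans (KP _ xi) _; lra.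
Qed.

Variables c d : R[i].

(** [picard n] gives the coefficient of [lambda ^ j] in the [n]-th Picard
    increment of both components.  That increment has degree at most [n] in
    [lambda]; the higher coefficients are set to 0 because a chosen primitive of
    0 is unspecified outside of the interval. *)
Fixpoint picard (n : nat) : (nat -> R -> R[i]) * (nat -> R -> R[i]) :=
  if n is m.+1 then
    let: (u, v) := picard m in
    ((fun j => if (j <= n)%N then chosen_primitive (rhs1 (u j) (v j)) else fun=> 0),
     (fun j => if (j <= n)%N then
        chosen_primitive (rhs2 (u j) (v j) (if j is k.+1 then u k else fun=> 0)) else fun=> 0))
  else ((fun j => fun=> if j is 0 then c else 0),
        (fun j => fun=> if j is 0 then d else 0)).

Definition picard_y n x : {poly R[i]} := \poly_(j < n.+1) (picard n).1 j x.
Definition picard_y1 n x : {poly R[i]} := \poly_(j < n.+1) (picard n).2 j x.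

Lemma picard_spec n :
  (forall j, bounded_measurable ((picard n).1 j) /\ bounded_measurable ((picard n).2 j)) /\
  (forall j x, (n < j)%N -> (picard n).1 j x = 0 /\ (picard n).2 j x = 0).
Proof.
elim: n => [|n [IH1 IH2]].
  by split=> [j|[|j] x]//; split; exact: bounded_measurable_cst.
rewrite /=; case: (picard n) IH1 IH2 => u v /= IH1 IH2; split.
  move=> j; case: ifP => _; last by split; exact: bounded_measurable_cst.
  have [nu nv] := IH1 j; split.
    by have [p _] := chosen_primitive_rhs1 nu nv; exact: cprimitive_bounded_measurable p.
  have nw : bounded_measurable (if j is k.+1 then u k else fun=> 0).
    by case: (j) => [|k]; [exact: bounded_measurable_cst|exact: (IH1 k).1].
  by have [p _] := chosen_primitive_rhs2 nu nv nw; exact: cprimitive_bounded_measurable p.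
by move=> j x nj; rewrite leqNgt nj.
Qed.

Lemma picard_poly0 x : picard_y 0 x = c%:P /\ picard_y1 0 x = d%:P.
Proof. by split; apply/polyP => -[|i]; rewrite coef_poly coefC. Qed.

Lemma picard_step n (l : R[i]) :
  cprimitive 0 pi (fun x => (picard_y n.+1 x).[l])
    (rhs1 (fun x => (picard_y n x).[l]) (fun x => (picard_y1 n x).[l])) /\
  cprimitive 0 pi (fun x => (picard_y1 n.+1 x).[l])
    (rhs2 (fun x => (picard_y n x).[l]) (fun x => (picard_y1 n x).[l])
       (fun x => l * (picard_y n x).[l])) /\
  (picard_y n.+1 0).[l] = 0 /\ (picard_y1 n.+1 0).[l] = 0.
Proof.
have [nices zeros] := picard_spec n.
rewrite /picard_y /picard_y1 /=; case: (picard n) nices zeros => u v /= nices zeros.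
have uE (w : nat -> R -> R[i]) x : (forall j x, (n < j)%N -> w j x = 0) ->
    (\poly_(j < n.+1) w j x).[l] = \sum_(j < n.+2) w j x * l ^+ j.
  by move=> w0; rewrite horner_poly [RHS]big_ord_recr/= w0// mul0r addr0.
have {}uE1 x := uE u x (fun j y nj => (zeros j y nj).1).
have {}uE2 x := uE v x (fun j y nj => (zeros j y nj).2).
pose w j : R -> R[i] := if j is k.+1 then u k else fun=> 0.
have nw j : bounded_measurable (w j).
  by case: j => [|k]; [exact: bounded_measurable_cst|exact: (nices k).1].
have wE x : l * (\poly_(j < n.+1) u j x).[l] = \sum_(j < n.+2) w j x * l ^+ j.
  rewrite horner_poly mulr_sumr [RHS]big_ord_recl /= mul0r add0r.
  by apply: eq_bigr => j _; rewrite /bump/= exprS; ring.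
split; [|split; [|split]].
- rewrite (funext (fun x => horner_poly _ _ _)).
  apply: cprimitive_eq (@cprimitive_sum n.+2
    (fun j x => (if (j <= n.+1)%N then chosen_primitive (rhs1 (u j) (v j)) else fun=> 0) x * l ^+ j)
    (fun j x => l ^+ j * rhs1 (u j) (v j) x) _) _.
    move=> j; rewrite ltnS => ->.
    rewrite (funext (fun x => mulrC _ _)).
    by apply: cprimitiveZ => //; have [nu nv] := nices j; exact: (chosen_primitive_rhs1 nu nv).1.
  move=> x _; rewrite /rhs1 uE1 uE2 mulr_sumr -big_split.
  by apply: eq_bigr => j _ /=; ring.
- rewrite (funext (fun x => horner_poly _ _ _)).
  apply: cprimitive_eq (@cprimitive_sum n.+2
    (fun j x => (if (j <= n.+1)%N then chosen_primitive (rhs2 (u j) (v j) (w j)) else fun=> 0) x * l ^+ j)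
    (fun j x => l ^+ j * rhs2 (u j) (v j) (w j) x) _) _.
    move=> j; rewrite ltnS => ->.
    rewrite (funext (fun x => mulrC _ _)).
    by apply: cprimitiveZ => //; have [nu nv] := nices j; exact: (chosen_primitive_rhs2 nu nv (nw j)).1.
  move=> x _; rewrite /rhs2 wE uE1 uE2 !mulr_sumr -!sumrN -!big_split.
  by apply: eq_bigr => j _ /=; ring.
- rewrite horner_poly big1// => j _; rewrite -ltnS ltn_ord.
  by have [nu nv] := nices j; rewrite (chosen_primitive_rhs1 nu nv).2 mul0r.
- rewrite horner_poly big1// => j _; rewrite -ltnS ltn_ord.
  by have [nu nv] := nices j; rewrite (chosen_primitive_rhs2 nu nv (nw j)).2 mul0r.
Qed.

End Picard.

(** * Convergence of the Picard iteration *)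
Section Telescoping.
Context {R : realType}.

(** [x n - t n] increases and [x n + t n] decreases, so the supremum of the
    former is squeezed between them. *)
Lemma telescoping_limit (x t : nat -> R) :
  (forall n, 0 <= t n) -> (forall n, `|x n.+1 - x n| <= t n - t n.+1) ->
  exists w, forall n, `|w - x n| <= t n.
Proof.
move=> t0 xt.
have mono n m : (n <= m)%N -> `|x m - x n| <= t n - t m.
  elim: m => [|m IH]; first by rewrite leqn0 => /eqP->; rewrite !subrr normr0.
  rewrite leq_eqVlt => /predU1P[->|]; first by rewrite !subrr normr0.
  rewrite ltnS => /IH; have := xt m; have := ler_normD (x m.+1 - x m) (x m - x n).
  by rewrite addrA subrK; lra.
have le n m : x n - t n <= x m + t m.
  have [nm|/ltnW mn] := leqP n m.
    by move: (mono _ _ nm) (t0 m) (t0 n); rewrite ler_norml => /andP[]; lra.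
  by move: (mono _ _ mn) (t0 m) (t0 n); rewrite ler_norml => /andP[]; lra.
pose A := range (fun n => x n - t n).
have hs : has_sup A.
  by split; [exists (x 0%N - t 0%N), 0%N|exists (x 0%N + t 0%N) => _ [n _ <-]; exact: le].
exists (sup A) => n.
have h1 : x n - t n <= sup A by apply: (ub_le_sup hs.2); exists n.
have h2 : sup A <= x n + t n by apply: ge_sup => [|_ [m _ <-]]; [exact: hs.1|exact: le].
by rewrite ler_norml; apply/andP; split; lra.
Qed.

Lemma telescoping_climit (z : nat -> R[i]) (t : nat -> R) :
  (forall n, 0 <= t n) -> (forall n, cabs (z n.+1 - z n) <= t n - t n.+1) ->
  exists w, forall n, cabs (w - z n) <= 2 * t n.
Proof.
move=> t0 zt.
have [|w1 w1P] := telescoping_limit (x := fun n => re (z n)) t0.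
  by move=> n; rewrite -reN -reD; apply: le_trans (zt n); exact: ler_re_cabs.
have [|w2 w2P] := telescoping_limit (x := fun n => im (z n)) t0.
  by move=> n; rewrite -imN -imD; apply: le_trans (zt n); exact: ler_im_cabs.
exists (w1 +i* w2) => n; apply: le_trans (cabs_le_reim _) _.
by rewrite !reimE/=; have := w1P n; have := w2P n; lra.
Qed.

(** The increments [a ^ n / n!] of the Picard iteration telescope to the tail of
    the exponential series, which bounds the distance to the limit. *)
Definition exp_tail (a : R) (n : nat) : R := expR a - series (exp_coeff a) n.

Lemma exp_tailS a n : exp_tail a n - exp_tail a n.+1 = a ^+ n / n`!%:R.
Proof.
by rewrite /exp_tail /series/= big_nat_recr//= /exp_coeff/=; ring.
Qed.

Lemma exp_tail_ge0 a n : 0 <= a -> 0 <= exp_tail a n.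
Proof.
move=> a0; rewrite subr_ge0; apply: nondecreasing_cvgn_le.
  by apply: nondecreasing_series => k _ _; exact: exp_coeff_ge0.
exact: is_cvg_series_exp_coeff.
Qed.

Lemma exp_tail_small a e : 0 <= a -> 0 < e -> exists n, forall m, (n <= m)%N -> exp_tail a m <= e.
Proof.
move=> a0 e0.
have /cvgrPdist_le /(_ _ e0) [n _ nP] : series (exp_coeff a) @ \oo --> expR a.
  exact: is_cvg_series_exp_coeff.
exists n => m /nP; apply: le_trans; exact: ler_norm.
Qed.

Lemma primitiveX (a b : R) (F f : R -> R) n : a <= b -> primitive a b F f ->
  primitive a b (fun x => F x ^+ n.+1) (fun x => n.+1%:R * (f x * F x ^+ n)).
Proof.
move=> ab pF; elim: n => [|n IH].
  by apply: primitive_eq pF _ => x _; rewrite expr0 mulr1 mul1r.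
rewrite (funext (fun x => exprS (F x) _)).
apply: primitive_eq (primitiveM ab pF IH) _ => x _.
by rewrite -[n.+2%:R]natr1 !exprS; ring.
Qed.

Lemma le_small (x A : R) : 0 <= A -> (forall e, 0 < e -> x <= A * e) -> x <= 0.
Proof.
move=> A0 H; apply/ler_addgt0Pr => e e0; rewrite add0r.
have A1 : 0 < A + 1 by lra.
have := H (e / (A + 1)) (divr_gt0 e0 A1); move/le_trans; apply.
by rewrite mulrCA ler_piMr ?(ltW e0)// ler_pdivrMr//; lra.
Qed.

End Telescoping.

Section PicardLimit.
Context {R : realType}.
Local Notation pi := (@pi R).
Variable s : R -> R[i].
Hypothesis sL2 : L2_0pi s.
Variables c d : R[i].
Variable N : R -> R.
Hypothesis pN : primitive 0 pi N (weight s).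
Hypothesis N0 : N 0 = 0.

Let pi0 : 0 <= pi. Proof. exact: ltW (pi_gt0 _). Qed.
Let K : R := cabs c + cabs d.
Let K0 : 0 <= K. Proof. by rewrite addr_ge0 ?cabs_ge0. Qed.
Local Notation u n x l := ((picard_y s c d n x).[l]).
Local Notation v n x l := ((picard_y1 s c d n x).[l]).

Let N_mono x y : 0 <= x -> x <= y -> y <= pi -> N x <= N y.
Proof.
move=> x0 xy ypi; apply: (primitive_ge0 pN) => //.
by apply: aeW => z _; rewrite /weight addr_ge0// sqr_ge0.
Qed.

Let N_ge0 x : 0 <= x <= pi -> 0 <= N x.
Proof. by case/andP => x0 xpi; rewrite -[leLHS]N0; exact: N_mono. Qed.

(** The right-hand sides at level [n] are at most [(2 + L) weight] times the
    bound for level [n], and [weight * N ^ n / n!] has the primitive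
    [N ^ (n + 1) / (n + 1)!]. *)
Lemma picard_bound (L : R) (l : R[i]) n x : cabs l <= L -> 0 <= x <= pi ->
  cabs (u n x l) <= K * (((2 + L) * N x) ^+ n / n`!%:R) /\
  cabs (v n x l) <= K * (((2 + L) * N x) ^+ n / n`!%:R).
Proof.
move=> lL; have L0 : 0 <= L by apply: le_trans lL; rewrite cabs_ge0.
elim: n x => [|n IH] x /andP[x0 xpi].
  have [-> ->] := picard_poly0 s c d x.
  by rewrite !hornerC expr0 fact0 divr1 mulr1 lerDl lerDr !cabs_ge0.
have [dU [dV [U0 V0]]] := picard_step sL2 c d n l.
pose b y := K * (((2 + L) * N y) ^+ n / n`!%:R).
have H := primitiveZ (K * (2 + L) ^+ n.+1 / n.+1`!%:R) pi0 (primitiveX n pi0 pN).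
have nf : n`!%:R != 0 :> R by rewrite pnatr_eq0 -lt0n fact_gt0.
have hE y : K * (2 + L) ^+ n.+1 / n.+1`!%:R * (n.+1%:R * (weight s y * N y ^+ n)) =
    (2 + L) * b y * weight s y.
  rewrite /b factS natrM exprS exprMn; field.
  by rewrite nf addrC natr1 pnatr_eq0.
have HE y : K * (2 + L) ^+ n.+1 / n.+1`!%:R * N y ^+ n.+1 =
    K * (((2 + L) * N y) ^+ n.+1 / n.+1`!%:R) by rewrite exprMn; ring.
have w0 y : 0 <= weight s y by rewrite addr_ge0// sqr_ge0.
have bP y : y \in `]0, pi[ -> cabs (u n y l) <= b y /\ cabs (v n y l) <= b y.
  by rewrite in_itv/= => /andP[y0 ypi]; apply: IH; rewrite !ltW.
have b0 y : y \in `]0, pi[ -> 0 <= b y.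
  by move=> /bP[h _]; apply: le_trans h; rewrite cabs_ge0.
split.
- have := cprimitive_le pi0 dU H _ (lexx 0) x0 xpi.
  rewrite U0 subr0 !HE N0 mulr0 [0 ^+ _]expr0n/= mul0r mulr0 subr0; apply.
  apply: aeW => y yi; rewrite hE; have [h1 h2] := bP y yi.
  apply: (@le_trans _ _ (2 * b y * weight s y)); first exact: rhs1_le.
  by rewrite ler_wpM2r ?w0// ler_wpM2r ?b0//; lra.
- have := cprimitive_le pi0 dV H _ (lexx 0) x0 xpi.
  rewrite V0 subr0 !HE N0 mulr0 [0 ^+ _]expr0n/= mul0r mulr0 subr0; apply.
  apply: aeW => y yi; rewrite hE; have [h1 h2] := bP y yi.
  by apply: rhs2_le => //; rewrite cabsM ler_pM ?cabs_ge0.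
Qed.

Definition picard_sum_y n x : {poly R[i]} := \sum_(k < n) picard_y s c d k x.
Definition picard_sum_y1 n x : {poly R[i]} := \sum_(k < n) picard_y1 s c d k x.

Let tail (L : R) n : R := K * exp_tail ((2 + L) * N pi) n.

Let tail_ge0 L n : 0 <= L -> 0 <= tail L n.
Proof.
move=> L0; rewrite mulr_ge0// exp_tail_ge0// mulr_ge0//; first lra.
by rewrite N_ge0// lexx pi0.
Qed.

Let tail_small L e : 0 <= L -> 0 < e ->
  exists n, forall m, (n <= m)%N -> tail L m <= K * e.
Proof.
move=> L0 e0.
have a0 : 0 <= (2 + L) * N pi by rewrite mulr_ge0 ?N_ge0 ?lexx ?pi0//; lra.
have [n nP] := exp_tail_small a0 e0.
by exists n => m nm; rewrite /tail ler_wpM2l// nP.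
Qed.

Let term_tail (L : R) (l : R[i]) n x : cabs l <= L -> 0 <= x <= pi ->
  cabs (u n x l) <= tail L n - tail L n.+1 /\
  cabs (v n x l) <= tail L n - tail L n.+1.
Proof.
move=> lL xpi; have L0 : 0 <= L by apply: le_trans lL; rewrite cabs_ge0.
have [h1 h2] := picard_bound n lL xpi.
have : K * (((2 + L) * N x) ^+ n / n`!%:R) <= tail L n - tail L n.+1.
  rewrite /tail -mulrBr exp_tailS ler_wpM2l// ler_wpM2r ?invr_ge0//.
  apply: lerXn2r; rewrite ?nnegrE ?mulr_ge0 ?N_ge0 ?lexx ?pi0//; try lra.
  by case/andP: xpi => x0 xpi; rewrite ler_wpM2l ?N_mono//; lra.
by move=> h; split; [apply: le_trans h1 h|apply: le_trans h2 h].
Qed.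

Let sumS n x l : (picard_sum_y n.+1 x).[l] = (picard_sum_y n x).[l] + u n x l /\
  (picard_sum_y1 n.+1 x).[l] = (picard_sum_y1 n x).[l] + v n x l.
Proof. by rewrite /picard_sum_y /picard_sum_y1 !big_ord_recr /= !hornerD. Qed.

(** The limit is taken for each [l] with the bound belonging to [|l|], and then
    identified with the one for any larger [L], which makes the convergence
    uniform on discs. *)
Lemma picard_limit l x : exists w : R[i] * R[i], 0 <= x <= pi ->
  forall L n, cabs l <= L ->
  cabs (w.1 - (picard_sum_y n x).[l]) <= 2 * tail L n /\
  cabs (w.2 - (picard_sum_y1 n x).[l]) <= 2 * tail L n.
Proof.
have [xpi|nx] := pselect (0 <= x <= pi); last by exists (0, 0).
have tp L : cabs l <= L -> forall n, 0 <= tail L n.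
  by move=> lL n; apply: tail_ge0; apply: le_trans lL; rewrite cabs_ge0.
have lim (z : nat -> R[i]) : (forall L n, cabs l <= L ->
     cabs (z n.+1 - z n) <= tail L n - tail L n.+1) ->
  exists w, forall L n, cabs l <= L -> cabs (w - z n) <= 2 * tail L n.
  move=> zP.
  have [w wP] := telescoping_climit (tp _ (lexx _)) (fun n => zP _ n (lexx (cabs l))).
  exists w => L n lL.
  have [w' w'P] := telescoping_climit (tp _ lL) (fun n => zP _ n lL).
  suff -> : w = w' by [].
  apply/eqP; rewrite -subr_eq0 -cabs_eq0 eq_le cabs_ge0 andbT.
  apply: (@le_small _ _ (4 * K)) => [|e e0]; first by rewrite mulr_ge0.
  have [n1 n1P] := tail_small (cabs_ge0 l) e0.
  have L0 : 0 <= L by apply: le_trans lL; rewrite cabs_ge0.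
  have [n2 n2P] := tail_small L0 e0.
  pose m := maxn n1 n2.
  have := n1P m (leq_maxl _ _); have := n2P m (leq_maxr _ _).
  have := wP m; have := w'P m; have := cabsB (w - z m) (w' - z m).
  by rewrite opprB addrA subrK; lra.
have [|w1 w1P] := lim (fun n => (picard_sum_y n x).[l]).
  by move=> L n lL; rewrite (sumS n x l).1 addrC addKr; exact: (term_tail n lL xpi).1.
have [|w2 w2P] := lim (fun n => (picard_sum_y1 n x).[l]).
  by move=> L n lL; rewrite (sumS n x l).2 addrC addKr; exact: (term_tail n lL xpi).2.
by exists (w1, w2) => _ L n lL; split; [exact: w1P|exact: w2P].
Qed.

Let sum_derive n l :
  cprimitive 0 pi (fun x => (picard_sum_y n.+1 x).[l])
    (rhs1 s (fun x => (picard_sum_y n x).[l]) (fun x => (picard_sum_y1 n x).[l])) /\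
  cprimitive 0 pi (fun x => (picard_sum_y1 n.+1 x).[l])
    (rhs2 s (fun x => (picard_sum_y n x).[l]) (fun x => (picard_sum_y1 n x).[l])
       (fun x => l * (picard_sum_y n x).[l])).
Proof.
elim: n => [|n [IH1 IH2]].
  have E x : (picard_sum_y 1 x).[l] = c /\ (picard_sum_y1 1 x).[l] = d.
    rewrite /picard_sum_y /picard_sum_y1 !big_ord1; have [-> ->] := picard_poly0 s c d x.
    by rewrite !hornerC.
  have Z x : (picard_sum_y 0 x).[l] = 0 /\ (picard_sum_y1 0 x).[l] = 0.
    by rewrite /picard_sum_y /picard_sum_y1 !big_ord0 horner0.
  rewrite (funext (fun x => (E x).1)) (funext (fun x => (E x).2)).
  by split; apply: cprimitive_eq (cprimitive_cst _ _ _) _ => x _;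
    rewrite /rhs1 /rhs2 (Z x).1 (Z x).2; ring.
have [dU [dV _]] := picard_step sL2 c d n l.
rewrite (funext (fun x => (sumS n.+1 x l).1)) (funext (fun x => (sumS n.+1 x l).2)).
split.
  apply: cprimitive_eq (cprimitiveD IH1 dU) _ => x _.
  by rewrite /rhs1 (sumS n x l).1 (sumS n x l).2; ring.
apply: cprimitive_eq (cprimitiveD IH2 dV) _ => x _.
by rewrite /rhs2 (sumS n x l).1 (sumS n x l).2; ring.
Qed.

Let sum0 n l : (picard_sum_y n.+1 0).[l] = c /\ (picard_sum_y1 n.+1 0).[l] = d.
Proof.
elim: n => [|n [IH1 IH2]].
  rewrite /picard_sum_y /picard_sum_y1 !big_ord1; have [-> ->] := picard_poly0 s c d 0.
  by rewrite !hornerC.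
have [_ [_ [U0 V0]]] := picard_step sL2 c d n l.
by rewrite (sumS n.+1 0 l).1 (sumS n.+1 0 l).2 IH1 IH2 U0 V0 !addr0.
Qed.

(** The limit [Y] inherits from the partial sums a Lipschitz bound with respect
    to [N], so the right-hand sides with [Y] have primitives.  These are within
    the same distance of the partial sums, hence equal to [Y] on the
    interval. *)
Lemma picard_solution l (Y Y1 : R -> R[i]) :
  (forall x, 0 <= x <= pi -> forall L n, cabs l <= L ->
    cabs (Y x - (picard_sum_y n x).[l]) <= 2 * tail L n /\
    cabs (Y1 x - (picard_sum_y1 n x).[l]) <= 2 * tail L n) ->
  exists y y1 : R -> R[i],
   [/\ cprimitive 0 pi y (rhs1 s y y1),
       cprimitive 0 pi y1 (rhs2 s y y1 (fun x => l * y x)),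
       y 0 = c, y1 0 = d &
       forall x, 0 <= x <= pi -> y x = Y x /\ y1 x = Y1 x].
Proof.
move=> YP; pose L := cabs l.
have L0 : 0 <= L by rewrite cabs_ge0.
have YL x n : 0 <= x <= pi ->
    cabs (Y x - (picard_sum_y n x).[l]) <= 2 * tail L n /\
    cabs (Y1 x - (picard_sum_y1 n x).[l]) <= 2 * tail L n.
  by move=> xpi; exact: YP.
have NP : 0 <= N pi by rewrite N_ge0// lexx pi0.
have tail0 n : tail L n <= tail L 0.
  elim: n => // n; apply: le_trans.
  rewrite -subr_ge0 /tail -mulrBr exp_tailS !mulr_ge0 ?invr_ge0 ?exprn_ge0//.
  by rewrite mulr_ge0//; lra.
pose B := 4 * tail L 0.
have YB x : 0 <= x <= pi -> cabs (Y x) <= B /\ cabs (Y1 x) <= B.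
  move=> xpi; have := YL x 0%N xpi.
  rewrite /picard_sum_y /picard_sum_y1 !big_ord0 !horner0 !subr0 => -[h1 h2].
  by have := tail_ge0 0 L0; rewrite /B; lra.
have SB x n : 0 <= x <= pi ->
    cabs (picard_sum_y n x).[l] <= B /\ cabs (picard_sum_y1 n x).[l] <= B.
  move=> xpi; have := YL x n xpi => -[h1 h2].
  have := YL x 0%N xpi; rewrite /picard_sum_y /picard_sum_y1 !big_ord0 !horner0 !subr0 => -[h3 h4].
  have := cabsB (Y x) (Y x - (picard_sum_y n x).[l]).
  have := cabsB (Y1 x) (Y1 x - (picard_sum_y1 n x).[l]).
  by rewrite !subKr /B; have := tail0 n; split; lra.
have itvP x : x \in `]0, pi[ -> 0 <= x <= pi.
  by rewrite in_itv/= => /andP[? ?]; rewrite !ltW.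
have w0 y : 0 <= weight s y by rewrite addr_ge0// sqr_ge0.
have B0 : 0 <= B by rewrite mulr_ge0 ?tail_ge0.
have lip x y : 0 <= x -> x <= y -> y <= pi ->
   cabs (Y y - Y x) <= (2 + L) * B * (N y - N x) /\
   cabs (Y1 y - Y1 x) <= (2 + L) * B * (N y - N x).
  move=> x0 xy ypi.
  have H := primitiveZ ((2 + L) * B) pi0 pN.
  have xpi : 0 <= x <= pi by rewrite x0 (le_trans xy).
  have ypi' : 0 <= y <= pi by rewrite (le_trans x0).
  have step n : 
     cabs ((picard_sum_y n.+1 y).[l] - (picard_sum_y n.+1 x).[l]) <= (2 + L) * B * (N y - N x) /\
     cabs ((picard_sum_y1 n.+1 y).[l] - (picard_sum_y1 n.+1 x).[l]) <= (2 + L) * B * (N y - N x).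
    have [d1 d2] := sum_derive n l.
    rewrite mulrBr; split.
      apply: (cprimitive_le pi0 d1 H) => //; apply: aeW => z /itvP zi.
      have [h1 h2] := SB z n zi; apply: (@le_trans _ _ (2 * B * weight s z)); first exact: rhs1_le.
      by rewrite ler_wpM2r ?w0// ler_wpM2r//; lra.
    apply: (cprimitive_le pi0 d2 H) => //; apply: aeW => z /itvP zi.
    have [h1 h2] := SB z n zi; apply: rhs2_le => //.
    by rewrite cabsM ler_pM ?cabs_ge0.
  split; rewrite -subr_le0; apply: (@le_small _ _ (4 * K)); rewrite ?mulr_ge0// => e e0;
    have [n nP] := tail_small L0 e0; have := nP n.+1 (leqnSn n);
    have := (step n); have := YL x n.+1 xpi; have := YL y n.+1 ypi'.
    move=> [h1 _] [h2 _] [h3 _] h4.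
    have := cabsD (Y y - (picard_sum_y n.+1 y).[l]) ((picard_sum_y n.+1 y).[l] - Y x).
    have := cabsB ((picard_sum_y n.+1 y).[l] - (picard_sum_y n.+1 x).[l]) (Y x - (picard_sum_y n.+1 x).[l]).
    by rewrite opprB !addrA !subrK; lra.
  move=> [_ h1] [_ h2] [_ h3] h4.
  have := cabsD (Y1 y - (picard_sum_y1 n.+1 y).[l]) ((picard_sum_y1 n.+1 y).[l] - Y1 x).
  have := cabsB ((picard_sum_y1 n.+1 y).[l] - (picard_sum_y1 n.+1 x).[l]) (Y1 x - (picard_sum_y1 n.+1 x).[l]).
  by rewrite opprB !addrA !subrK; lra.
have LB0 : 0 <= (2 + L) * B by rewrite mulr_ge0//; lra.
have niceY (Z : R -> R[i]) : (forall x, 0 <= x <= pi -> cabs (Z x) <= B) ->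
    (forall x y, 0 <= x -> x <= y -> y <= pi ->
      cabs (Z y - Z x) <= (2 + L) * B * (N y - N x)) -> bounded_measurable Z.
  move=> ZB Zlip.
  have Zlip2 x y : 0 <= x <= pi -> 0 <= y <= pi ->
      cabs (Z y - Z x) <= (2 + L) * B * (`|N y - N x| + `|N y - N x|).
    move=> /andP[x0 xpi] /andP[y0 ypi].
    have [xy|/ltW yx] := leP x y.
      apply: le_trans (Zlip _ _ x0 xy ypi) _; rewrite ler_wpM2l//.
      by rewrite ler_wpDr// ler_norm.
    rewrite cabs_distC; apply: le_trans (Zlip _ _ y0 yx xpi) _; rewrite ler_wpM2l//.
    by rewrite ler_wpDr// distrC ler_norm.
  split; last by exists B => // x /itvP; exact: ZB.
  have [acN _] := pN.
  split; apply: abs_continuous_measurable; apply: (abs_continuous_lip2 acN acN LB0);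
    move=> x y xi yi; apply: le_trans (Zlip2 _ _ xi yi).
    by rewrite -reN -reD ler_re_cabs.
  by rewrite -imN -imD ler_im_cabs.
have nY : bounded_measurable Y.
  by apply: niceY => [x /YB[]//|x y x0 xy ypi]; exact: (lip x y x0 xy ypi).1.
have nY1 : bounded_measurable Y1.
  by apply: niceY => [x /YB[]//|x y x0 xy ypi]; exact: (lip x y x0 xy ypi).2.
have nlY : bounded_measurable (fun x => l * Y x).
  have [mY [M M0 MP]] := nY; split; first exact: cmeasurableM (cmeasurable_cst l) mY.
  exists (cabs l * M) => [|x xi]; first by rewrite mulr_ge0 ?cabs_ge0.
  by rewrite cabsM ler_wpM2l ?cabs_ge0 ?MP.
have [p1 p10] := chosen_primitive_rhs1 sL2 nY nY1.
have [p2 p20] := chosen_primitive_rhs2 sL2 nY nY1 nlY.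
set F1 := chosen_primitive _ in p1 p10; set F2 := chosen_primitive _ in p2 p20.
have key x : 0 <= x <= pi -> c + F1 x = Y x /\ d + F2 x = Y1 x.
  move=> xpi; have /andP[x0 xpi'] := xpi.
  have est n : cabs (c + F1 x - (picard_sum_y n.+1 x).[l]) <= (2 + L) * (2 * tail L n) * N x /\
     cabs (d + F2 x - (picard_sum_y1 n.+1 x).[l]) <= (2 + L) * (2 * tail L n) * N x.
    have [d1 d2] := sum_derive n l.
    have H := primitiveZ ((2 + L) * (2 * tail L n)) pi0 pN.
    have t0 : 0 <= 2 * tail L n by rewrite mulr_ge0 ?tail_ge0.
    split.
      have := cprimitive_le pi0 (cprimitiveB pi0 p1 d1) H _ (lexx 0) x0 xpi'.
      rewrite N0 mulr0 subr0 p10 (sum0 n l).1 sub0r opprK.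
      rewrite (_ : F1 x - _ + c = c + F1 x - (picard_sum_y n.+1 x).[l]); last by ring.
      apply; apply: aeW => z /itvP zi.
      have [h1 h2] := YL z n zi.
      rewrite (_ : _ - _ = rhs1 s (fun x => Y x - (picard_sum_y n x).[l]) (fun x => Y1 x - (picard_sum_y1 n x).[l]) z);
        last by rewrite /rhs1; ring.
      apply: (@le_trans _ _ (2 * (2 * tail L n) * weight s z)); first exact: rhs1_le.
      by rewrite ler_wpM2r ?w0// ler_wpM2r//; lra.
    have := cprimitive_le pi0 (cprimitiveB pi0 p2 d2) H _ (lexx 0) x0 xpi'.
    rewrite N0 mulr0 subr0 p20 (sum0 n l).2 sub0r opprK.
    rewrite (_ : F2 x - _ + d = d + F2 x - (picard_sum_y1 n.+1 x).[l]); last by ring.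
    apply; apply: aeW => z /itvP zi.
    have [h1 h2] := YL z n zi.
    rewrite (_ : _ - _ = rhs2 s (fun x => Y x - (picard_sum_y n x).[l]) (fun x => Y1 x - (picard_sum_y1 n x).[l])
         (fun x => l * (Y x - (picard_sum_y n x).[l])) z); last by rewrite /rhs2; ring.
    by apply: rhs2_le => //; rewrite cabsM ler_pM ?cabs_ge0.
  have Nx := N_ge0 xpi.
  have L2 : 0 <= 2 + L by rewrite addr_ge0.
  have A0 : 0 <= (2 + L) * N x by rewrite mulr_ge0.
  split; apply/eqP; rewrite -subr_eq0 -cabs_eq0 eq_le cabs_ge0 andbT;
    apply: (@le_small _ _ (2 * ((2 + L) * N x) * K + 2 * K));
    rewrite ?addr_ge0 ?mulr_ge0// => e e0;
    have [n nP] := tail_small L0 e0; have t1 := nP n.+1 (leqnSn n);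
    have t2 := nP n (leqnn n); have [e1 e2] := est n;
    have [h1 h2] := YL x n.+1 xpi; have t3 := ler_wpM2l A0 t2.
    have := cabsB (c + F1 x - (picard_sum_y n.+1 x).[l]) (Y x - (picard_sum_y n.+1 x).[l]).
    by rewrite opprB addrA subrK; lra.
  have := cabsB (d + F2 x - (picard_sum_y1 n.+1 x).[l]) (Y1 x - (picard_sum_y1 n.+1 x).[l]).
  by rewrite opprB addrA subrK; lra.
exists (fun x => c + F1 x), (fun x => d + F2 x); split.
- apply: cprimitive_eq (cprimitiveD (cprimitive_cst _ _ c) p1) _ => x /itvP/key[h1 h2].
  by rewrite /rhs1 h1 h2 add0r.
- apply: cprimitive_eq (cprimitiveD (cprimitive_cst _ _ d) p2) _ => x /itvP/key[h1 h2].
  by rewrite /rhs2 h1 h2 add0r.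
- by rewrite p10 addr0.
- by rewrite p20 addr0.
- exact: key.
Qed.

(** At each [x] the Picard partial sums are polynomials in [lambda] that converge
    uniformly on discs, so the solutions with data [c], [d] at 0 are entire in
    [lambda]. *)
Lemma picard_entire : exists y y1 : R -> R[i] -> R[i],
  (forall l, [/\ cprimitive 0 pi (y^~ l) (rhs1 s (y^~ l) (y1^~ l)),
       cprimitive 0 pi (y1^~ l) (rhs2 s (y^~ l) (y1^~ l) (fun x => l * y x l)),
       y 0 l = c & y1 0 l = d]) /\
  (forall x, 0 <= x <= pi -> entire (y x) /\ entire (y1 x)).
Proof.
have [W WP] := choice (fun lx : R[i] * R => picard_limit lx.1 lx.2).
have [Z ZP] := choice (fun l => 
  match picard_solution (fun x xpi L n lL => WP (l, x) xpi L n lL) with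
  | ex_intro y (ex_intro y1 h) => ex_intro (fun z : (R -> R[i]) * (R -> R[i]) => 
   [/\ cprimitive 0 pi z.1 (rhs1 s z.1 z.2),
       cprimitive 0 pi z.2 (rhs2 s z.1 z.2 (fun x => l * z.1 x)),
       z.1 0 = c, z.2 0 = d &
       forall x, 0 <= x <= pi -> z.1 x = (W (l, x)).1 /\ z.2 x = (W (l, x)).2]) (y, y1) h end).
exists (fun x l => (Z l).1 x), (fun x l => (Z l).2 x); split.
  by move=> l; have [h1 h2 h3 h4 _] := ZP l; split.
move=> x xpi; split=> L e e0.
  pose L' := Num.max 0 L.
  have L0 : 0 <= L' by rewrite le_max lexx.
  have K1 : 0 < 2 * K + 1 by rewrite ltr_wpDl// mulr_ge0.
  have [n nP] := tail_small L0 (divr_gt0 e0 K1).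
  exists (picard_sum_y n x) => z zL; have [_ _ _ _ /(_ x xpi)[-> _]] := ZP z.
  have /= := WP (z, x) xpi L' n _; rewrite le_max zL orbT => /(_ isT)[h _].
  apply: le_trans h _.
  have := nP n (leqnn n); rewrite mulrA ler_pdivlMr// => h.
  rewrite -(ler_pM2r K1); have : 0 <= K * e by rewrite mulr_ge0// ltW.
  have := tail_ge0 n L0; lra.
pose L' := Num.max 0 L.
have L0 : 0 <= L' by rewrite le_max lexx.
have K1 : 0 < 2 * K + 1 by rewrite ltr_wpDl// mulr_ge0.
have [n nP] := tail_small L0 (divr_gt0 e0 K1).
exists (picard_sum_y1 n x) => z zL; have [_ _ _ _ /(_ x xpi)[_ ->]] := ZP z.
have /= := WP (z, x) xpi L' n _; rewrite le_max zL orbT => /(_ isT)[_ h].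
apply: le_trans h _.
have := nP n (leqnn n); rewrite mulrA ler_pdivlMr// => h.
rewrite -(ler_pM2r K1); have : 0 <= K * e by rewrite mulr_ge0// ltW.
have := tail_ge0 n L0; lra.
Qed.

End PicardLimit.

(** * Energy estimates for the first-order system *)
Section Gronwall.
Context {R : realType}.
Notation mu := (@lebesgue_measure R).

(** [E exp (- G)] decreases and [E exp G] increases. *)
Lemma gronwall (a b : R) (E e G g : R -> R) : a <= b ->
  primitive a b E e -> primitive a b G g ->
  {ae mu, forall x, x \in `]a, b[ -> `|e x| <= g x * E x} ->
  forall u v, a <= u -> u <= v -> v <= b ->
  E v <= E u * expR (G v - G u) /\ E u <= E v * expR (G v - G u).
Proof.
move=> ab pE pG eg u v au uv vb.
have pNG := primitiveZ (-1) ab pG.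
have pe1 := primitive_expR ab pNG.
have pe2 := primitive_expR ab pG.
have p1 := primitiveZ (-1) ab (primitiveM ab pE pe1).
have p2 := primitiveM ab pE pe2.
split.
  have /(primitive_ge0 p1) /(_ u v au uv vb) : {ae mu, forall x, x \in `]a, b[ ->
      0 <= -1 * (e x * expR (-1 * G x) + E x * (-1 * g x * expR (-1 * G x)))}.
    apply: ae_imply eg => x h /h; rewrite ler_norml => /andP[_ h2].
    rewrite (_ : -1 * _ = (g x * E x - e x) * expR (-1 * G x)); last by ring.
    by rewrite mulr_ge0 ?expR_ge0// subr_ge0.
  rewrite !mulN1r lerN2 !expRN => H.
  rewrite expRD expRN mulrCA mulrC -ler_pdivrMr ?expR_gt0//.
have /(primitive_ge0 p2) /(_ u v au uv vb) : {ae mu, forall x, x \in `]a, b[ ->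
    0 <= e x * expR (G x) + E x * (g x * expR (G x))}.
  apply: ae_imply eg => x h /h; rewrite ler_norml => /andP[h1 _].
  rewrite (_ : _ + _ = (e x + g x * E x) * expR (G x)); last by ring.
  by rewrite mulr_ge0 ?expR_ge0//; lra.
by rewrite expRD expRN mulrA ler_pdivlMr ?expR_gt0.
Qed.

End Gronwall.

(** The coupling terms of the energy estimates, with [S = |sigma|], [Y = |y|] and
    [P], [Q] the moduli of the two components.  The free parameters [a] and [b]
    decide how much is charged to [P] and how much to [|sigma|^2], which is
    integrable. *)
Lemma young_cross (R : realType) (a b k S P Q X Y : R) :
  0 < b -> b <= a -> b <= k -> 0 <= S -> 0 <= P -> 0 <= Q -> 0 <= X -> 0 <= Y ->
  X ^+ 2 <= P ^+ 2 + Q ^+ 2 -> k * (2 * Y) <= P + Q ->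
  2 * (S * (P * Q) + S ^+ 2 * (X * Y)) <=
  a * P ^+ 2 + S ^+ 2 * (3 * (P ^+ 2 + Q ^+ 2) / b).
Proof.
move=> b0 ba bk S0 P0 Q0 X0 Y0 XE kY.
have h1 : 2 * (S * (P * Q)) <= b * P ^+ 2 + S ^+ 2 * Q ^+ 2 / b.
  rewrite -subr_ge0 (_ : _ - _ = (b * P - S * Q) ^+ 2 / b); last by field; lra.
  by rewrite divr_ge0 ?sqr_ge0// ltW.
have h2 : 2 * (X * Y) <= 2 * (P ^+ 2 + Q ^+ 2) / b.
  rewrite ler_pdivlMr//.
  have bY : b * (2 * Y) <= P + Q.
    by apply: le_trans kY; rewrite ler_wpM2r// mulr_ge0.
  have := ler_wpM2l X0 bY.
  have := sqr_ge0 (X - (P + Q) / 2); have := sqr_ge0 (P - Q).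
  have := sqr_ge0 P; have := sqr_ge0 Q.
  by clear - XE; lra.
have h3 := ler_wpM2l (sqr_ge0 S) h2.
have h4 : b * P ^+ 2 <= a * P ^+ 2 by rewrite ler_wpM2r ?sqr_ge0.
have h5 : 0 <= S ^+ 2 * (P ^+ 2) / b by rewrite divr_ge0 ?(ltW b0)// mulr_ge0// sqr_ge0.
rewrite (_ : S ^+ 2 * (3 * (P ^+ 2 + Q ^+ 2) / b) = S ^+ 2 * P ^+ 2 / b
  + S ^+ 2 * Q ^+ 2 / b + S ^+ 2 * (2 * (P ^+ 2 + Q ^+ 2) / b)); last by ring.
clear - h1 h3 h4 h5; lra.
Qed.

Section Estimates.
Context {R : realType}.
Notation mu := (@lebesgue_measure R).
Local Notation pi := (@pi R).

Definition system_solution (s : R -> R[i]) (l : R[i]) (y y1 : R -> R[i]) : Prop :=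
  cprimitive 0 pi y (rhs1 s y y1) /\
  cprimitive 0 pi y1 (rhs2 s y y1 (fun x => l * y x)).

Lemma solution_system s l y y1 : solution s l y y1 -> system_solution s l y y1.
Proof.
move=> [acy acy1 qd eq]; split; split => //.
  apply: ae_imply qd => x h /h [dy dyP yE].
  by rewrite /rhs1 yE addrC subrK.
apply: ae_imply eq => x h /h [dy dyP yE].
rewrite /rhs2 -yE (_ : _ - _ = dy)//; ring.
Qed.

Lemma system_solutionD s l y y1 z z1 (a b : R[i]) :
  system_solution s l y y1 -> system_solution s l z z1 ->
  system_solution s l (fun x => a * y x + b * z x) (fun x => a * y1 x + b * z1 x).
Proof.
have pi0 : 0 <= pi by exact: ltW (pi_gt0 _).
move=> [y0 y1'] [z0 z1']; split.
  apply: cprimitive_eq (cprimitiveD (cprimitiveZ pi0 a y0) (cprimitiveZ pi0 b z0)) _.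
  by move=> x _; rewrite /rhs1; ring.
apply: cprimitive_eq (cprimitiveD (cprimitiveZ pi0 a y1') (cprimitiveZ pi0 b z1')) _.
by move=> x _; rewrite /rhs2; ring.
Qed.

Variable s : R -> R[i].
Variable N : R -> R.
Hypothesis pN : primitive 0 pi N (weight s).
Hypothesis N0 : N 0 = 0.

Let pi0 : 0 <= pi. Proof. exact: ltW (pi_gt0 _). Qed.
Let w := weight s.
Let w1 x : 1 <= w x. Proof. by rewrite /w /weight lerDl sqr_ge0. Qed.
Let s2w x : cabs (s x) ^+ 2 <= w x. Proof. by rewrite /w /weight lerDr. Qed.

Let N_mono x y : 0 <= x -> x <= y -> y <= pi -> N x <= N y.
Proof.
move=> x0 xy ypi; apply: (primitive_ge0 pN) => //.
by apply: aeW => z _; apply: le_trans (w1 z).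
Qed.

Let N_ge0 x : 0 <= x <= pi -> 0 <= N x.
Proof. by case/andP => x0 xpi; rewrite -[leLHS]N0; exact: N_mono. Qed.

(** For [lambda = - kappa ^ 2] the components [p = y1 + kappa y] and
    [q = y1 - kappa y] diagonalise the system up to terms with [sigma]:
    [p' = kappa p - s q - s^2 y] and [q' = - kappa q - s p - s^2 y], where
    [y = (p - q) / (2 kappa)]. *)
Section FixedParameter.
Variables (kappa : R[i]) (y y1 : R -> R[i]).
Hypothesis ys : system_solution s (- kappa ^+ 2) y y1.
Hypothesis kappa1 : 1 <= cabs kappa.
Let k := re kappa.
Hypothesis k0 : 0 <= k.

Let p x := y1 x + kappa * y x.
Let q x := y1 x - kappa * y x.

Let dp x := kappa * p x - s x * q x - s x ^+ 2 * y x.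
Let dq x := - kappa * q x - s x * p x - s x ^+ 2 * y x.

Let pP : cprimitive 0 pi p dp.
Proof.
have [h1 h2] := ys.
apply: cprimitive_eq (cprimitiveD h2 (cprimitiveZ pi0 kappa h1)) _ => x _.
by rewrite /rhs1 /rhs2 /dp /p /q; ring.
Qed.

Let qP : cprimitive 0 pi q dq.
Proof.
have [h1 h2] := ys.
apply: cprimitive_eq (cprimitiveB pi0 h2 (cprimitiveZ pi0 kappa h1)) _ => x _.
by rewrite /rhs1 /rhs2 /dq /p /q; ring.
Qed.

Let y_le x : cabs kappa * (2 * cabs (y x)) <= cabs (p x) + cabs (q x).
Proof.
have -> : cabs kappa * (2 * cabs (y x)) = cabs (p x - q x).
  have -> : p x - q x = kappa * (2%:R%:C * y x).
    by rewrite /p /q; rewrite rmorph_nat; ring.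
  by rewrite !cabsM cabs_real ger0_norm.
exact: cabsB.
Qed.

Definition energy (x : R) : R :=
  cabs (y1 x + kappa * y x) ^+ 2 + cabs (y1 x - kappa * y x) ^+ 2.

Let cdot_kappa z : cdot z (kappa * z) = k * cabs z ^+ 2.
Proof. by rewrite cabs_sqr /cdot !reimE /k; ring. Qed.

Let cross z z' x : `|cdot z (s x * z' + s x ^+ 2 * y x)| <=
  cabs (s x) * (cabs z * cabs z') + cabs (s x) ^+ 2 * (cabs z * cabs (y x)).
Proof.
rewrite cdotDr; apply: le_trans (ler_normD _ _) _; apply: lerD;
  apply: le_trans (cdot_le _ _) _; rewrite cabsM ?cabsX le_eqVlt;
  by apply/orP; left; apply/eqP; ring.
Qed.

Let cdot_dp x : cdot (p x) (dp x) =
  k * cabs (p x) ^+ 2 - cdot (p x) (s x * q x + s x ^+ 2 * y x).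
Proof. by rewrite -cdot_kappa -cdotNr -cdotDr /dp; congr cdot; ring. Qed.

Let cdot_dq x : cdot (q x) (dq x) =
  - (k * cabs (q x) ^+ 2) - cdot (q x) (s x * p x + s x ^+ 2 * y x).
Proof. by rewrite -cdot_kappa -!cdotNr -cdotDr /dq; congr cdot; ring. Qed.

Let energyE x : energy x = cabs (p x) ^+ 2 + cabs (q x) ^+ 2.
Proof. by []. Qed.

Let energy_ge0 x : 0 <= energy x.
Proof. by rewrite addr_ge0 ?sqr_ge0. Qed.

Let cross_energy x :
  2 * (`|cdot (p x) (s x * q x + s x ^+ 2 * y x)| +
       `|cdot (q x) (s x * p x + s x ^+ 2 * y x)|) <= 4 * w x * energy x.
Proof.
have h1 := cross (p x) (q x) x; have h2 := cross (q x) (p x) x.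
have S0 := cabs_ge0 (s x); have P0 := cabs_ge0 (p x); have Q0 := cabs_ge0 (q x).
have sw : cabs (s x) <= w x := cabs_le_weight s x.
have PQ : 2 * (cabs (p x) * cabs (q x)) <= energy x.
  by rewrite energyE; have := sqr_ge0 (cabs (p x) - cabs (q x)); rewrite sqrrB mulr2n; lra.
have j1 : cabs (s x) * (2 * (cabs (p x) * cabs (q x))) <= w x * energy x.
  by rewrite ler_pM// !mulr_ge0.
have j2 : cabs (s x) ^+ 2 * ((cabs (p x) + cabs (q x)) * cabs (y x)) <= w x * energy x.
  rewrite ler_pM ?sqr_ge0 ?mulr_ge0 ?addr_ge0 ?cabs_ge0//.
  have yPQ : 2 * cabs (y x) <= cabs (p x) + cabs (q x).
    by apply: le_trans (y_le x); rewrite ler_peMl// mulr_ge0// cabs_ge0.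
  have := ler_wpM2l (addr_ge0 P0 Q0) yPQ; rewrite -expr2 sqrrD mulr2n energyE in PQ *.
  lra.
lra.
Qed.

(** The diagonal part of the system changes the energy at a rate at most
    [2 k] times the energy, in either direction, and the part involving [sigma]
    adds at most [4 weight]; the bound is uniform in the spectral parameter
    apart from the exponential rate [k], which vanishes for positive [lambda]. *)
Lemma energy_bound x x' : 0 <= x -> x <= x' -> x' <= pi ->
  energy x' <= energy x * expR (2 * k * (x' - x) + 4 * N pi) /\
  energy x <= energy x' * expR (2 * k * (x' - x) + 4 * N pi).
Proof.
move=> x0 xx x'pi.
have pE := primitiveD (cprimitive_sqr pi0 pP) (cprimitive_sqr pi0 qP).
have pG := primitiveD (primitiveZ (2 * k) pi0 (primitive_id 0 pi)) (primitiveZ 4 pi0 pN).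
have [|h1 h2] := gronwall pi0 pE pG _ x0 xx x'pi.
  apply: aeW => z _; rewrite /= -/w cdot_dp cdot_dq -energyE.
  have := cross_energy z; have := ler_norm (cdot (p z) (s z * q z + s z ^+ 2 * y z)).
  have := ler_norm (- cdot (p z) (s z * q z + s z ^+ 2 * y z)).
  have := ler_norm (cdot (q z) (s z * p z + s z ^+ 2 * y z)).
  have := ler_norm (- cdot (q z) (s z * p z + s z ^+ 2 * y z)); rewrite !normrN.
  have kP : 0 <= k * cabs (p z) ^+ 2 by rewrite mulr_ge0 ?sqr_ge0.
  have kQ : 0 <= k * cabs (q z) ^+ 2 by rewrite mulr_ge0 ?sqr_ge0.
  have kE : 2 * k * energy z = 2 * (k * cabs (p z) ^+ 2) + 2 * (k * cabs (q z) ^+ 2).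
    by rewrite energyE; ring.
  rewrite ler_norml mulr1 => i1 i2 i3 i4 i5.
  by apply/andP; split; lra.
have mono : expR (2 * k * x' + 4 * N x' - (2 * k * x + 4 * N x)) <=
    expR (2 * k * (x' - x) + 4 * N pi).
  have Nx : 0 <= N x by rewrite N_ge0// x0 (le_trans xx).
  have := N_mono (le_trans x0 xx) x'pi (lexx _).
  rewrite ler_expR; lra.
by split; [apply: le_trans h1 _|apply: le_trans h2 _]; rewrite ler_wpM2l//;
  exact: energy_ge0.
Qed.

Lemma solution_le_energy x : cabs kappa ^+ 2 * (2 * cabs (y x) ^+ 2) <= energy x.
Proof.
have : (cabs kappa * (2 * cabs (y x))) ^+ 2 <= (cabs (p x) + cabs (q x)) ^+ 2.
  by rewrite ler_sqr// ?nnegrE ?addr_ge0 ?mulr_ge0 ?cabs_ge0.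
have := sqr_ge0 (cabs (p x) - cabs (q x)).
rewrite energyE !exprMn sqrrB sqrrD mulr2n => i1 i2; lra.
Qed.

(** Both components are now followed leftwards from [pi], where [q] grows and
    [p] is damped, with the weight [e] that makes the energy bounded. *)
Section Backward.

Variable B : R.
Hypothesis B0 : 0 <= B.
Hypothesis k1 : 1 <= k.
Let e x := expR (2 * k * x - 2 * k * pi).
Hypothesis energy_le : forall x, 0 <= x <= pi -> energy x * e x <= B.

Let kp : 0 < k. Proof. exact: lt_le_trans k1. Qed.
Let r : R := Num.sqrt k.
Let rr : r ^+ 2 = k. Proof. by rewrite sqr_sqrtr// ltW. Qed.
Let r1 : 1 <= r. Proof. by rewrite -(@ler_pXn2r _ 2)// ?nnegrE ?sqrtr_ge0// rr expr1n. Qed.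
Let rp : 0 < r. Proof. exact: lt_le_trans r1. Qed.
Let rk : r <= k. Proof. by rewrite -rr expr2 ler_peMr// ltW. Qed.

Let e_gt0 x : 0 < e x. Proof. exact: expR_gt0. Qed.
Let e_pi : e pi = 1. Proof. by rewrite /e subrr expR0. Qed.

Let e_primitive : primitive 0 pi e (fun x => 2 * k * e x).
Proof.
have h := primitiveB pi0 (primitiveZ (2 * k) pi0 (primitive_id 0 pi))
  (primitive_cst 0 pi (2 * k * pi)).
by apply: primitive_eq (primitive_expR pi0 h) _ => x _; rewrite /e mulr1 subr0.
Qed.

Let itvP x : x \in `]0, pi[ -> 0 <= x <= pi.
Proof. by rewrite in_itv/= => /andP[? ?]; rewrite !ltW. Qed.

Let ky x : k * (2 * cabs (y x)) <= cabs (p x) + cabs (q x).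
Proof.
apply: le_trans (y_le x); rewrite ler_wpM2r ?mulr_ge0 ?cabs_ge0//.
by apply: le_trans (ler_re_cabs kappa); exact: ler_norm.
Qed.

Let weighted_energy b x : 0 < b -> 0 <= x <= pi ->
  cabs (s x) ^+ 2 * (3 * energy x / b) * e x <= w x * (3 * B / b).
Proof.
move=> b0 xpi.
rewrite [leLHS](_ : _ = cabs (s x) ^+ 2 * (3 * (energy x * e x) / b)); last by ring.
apply: ler_pM => //; first exact: sqr_ge0.
  by rewrite divr_ge0 ?(ltW b0)// mulr_ge0// mulr_ge0 ?(ltW (e_gt0 x)).
by rewrite ler_wpM2r ?invr_ge0 ?(ltW b0)// ler_wpM2l// energy_le.
Qed.

(** Going left from [pi], [|p|^2 e] is damped at the rate [2 k], so what remains
    of it away from [pi] comes from the coupling and is of size [B / k].  The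
    correction by a multiple of [N - N pi] turns this into the monotonicity
    of a single function. *)
Lemma damped_component x : 0 <= x <= pi ->
  cabs (y1 x + kappa * y x) ^+ 2 * e x <= B * (e x + 3 * N pi / k).
Proof.
rewrite -/(p x) => xpi; have /andP[x0 xpi'] := xpi.
pose D := 3 * B / k.
have D0 : 0 <= D by rewrite divr_ge0 ?(ltW kp)// mulr_ge0.
have V := primitiveM pi0
  (primitiveD (primitiveM pi0 (cprimitive_sqr pi0 pP) e_primitive)
    (primitiveZ D pi0 (primitiveB pi0 pN (primitive_cst 0 pi (N pi)))))
  (primitive_expR pi0 (primitiveZ (- (2 * k)) pi0 (primitive_id 0 pi))).
have {V} := primitive_ge0 V _ x0 xpi' (lexx _).
rewrite /= e_pi subrr mulr0 addr0 !mulr1 => V.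
have {}V : (cabs (p x) ^+ 2 * e x + D * (N x - N pi)) * expR (- (2 * k) * x) <=
    cabs (p pi) ^+ 2 * expR (- (2 * k) * pi).
  apply: V; apply: aeW => z /itvP zpi; rewrite subr0.
  rewrite [X in 0 <= X](_ : _ = (2 * cdot (p z) (dp z) * e z + D * w z
     + 2 * k * (D * (N pi - N z))) * expR (- (2 * k) * z)); last by rewrite /w; ring.
  rewrite mulr_ge0 ?expR_ge0//.
  have Nz : 0 <= 2 * k * (D * (N pi - N z)).
    apply: mulr_ge0; first by rewrite mulr_ge0// ltW.
    apply: mulr_ge0 => //; rewrite subr_ge0.
    by case/andP: zpi => z0 z1; exact: N_mono.
  have c1 := le_trans (ler_norm _) (cross (p z) (q z) z).
  have yc : 2 * (cabs (s z) * (cabs (p z) * cabs (q z)) +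
      cabs (s z) ^+ 2 * (cabs (p z) * cabs (y z))) <=
      2 * k * cabs (p z) ^+ 2 + cabs (s z) ^+ 2 * (3 * energy z / k).
    rewrite energyE; apply: (young_cross (k := k)); rewrite ?cabs_ge0//.
      by rewrite ler_peMl ?(ltW kp)// ler1n.
    by rewrite lerDl sqr_ge0.
  have main : - (cabs (s z) ^+ 2 * (3 * energy z / k)) <= 2 * cdot (p z) (dp z).
    by rewrite cdot_dp; lra.
  have := ler_wpM2r (ltW (e_gt0 z)) main.
  have := weighted_energy kp zpi; rewrite -/D => i1 i2.
  by lra.
have ex : expR (- (2 * k) * x) = (e x)^-1 * expR (- (2 * k) * pi).
  by rewrite /e -expRN -expRD; congr expR; ring.
move: V; rewrite ex mulrA ler_pM2r ?expR_gt0// ler_pdivrMr// => V.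
have ppi : cabs (p pi) ^+ 2 <= B.
  have := energy_le (_ : 0 <= pi <= pi); rewrite e_pi mulr1 lexx pi0 => /(_ isT).
  by apply: le_trans; rewrite energyE lerDl sqr_ge0.
have h1 := ler_wpM2r (ltW (e_gt0 x)) ppi.
have h2 : 0 <= D * N x by rewrite mulr_ge0 ?N_ge0.
rewrite mulrDr (_ : B * (3 * N pi / k) = D * N pi); last by rewrite /D; ring.
by lra.
Qed.

(** The weight makes [|q|^2 e] constant up to the coupling terms.  Splitting
    these by Young's inequality with the balance [sqrt k] leaves [|sigma|^2],
    which is integrable, over [sqrt k], and [sqrt k |p|^2 e], whose integral is
    small by the previous lemma. *)
Lemma persistent_component :
  cabs (y1 pi - kappa * y pi) ^+ 2 - cabs (y1 0 - kappa * y 0) ^+ 2 * e 0 <=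
  B * (3 * N pi + 1 / 2 + 3 * N pi * pi) / r.
Proof.
rewrite -/(q pi) -/(q 0).
have Q := primitiveM pi0 (cprimitive_sqr pi0 qP) e_primitive.
have H := primitiveZ B pi0 (primitiveD (primitiveD
   (primitiveZ (3 / r) pi0 pN) (primitiveZ ((2 * r)^-1) pi0 e_primitive))
   (primitiveZ (3 * N pi / r) pi0 (primitive_id 0 pi))).
have {H} := primitive_ge0 (primitiveB pi0 H Q) _ (lexx 0) pi0 (lexx _).
rewrite /= e_pi N0 !mulr1 => H.
have {}H : B * (3 / r * 0 + (2 * r)^-1 * e 0 + 3 * N pi / r * 0) - cabs (q 0) ^+ 2 * e 0 <=
    B * (3 / r * N pi + (2 * r)^-1 + 3 * N pi / r * pi) - cabs (q pi) ^+ 2.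
  apply: H; apply: aeW => z /itvP zpi; rewrite subr_ge0 -/w.
  rewrite [leLHS](_ : _ = 2 * (- cdot (q z) (s z * p z + s z ^+ 2 * y z)) * e z); last first.
    by rewrite cdot_dq; ring.
  have c1 := cross (q z) (p z) z; rewrite -normrN in c1.
  have {}c1 := le_trans (ler_norm _) c1.
  have yc : 2 * (cabs (s z) * (cabs (p z) * cabs (q z)) +
      cabs (s z) ^+ 2 * (cabs (q z) * cabs (y z))) <=
      r * cabs (p z) ^+ 2 + cabs (s z) ^+ 2 * (3 * energy z / r).
    rewrite energyE; apply: (young_cross (k := k)); rewrite ?cabs_ge0//.
    by rewrite lerDr sqr_ge0.
  have a4 := weighted_energy rp zpi.
  have a5 := ler_wpM2l (ltW rp) (damped_component zpi); rewrite -/(p z) in a5.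
  have a6 : r * (B * (e z + 3 * N pi / k)) = B * ((2 * r)^-1 * (2 * k * e z) + 3 * N pi / r).
    by rewrite -rr; have rn := lt0r_neq0 rp; field.
  have main : 2 * (- cdot (q z) (s z * p z + s z ^+ 2 * y z)) <=
      cabs (s z) ^+ 2 * (3 * energy z / r) + r * cabs (p z) ^+ 2.
    by lra.
  have a7 := ler_wpM2r (ltW (e_gt0 z)) main.
  by lra.
have e0r : 0 <= B * ((2 * r)^-1 * e 0).
  apply: mulr_ge0 => //; apply: mulr_ge0; last exact: ltW.
  by rewrite invr_ge0 mulr_ge0// ltW.
rewrite [leRHS](_ : _ = B * (3 / r * N pi + (2 * r)^-1 + 3 * N pi / r * pi)); last first.
  by have rn := lt0r_neq0 rp; field.
by lra.
Qed.

End Backward.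

(** The factor 10 is [1 + 3 ^ 2]: at [pi] the component [p] is at most 3 times
    [q]. *)
Definition growth_const : R := 10 * expR (4 * N pi).
Definition decay_threshold : R :=
  16 * growth_const * (1 + 3 * N pi + (3 * N pi + 1 / 2 + 3 * N pi * pi)).

(** A solution whose data at [pi] are dominated by the component [q], the one
    that grows towards 0, grows like [exp (k (pi - x))]: the upper
    bound is the energy estimate, and at 0 the component [q] has kept most of
    its size while [p] is negligible, so that [y1 0 = (p 0 + q 0) / 2] is of the
    size of [q 0].  The quotient [y x / y1 0] is therefore
    [O (exp (- k x) / |kappa|)]. *)
Lemma decaying_solution :
  decay_threshold ^+ 2 <= k ->
  cabs (y1 pi + kappa * y pi) <= 3 * cabs (y1 pi - kappa * y pi) ->
  y1 pi - kappa * y pi != 0 ->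
  y1 0 != 0 /\ forall x, 0 <= x <= pi ->
    cabs kappa * cabs (y x) * expR (k * x) <= 4 * growth_const * cabs (y1 0).
Proof.
rewrite -/(p pi) -/(q pi) => Tk pq q0.
have NP : 0 <= N pi by rewrite N_ge0// lexx pi0.
have eA : 1 <= expR (4 * N pi) by rewrite -expR0 ler_expR mulr_ge0.
set D := growth_const in Tk *.
have D10 : 10 <= D by rewrite /D /growth_const ler_peMr.
have D0 : 0 <= D by lra.
set C1 := 3 * N pi + 1 / 2 + 3 * N pi * pi.
have C10 : 0 <= C1 by rewrite !addr_ge0 ?mulr_ge0.
have A0 : 1 <= 1 + 3 * N pi by rewrite lerDl mulr_ge0.
have T1 : 1 <= decay_threshold.
  rewrite /decay_threshold -/C1 -/D; have : 10 * 1 <= D * (1 + 3 * N pi + C1).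
    by rewrite ler_pM// -[leLHS]addr0 lerD.
  by lra.
have T0 : 0 <= decay_threshold by apply: le_trans T1.
have k1 : 1 <= k by apply: le_trans Tk; rewrite expr_ge1.
have kp : 0 < k by exact: lt_le_trans k1.
pose r := Num.sqrt k.
have rr : r ^+ 2 = k by rewrite sqr_sqrtr.
have rT : decay_threshold <= r.
  by rewrite -(@ler_pXn2r _ 2)// ?nnegrE ?sqrtr_ge0 ?rr.
have r1 : 1 <= r by exact: le_trans rT.
have rp : 0 < r by exact: lt_le_trans r1.
have rk : r <= k by rewrite -rr expr2 ler_peMr// ltW.
pose W := cabs (q pi) ^+ 2.
have Wp : 0 < W by rewrite exprn_gt0// cabs_gt0.
have W0 := ltW Wp.
pose B := D * W.
have B0 : 0 <= B by exact: mulr_ge0.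
pose e x := expR (2 * k * x - 2 * k * pi).
have e0 x : 0 < e x by exact: expR_gt0.
have S1 x : 0 <= x <= pi -> energy x * e x <= B.
  move=> /andP[x0 xpi]; have [_ h] := energy_bound x0 xpi (lexx _).
  have Epi : energy pi <= 10 * W.
    have : cabs (p pi) ^+ 2 <= (3 * cabs (q pi)) ^+ 2.
      by rewrite ler_sqr// ?nnegrE ?mulr_ge0 ?cabs_ge0.
    by rewrite energyE exprMn -/W; lra.
  have : energy x * e x <= energy pi * expR (4 * N pi).
    have -> : expR (4 * N pi) = expR (2 * k * (pi - x) + 4 * N pi) * e x.
      by rewrite /e -expRD; congr expR; ring.
    by rewrite mulrA ler_wpM2r// expR_ge0.
  move/le_trans; apply; rewrite /B /D /growth_const.
  by rewrite [leRHS]mulrAC; apply: ler_wpM2r => //; exact: expR_ge0.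
have S2 := damped_component B0 k1 S1; have S3 := persistent_component B0 k1 S1.
rewrite -/r -/(q pi) -/(q 0) -/C1 -/W -/(e 0) in S3.
have e0k : e 0 <= k^-1.
  rewrite /e mulr0 sub0r expRN lef_pV2 ?posrE ?expR_gt0//.
  apply: le_trans (expR_ge1Dx _); have := pi_ge2 R; nra.
have DT : D * (1 + 3 * N pi) / r + D * C1 / r <= 1 / 16.
  rewrite -mulrDl ler_pdivrMr//; move: rT; rewrite /decay_threshold -/C1 -/D.
  by lra.
have DA : 0 <= D * (1 + 3 * N pi) / r.
  by rewrite divr_ge0 ?(ltW rp)// mulr_ge0// (le_trans _ A0).
have DC : 0 <= D * C1 / r by rewrite divr_ge0 ?(ltW rp)// mulr_ge0.
have S4p : cabs (p 0) ^+ 2 * e 0 <= W / 16.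
  have := S2 0; rewrite lexx pi0 => /(_ isT); move/le_trans; apply.
  have : e 0 + 3 * N pi / k <= (1 + 3 * N pi) / r.
    have : (1 + 3 * N pi) / k <= (1 + 3 * N pi) / r.
      by rewrite ler_wpM2l ?lef_pV2 ?posrE// (le_trans _ A0).
    by rewrite -/(e 0) mulrDl mul1r; lra.
  move/(ler_wpM2l B0)/le_trans; apply.
  rewrite [leLHS](_ : _ = W * (D * (1 + 3 * N pi) / r)); last by rewrite /B; ring.
  by rewrite ler_wpM2l//; lra.
have S4q : 9 / 16 * W <= cabs (q 0) ^+ 2 * e 0.
  have : B * C1 / r <= W / 16.
    rewrite [leLHS](_ : _ = W * (D * C1 / r)); last by rewrite /B; ring.
    by rewrite ler_wpM2l//; lra.
  by lra.
pose h := expR (- (k * pi)).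
have h0 : 0 < h by exact: expR_gt0.
have hh : e 0 = h ^+ 2 by rewrite /e /h -expRM_natl; congr expR; ring.
have S5p : cabs (p 0) * h <= cabs (q pi) / 4.
  rewrite -(@ler_pXn2r _ 2)// ?nnegrE ?mulr_ge0 ?divr_ge0 ?cabs_ge0 ?(ltW h0)//.
  rewrite exprMn -hh (_ : (cabs (q pi) / 4) ^+ 2 = W / 16)//.
  by rewrite /W; field.
have S5q : 3 / 4 * cabs (q pi) <= cabs (q 0) * h.
  rewrite -(@ler_pXn2r _ 2)// ?nnegrE ?mulr_ge0 ?divr_ge0 ?cabs_ge0 ?(ltW h0)//.
  rewrite [leRHS]exprMn -hh (_ : (3 / 4 * cabs (q pi)) ^+ 2 = 9 / 16 * W)//.
  by rewrite /W; field.
have low : cabs (q pi) <= 4 * (cabs (y1 0) * h).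
  have : cabs (q 0) - cabs (p 0) <= 2 * cabs (y1 0).
    have := cabs_lowerD (q 0) (p 0).
    have -> : q 0 + p 0 = 2%:R%:C * y1 0 by rewrite /p /q rmorph_nat; ring.
    by rewrite cabsM cabs_real ger0_norm.
  by move/(ler_wpM2r (ltW h0)); rewrite mulrBl; lra.
have qp : 0 < cabs (q pi) by rewrite cabs_gt0.
split.
  rewrite -cabs_gt0 lt_neqAle cabs_ge0 andbT; apply/eqP => y10.
  by move: low; rewrite -y10 mul0r mulr0 leNgt qp.
move=> x xpi.
have up : cabs kappa * cabs (y x) * (expR (k * x) * h) <= D * cabs (q pi).
  rewrite -(@ler_pXn2r _ 2)// ?nnegrE ?mulr_ge0 ?cabs_ge0 ?expR_ge0 ?(ltW h0)//.
  have -> : (cabs kappa * cabs (y x) * (expR (k * x) * h)) ^+ 2 =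
      cabs kappa ^+ 2 * cabs (y x) ^+ 2 * e x.
    by rewrite !exprMn -!expRM_natl -expRD /e; congr (_ * expR _); ring.
  have i1 := ler_wpM2r (ltW (e0 x)) (solution_le_energy x).
  have i2 : 0 <= cabs kappa ^+ 2 * cabs (y x) ^+ 2 * e x.
    by apply: mulr_ge0; [apply: mulr_ge0; exact: sqr_ge0|exact: ltW].
  have i3 := S1 x xpi; rewrite /B in i3.
  have i4 : D * W <= D ^+ 2 * W.
    by rewrite ler_wpM2r// expr2 ler_peMl//; lra.
  by rewrite exprMn -/W; lra.
have i5 := ler_wpM2l D0 low.
by rewrite -(ler_pM2r h0); lra.
Qed.

End FixedParameter.
End Estimates.

(** * Decay of the solution normalised at the right end *)
Section Polynomials.
Context {R : realType}.
Implicit Types (p r : {poly R[i]}).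

Lemma poly_upper p M : (size p <= M.+1)%N ->
  exists2 C, 0 <= C & forall z, 1 <= cabs z -> cabs p.[z] <= C * cabs z ^+ M.
Proof.
elim: M p => [|M IH] p.
  move=> /size1_polyC ->; exists (cabs p`_0); first exact: cabs_ge0.
  by move=> z _; rewrite hornerC expr0 mulr1.
move=> sp; have [|C C0 CP] := IH (drop_poly 1 p).
  by rewrite size_drop_poly leq_subLR.
exists (cabs p`_0 + C) => [|z z1]; first by rewrite addr_ge0 ?cabs_ge0.
have -> : p.[z] = p`_0 + (drop_poly 1 p).[z] * z.
  rewrite -{1}(poly_take_drop 1 p) hornerD hornerM hornerXn expr1; congr (_ + _).
  by rewrite horner_poly big_ord1 expr0 mulr1.
apply: le_trans (cabsD _ _) _; rewrite mulrDl lerD//.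
  by rewrite ler_peMr ?cabs_ge0// exprn_ege1.
by rewrite cabsM exprSr mulrA ler_wpM2r ?cabs_ge0// CP.
Qed.

Lemma poly_lower p M : (size p <= M.+1)%N -> p`_M = 1 ->
  exists2 Z, 1 <= Z & forall z, Z <= cabs z -> cabs z ^+ M <= 2 * cabs p.[z].
Proof.
case: M => [|M] sp p1.
  exists 1 => // z _; rewrite (size1_polyC sp) p1 hornerC cabs1 expr0; lra.
have sq : (size (p - 'X^(M.+1))%R <= M.+1)%N.
  apply/leq_sizeP => j; rewrite coefB coefXn leq_eqVlt => /predU1P[<-|Mj].
    by rewrite p1 eqxx subrr.
  by rewrite gtn_eqF// subr0 nth_default// (leq_trans sp).
have [C C0 CP] := poly_upper sq.
exists (1 + 2 * C) => [|z zZ]; first lra.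
have z1 : 1 <= cabs z by lra.
have := CP z z1; rewrite hornerD hornerN hornerXn => h.
have := cabs_lowerB (z ^+ M.+1) (z ^+ M.+1 - p.[z]); rewrite subKr cabs_distC cabsX.
have : 2 * C * cabs z ^+ M <= cabs z ^+ M.+1.
  by rewrite exprS ler_wpM2r ?exprn_ge0 ?cabs_ge0//; lra.
lra.
Qed.

Lemma poly_nonzero_large p : p != 0 ->
  exists2 Z, 1 <= Z & forall z, Z <= cabs z -> p.[z] != 0.
Proof.
move=> p0; have lp : lead_coef p != 0 by rewrite lead_coef_eq0.
have sz : (size p).-1.+1 = size p by rewrite prednK// size_poly_gt0.
have [||Z Z1 ZP] := @poly_lower ((lead_coef p)^-1 *: p) (size p).-1.
- by rewrite sz size_scale_leq.
- by rewrite coefZ -lead_coefE mulVf.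
exists Z => // z zZ; apply/negP => /eqP pz.
have := ZP z zZ; rewrite hornerZ pz mulr0 cabs0 mulr0 leNgt exprn_gt0//.
by lra.
Qed.

(** If one of two numbers is at most half of the other, their sum and their
    difference have moduli between [1 / 2] and [3 / 2] of the larger one. *)
Lemma ratio_bound (a b : R[i]) : 
  (b != 0 /\ 2 * cabs a <= cabs b) \/ (a != 0 /\ 2 * cabs b <= cabs a) ->
  cabs (- b + a) <= 3 * cabs (- b - a) /\ - b - a != 0.
Proof.
have h1 := cabsD (- b) a; have h2 := cabs_lowerB (- b) a.
have h3 := cabs_lowerB a (- b); rewrite cabsN in h1 h2 h3.
have h4 : cabs (a - - b) = cabs (- b - a) by rewrite cabs_distC.
move=> H; rewrite -cabs_gt0.
by case: H => -[]; rewrite -cabs_gt0 => ? ?; split; lra.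
Qed.

(** With [lambda = - kappa ^ 2] the polynomial [r2] has even order in [kappa] and
    [kappa * r1] odd order, so they never balance: [kappa * r1] dominates when the
    degree of [r1] is not the smaller one, and [r2] otherwise, in each case by a
    factor of order [|kappa|] at least.  This puts the data of [psi] at [pi] in
    the range of the lemma on decaying solutions. *)
Lemma normalized_dominance r1 r2 : normalized r1 r2 ->
  exists2 Z, 1 <= Z & forall kappa, Z <= cabs kappa ->
    let l := - kappa ^+ 2 in
    cabs (- r2.[l] + kappa * r1.[l]) <= 3 * cabs (- r2.[l] - kappa * r1.[l]) /\
    - r2.[l] - kappa * r1.[l] != 0.
Proof.
move=> [M1 [M2 [s1 s2 n1 n2]]].
have cabsl (kappa : R[i]) : cabs (- kappa ^+ 2) = cabs kappa * cabs kappa.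
  by rewrite cabsN cabsX expr2.
have [s21|s12] := leqP (size r2) (size r1).
  have [ME c1] := n1 s21; subst M2.
  have [Z Z1 ZP] := poly_lower s1 c1; have [C C0 CP] := poly_upper s2.
  exists (Z + 4 * C) => [|kappa kZ]; first lra.
  have kZ' : Z <= cabs kappa by lra.
  have lZ : Z <= cabs (- kappa ^+ 2).
    by rewrite cabsl; apply: le_trans kZ' _; rewrite ler_peMr ?cabs_ge0//; lra.
  have lower := ZP _ lZ; have upper := CP _ (le_trans Z1 lZ).
  have lM : 0 < cabs (- kappa ^+ 2) ^+ M1 by rewrite exprn_gt0//; lra.
  apply: ratio_bound; right; split.
    by rewrite -cabs_gt0 cabsM mulr_gt0//; lra.
  rewrite cabsM; apply: (@le_trans _ _ (4 * C * cabs r1.[- kappa ^+ 2])).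
    have := ler_wpM2l C0 lower; lra.
  by rewrite ler_wpM2r ?cabs_ge0//; lra.
have [ME c1] := n2 s12; subst M2.
have [Z Z1 ZP] := poly_lower s2 c1; have [C C0 CP] := poly_upper s1.
exists (Z + 4 * C) => [|kappa kZ]; first lra.
have kZ' : Z <= cabs kappa by lra.
have lZ : Z <= cabs (- kappa ^+ 2).
  by rewrite cabsl; apply: le_trans kZ' _; rewrite ler_peMr ?cabs_ge0//; lra.
have lower := ZP _ lZ; have upper := CP _ (le_trans Z1 lZ).
have lM : 0 < cabs (- kappa ^+ 2) ^+ M1 by rewrite exprn_gt0//; lra.
rewrite exprS {1}cabsl in lower.
set A := cabs (- kappa ^+ 2) ^+ M1 in lower upper lM.
have kk : 0 < cabs kappa by lra.
have h : 4 * C * cabs kappa * A <= cabs kappa * cabs kappa * A.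
  by rewrite ler_pM2r// ler_pM2r//; lra.
apply: ratio_bound; left; split.
  rewrite -cabs_gt0; have : 0 < cabs kappa * cabs kappa * A by rewrite !mulr_gt0.
  lra.
rewrite cabsM; have := ler_wpM2l (ltW kk) upper; lra.
Qed.

End Polynomials.

Section Bounds.
Context {R : realType}.
Local Notation pi := (@pi R).

Lemma sqrt_opp (z : R[i]) : exists2 kappa, - kappa ^+ 2 = z & 0 <= re kappa.
Proof.
have sq := sqr_sqrtc (- z); have [h|/ltW h] := leP 0 (re (sqrtc (- z))).
  by exists (sqrtc (- z)) => //; rewrite sq opprK.
by exists (- sqrtc (- z)); rewrite ?sqrrN ?sq ?opprK// reN oppr_ge0.
Qed.

Variables (s : R -> R[i]) (N : R -> R).
Hypothesis pN : primitive 0 pi N (weight s).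
Hypothesis N0 : N 0 = 0.
Let pi0 : 0 <= pi. Proof. exact: ltW (pi_gt0 _). Qed.

(** The energy estimate for data at 0; when [re kappa = 0], that is for positive
    [lambda], it is a bound independent of [lambda]. *)
Lemma solution_upper kappa y y1 (a x : R) : system_solution s (- kappa ^+ 2) y y1 ->
  1 <= cabs kappa -> 0 <= re kappa -> 0 <= a -> 0 <= x <= pi ->
  energy kappa y y1 0 <= 2 * a ^+ 2 ->
  cabs kappa * cabs (y x) <= a * expR (re kappa * x + 2 * N pi).
Proof.
move=> ys k1 k0 a0 /andP[x0 xpi] E0.
have [up _] := energy_bound pN N0 ys k1 k0 (lexx 0) x0 xpi.
have low := solution_le_energy kappa y y1 x.
rewrite -(@ler_pXn2r _ 2)// ?nnegrE ?mulr_ge0 ?cabs_ge0 ?expR_ge0//.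
rewrite !exprMn -expRM_natl.
have := ler_wpM2r (expR_ge0 (2 * re kappa * (x - 0) + 4 * N pi)) E0.
rewrite (_ : 2 * (re kappa * x + 2 * N pi) = 2 * re kappa * (x - 0) + 4 * N pi); last by ring.
lra.
Qed.

Lemma solution_unique kappa y y1 : system_solution s (- kappa ^+ 2) y y1 ->
  1 <= cabs kappa -> 0 <= re kappa -> y 0 = 0 -> y1 0 = 0 ->
  forall x, 0 <= x <= pi -> y x = 0 /\ y1 x = 0.
Proof.
move=> ys k1 k0 y0 y10 x /andP[x0 xpi].
have [up _] := energy_bound pN N0 ys k1 k0 (lexx 0) x0 xpi.
move: up; rewrite {2}/energy y0 y10 mulr0 subrr addr0 cabs0 expr0n addr0 mul0r.
rewrite /energy => E.
have P0 := sqr_ge0 (cabs (y1 x + kappa * y x)).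
have Q0 := sqr_ge0 (cabs (y1 x - kappa * y x)).
have : cabs (y1 x + kappa * y x) ^+ 2 == 0 by rewrite eq_le P0 andbT; lra.
have : cabs (y1 x - kappa * y x) ^+ 2 == 0 by rewrite eq_le Q0 andbT; lra.
rewrite !expf_eq0/= !cabs_eq0 => /eqP q0 /eqP p0.
have kn : kappa != 0 by rewrite -cabs_gt0; lra.
have y1E : y1 x = 0.
  by rewrite (_ : y1 x = (y1 x + kappa * y x + (y1 x - kappa * y x)) / 2);
    [rewrite p0 q0 addr0 mul0r|field].
split=> //; move: p0; rewrite y1E add0r => /eqP; rewrite mulf_eq0 (negbTE kn).
by move/eqP.
Qed.

Lemma cosine_upper kappa y y1 x : system_solution s (- kappa ^+ 2) y y1 ->
  y 0 = 1 -> y1 0 = 0 -> 1 <= cabs kappa -> 0 <= re kappa -> 0 <= x <= pi ->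
  cabs (y x) <= expR (re kappa * x + 2 * N pi).
Proof.
move=> ys y0 y10 k1 k0 xpi.
have k : 0 < cabs kappa by lra.
rewrite -(ler_pM2l k); apply: (solution_upper ys) => //; first exact: ltW.
by rewrite /energy y0 y10 mulr1 add0r sub0r cabsN; lra.
Qed.

Lemma sine_upper kappa y y1 x : system_solution s (- kappa ^+ 2) y y1 ->
  y 0 = 0 -> y1 0 = 1 -> 1 <= cabs kappa -> 0 <= re kappa -> 0 <= x <= pi ->
  cabs kappa * cabs (y x) <= expR (re kappa * x + 2 * N pi).
Proof.
move=> ys y0 y10 k1 k0 xpi; rewrite -[leRHS]mul1r.
apply: (solution_upper ys) => //.
by rewrite /energy y0 y10 mulr0 addr0 subr0 cabs1; lra.
Qed.

(** [psi / psi1 0] is the solution that satisfies the boundary condition at [pi]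
    and has quasi-derivative 1 at 0; its decay compensates the growth of the
    solutions with prescribed data at 0. *)
Lemma psi_quotient_decays r1 r2 psi psi1 : normalized r1 r2 -> is_psi s r1 r2 psi psi1 ->
  exists2 T, 1 <= T & forall kappa, T <= re kappa ->
    let l := - kappa ^+ 2 in
    psi1 0 l != 0 /\ forall x, 0 <= x <= pi ->
      cabs kappa * cabs (psi x l / psi1 0 l) <= 4 * growth_const N * expR (- (re kappa * x)).
Proof.
move=> nr psiP; have [Z Z1 ZP] := normalized_dominance nr.
exists (Z + decay_threshold N ^+ 2) => [|kappa kT l]; first by have := sqr_ge0 (decay_threshold N); lra.
have kk : re kappa <= cabs kappa by apply: le_trans (ler_re_cabs _); exact: ler_norm.
have T0 := sqr_ge0 (decay_threshold N).
have [//|dom nz] := ZP kappa; first lra.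
have [ps pp p1p] := psiP l.
have [||||//|y10 yP] := decaying_solution pN N0 (solution_system ps).
- lra.
- lra.
- lra.
- by rewrite pp p1p.
- by rewrite pp p1p.
split=> // x xpi; rewrite cabsM cabsV.
have p10 : 0 < cabs (psi1 0 l) by rewrite cabs_gt0.
rewrite mulrA ler_pdivrMr// expRN mulrAC ler_pdivlMr ?expR_gt0//.
exact: yP.
Qed.

End Bounds.

(** * The matrix between the two systems *)
Section Transfer.
Context {R : realType}.
Notation mu := (@lebesgue_measure R).
Local Notation pi := (@pi R).
Let pi0 : 0 <= pi. Proof. exact: ltW (pi_gt0 _). Qed.

Lemma is_derive_locally_cst (F : R -> R) (x d a b c : R) : a < x -> x < b ->
  (forall y, a <= y <= b -> F y = c) -> is_derive x 1 F d -> d = 0.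
Proof.
move=> ax xb Fc /is_derive_eps dF.
apply/eqP; rewrite -normr_eq0 eq_le normr_ge0 andbT.
apply/ler_addgt0Pr => e e0; rewrite add0r.
have [r r0 rP] := dF e e0.
pose y := Num.min b (x + r / 2).
have xy : x < y by rewrite lt_min xb ltrDl divr_gt0.
have yr : y <= x + r / 2 by rewrite ge_min lexx orbT.
have yb : y <= b by rewrite ge_min lexx.
have yx : `|y - x| = y - x by rewrite gtr0_norm// subr_gt0.
have := rP y; rewrite yx (Fc y) ?(Fc x); last 2 first.
- by rewrite !ltW.
- by rewrite yb andbT ltW// (lt_trans ax).
rewrite subrr sub0r normrN normrM yx ler_pM2r ?subr_gt0//; apply; lra.
Qed.

Lemma cprimitive_cst_eq0 (F f : R -> R[i]) (c : R[i]) : cprimitive 0 pi F f ->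
  (forall x, 0 <= x <= pi -> F x = c) ->
  {ae mu, forall x, x \in `]0, pi[ -> f x = 0}.
Proof.
move=> [_ dF] Fc; apply: ae_imply dF => x h xi.
have [d1 d2] := h xi; move: xi; rewrite in_itv/= => /andP[x0 xpi].
apply: complexP.
  by apply: is_derive_locally_cst x0 xpi _ d1 => y /Fc ->.
by apply: is_derive_locally_cst x0 xpi _ d2 => y /Fc ->.
Qed.

Variables (s st : R -> R[i]) (l : R[i]).
Variables (C C1 S S1 Ct Ct1 St St1 : R -> R[i]).
Hypothesis Cs : system_solution s l C C1.
Hypothesis Ss : system_solution s l S S1.
Hypothesis Cts : system_solution st l Ct Ct1.
Hypothesis Sts : system_solution st l St St1.
Hypothesis C_0 : C 0 = 1.
Hypothesis C1_0 : C1 0 = 0.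
Hypothesis S_0 : S 0 = 0.
Hypothesis S1_0 : S1 0 = 1.
Hypothesis Ct_0 : Ct 0 = 1.
Hypothesis Ct1_0 : Ct1 0 = 0.
Hypothesis St_0 : St 0 = 0.
Hypothesis St1_0 : St1 0 = 1.

Lemma wronskian (t : R -> R[i]) (y y1 z z1 : R -> R[i]) :
  system_solution t l y y1 -> system_solution t l z z1 ->
  forall x, 0 <= x <= pi -> y x * z1 x - z x * y1 x = y 0 * z1 0 - z 0 * y1 0.
Proof.
move=> [dy dy1] [dz dz1] x /andP[x0 xpi].
have d := cprimitiveB pi0 (cprimitiveM pi0 dy dz1) (cprimitiveM pi0 dz dy1).
apply: (cprimitive_eq0 pi0 d) => //.
by apply: aeW => u _; rewrite /rhs1 /rhs2; ring.
Qed.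

(** The matrix [Q = Tt T^-1] satisfies [Q' = At Q - Q A], with [A] and [At] the
    matrices of the two systems.  If [Q12] vanishes identically, the equation of
    [Q12] gives [Q22 = Q11] almost everywhere, whence the trace is constant; it
    is 2, the determinant is 1, so [Q11 = Q22 = 1] everywhere.  The equation of
    [Q11] is then [Q21 = s - st], and that of [Q21] reads [Q21' = 0]. *)
Lemma eq_potentials_of_transfer_vanish : (forall x, 0 <= x <= pi -> St x * C x - Ct x * S x = 0) ->
  {ae mu, forall x, x \in `]0, pi[ -> s x = st x}.
Proof.
move=> Q12.
pose Q11 x := Ct x * S1 x - St x * C1 x.
pose Q21 x := Ct1 x * S1 x - St1 x * C1 x.
pose Q22 x := St1 x * C x - Ct1 x * S x.
have [dC dC1] := Cs; have [dS dS1] := Ss.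
have [dCt dCt1] := Cts; have [dSt dSt1] := Sts.
have d12 := cprimitiveB pi0 (cprimitiveM pi0 dSt dC) (cprimitiveM pi0 dCt dS).
have d11 : cprimitive 0 pi Q11 _ :=
  cprimitiveB pi0 (cprimitiveM pi0 dCt dS1) (cprimitiveM pi0 dSt dC1).
have d21 : cprimitive 0 pi Q21 _ :=
  cprimitiveB pi0 (cprimitiveM pi0 dCt1 dS1) (cprimitiveM pi0 dSt1 dC1).
have d22 : cprimitive 0 pi Q22 _ :=
  cprimitiveB pi0 (cprimitiveM pi0 dSt1 dC) (cprimitiveM pi0 dCt1 dS).
have itvP x : x \in `]0, pi[ -> 0 <= x <= pi.
  by rewrite in_itv/= => /andP[? ?]; rewrite !ltW.
have diag : {ae mu, forall x, x \in `]0, pi[ -> Q22 x = Q11 x}.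
  apply: ae_imply (cprimitive_cst_eq0 d12 Q12) => x h xi; have := h xi.
  rewrite /rhs1 [LHS](_ : _ = Q22 x - Q11 x + (s x + st x) * (St x * C x - Ct x * S x)).
    by rewrite Q12 ?itvP// mulr0 addr0 => /eqP; rewrite subr_eq0 => /eqP.
  by rewrite /Q22 /Q11; ring.
have trace x : 0 <= x <= pi -> Q11 x + Q22 x = 1 + 1.
  move=> /andP[x0 xpi]; rewrite (cprimitive_eq0 pi0 (cprimitiveD d11 d22) _ x0 xpi).
    by rewrite /Q11 /Q22 C_0 C1_0 S_0 S1_0 Ct_0 Ct1_0 St_0 St1_0; ring.
  apply: ae_imply diag => z h zi; have E := h zi.
  rewrite /rhs1 /rhs2 /= [LHS](_ : _ = (st z - s z) * (Q11 z - Q22 z) +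
    (s z ^+ 2 - st z ^+ 2) * (St z * C z - Ct z * S z)); last by rewrite /Q11 /Q22; ring.
  by rewrite E subrr Q12 ?itvP// !mulr0 addr0.
have det x : 0 <= x <= pi -> Q11 x * Q22 x = 1.
  move=> xpi; have w1 := wronskian Cs Ss xpi; have w2 := wronskian Cts Sts xpi.
  move: w1 w2; rewrite C_0 C1_0 S_0 S1_0 Ct_0 Ct1_0 St_0 St1_0 => w1 w2.
  have : Q11 x * Q22 x = Q21 x * (St x * C x - Ct x * S x) +
     (C x * S1 x - S x * C1 x) * (Ct x * St1 x - St x * Ct1 x).
    by rewrite /Q11 /Q22 /Q21; ring.
  by rewrite Q12// w1 w2 => ->; ring.
have one x : 0 <= x <= pi -> Q11 x = 1.
  move=> xpi; have t := trace x xpi; have d := det x xpi.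
  have : (Q11 x - 1) ^+ 2 = 0.
    transitivity (Q11 x * (Q11 x + Q22 x) - Q11 x * Q22 x + 1 - Q11 x * (1 + 1)); first by ring.
    by rewrite t d; ring.
  by move/eqP; rewrite expf_eq0/= => /eqP/subr0_eq.
have one2 x : 0 <= x <= pi -> Q22 x = 1.
  by move=> xpi; have := det x xpi; rewrite one// mul1r.
have Q21E : {ae mu, forall x, x \in `]0, pi[ -> Q21 x = s x - st x}.
  apply: ae_imply (cprimitive_cst_eq0 d11 one) => x h xi; have := h xi.
  rewrite /rhs1 /rhs2 /= [LHS](_ : _ = Q21 x - (s x - st x) * Q11 x +
     (s x ^+ 2 + l) * (St x * C x - Ct x * S x)); last by rewrite /Q21 /Q11; ring.
  by rewrite Q12 ?one ?itvP// mulr0 addr0 mulr1 => /eqP; rewrite subr_eq0 => /eqP.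
have Q210 x : 0 <= x <= pi -> Q21 x = 0.
  move=> /andP[x0 xpi]; rewrite (cprimitive_eq0 pi0 d21 _ x0 xpi).
    by rewrite /Q21 C1_0 S1_0 Ct1_0 St1_0; ring.
  apply: ae_imply Q21E => z h zi; have E := h zi.
  rewrite /rhs2 /= [LHS](_ : _ = - (st z ^+ 2 + l) * Q11 z + (s z ^+ 2 + l) * Q22 z
    - (s z + st z) * Q21 z); last by rewrite /Q11 /Q22 /Q21; ring.
  by rewrite E one ?one2 ?itvP//; ring.
apply: ae_imply Q21E => x h xi; apply/eqP; rewrite -subr_eq0 -h//.
by rewrite Q210 ?itvP.
Qed.

End Transfer.

(** * The boundary polynomials *)
Section Proportional.
Context {R : realType}.

(** Coprimality makes [r1] and [rt1] divide each other, so the pairs differ by a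
    constant factor, and the normalisation fixes this factor because it makes
    the same one of the two polynomials monic on both sides. *)
Lemma normalized_proportional (r1 r2 rt1 rt2 : {poly R[i]}) :
  coprimep r1 r2 -> coprimep rt1 rt2 -> normalized r1 r2 -> normalized rt1 rt2 ->
  r1 * rt2 = r2 * rt1 -> r1 = rt1 /\ r2 = rt2.
Proof.
move=> co cot nr nrt E.
have r1_neq0 (p1 p2 : {poly R[i]}) : coprimep p1 p2 -> normalized p1 p2 -> p1 != 0.
  move=> cop [M1 [M2 [_ _ _ n2]]]; apply/eqP => p10.
  move: cop n2; rewrite p10 coprime0p -size_poly_eq1 size_poly0 => /eqP s2.
  rewrite s2 => /(_ isT)[-> /eqP]; rewrite nth_default ?s2//.
  by rewrite eq_sym oner_eq0.
have n0 := r1_neq0 _ _ co nr; have nt0 := r1_neq0 _ _ cot nrt.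
have d1 : r1 %| rt1 by rewrite -(Gauss_dvdpr rt1 co) -E dvdp_mulr.
have d2 : rt1 %| r1.
  by rewrite -(Gauss_dvdpr r1 cot) mulrC E mulrC dvdp_mulr.
have /eqpf_eq [c c0 rc] : r1 %= rt1 by rewrite /eqp d1 d2.
have r2c : r2 = c *: rt2.
  apply: (mulIf nt0); rewrite -E rc -!scalerAl; congr (_ *: _); exact: mulrC.
suff c1 : c = 1 by rewrite rc r2c c1 !scale1r.
have [M1 [M2 [s1 s2 n1 n2]]] := nr; have [L1 [L2 [t1 t2 m1 m2]]] := nrt.
have lead (p q : {poly R[i]}) M L : (size p <= M.+1)%N -> p`_M = 1 ->
    (size q <= L.+1)%N -> q`_L = 1 -> p = c *: q -> c = 1.
  move=> sp pM sq qL pq.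
  have eqs : forall (u : {poly R[i]}) K, (size u <= K.+1)%N -> u`_K = 1 -> size u = K.+1.
    move=> u K su uK; apply/eqP; rewrite eqn_leq su ltnNge; apply/negP => h.
    by move: uK; rewrite nth_default// => /eqP; rewrite eq_sym oner_eq0.
  have ML : M = L.
    by apply: succn_inj; rewrite -(eqs p M)// -(eqs q L)// pq size_scale.
  by move: pM; rewrite pq coefZ ML qL mulr1.
have [h|h] := leqP (size r2) (size r1).
  have ht : (size rt2 <= size rt1)%N by move: h; rewrite rc r2c !size_scale.
  exact: lead s1 (n1 h).2 t1 (m1 ht).2 rc.
have ht : (size rt1 < size rt2)%N by move: h; rewrite rc r2c !size_scale.
exact: lead s2 (n2 h).2 t2 (m2 ht).2 r2c.
Qed.

End Proportional.

(** * Vanishing of the off-diagonal entry *)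
Section WeylUniqueness.
Context {R : realType}.
Local Notation pi := (@pi R).
Let pi0 : 0 <= pi. Proof. exact: ltW (pi_gt0 _). Qed.

Lemma weight_primitive (s : R -> R[i]) : L2_0pi s ->
  exists N, primitive 0 pi N (weight s) /\ N 0 = 0.
Proof. by move=> sL2; apply: primitive_exists (integrable_weight sL2); exact: pi_gt0. Qed.

(** Off the positive axis [re (kappa ^ 2) >= 0], hence
    [re kappa ^ 2 >= |kappa| ^ 2 / 2]. *)
Lemma axis_re_large (kappa u : R[i]) (x : R) : u \in [:: 'i; - 1; - 'i] ->
  - kappa ^+ 2 = u * x%:C -> 0 <= x -> 0 <= re kappa -> x <= 2 * re kappa ^+ 2.
Proof.
move=> uax ku x0 k0.
have rek : re kappa ^+ 2 - im kappa ^+ 2 >= 0.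
  have := congr1 re ku; rewrite expr2 !reimE/= => E.
  by rewrite !inE in uax; case/or3P: uax E => /eqP->/=; lra.
have : cabs (kappa ^+ 2) = x.
  rewrite -cabsN ku cabsM cabs_real ger0_norm// cabs_axis ?mul1r//.
  by rewrite !inE in uax *; rewrite uax orbT.
rewrite cabsX cabs_sqr; lra.
Qed.

Lemma positive_axis_re (kappa : R[i]) (x : R) : - kappa ^+ 2 = x%:C -> 0 < x -> re kappa = 0.
Proof.
move=> ku x0; have E1 := congr1 re ku; have E2 := congr1 im ku.
rewrite expr2 !reimE/= in E1 E2.
have /eqP : re kappa * im kappa = 0 by lra.
rewrite mulf_eq0 => /orP[/eqP//|/eqP im0].
by move: E1; rewrite im0; have := sqr_ge0 (re kappa); nra.
Qed.

(** On the positive half-axis the energy estimate bounds [C] and [kappa S] for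
    both systems.  On the other three half-axes [psi / psi1 0 = S - M C], and the
    equality of the Weyl functions turns [St C - Ct S] into
    [(psit / psit1 0) C - Ct (psi / psi1 0)], where decay beats growth. *)
Theorem weyl_transfer_vanish (s st : R -> R[i]) (r1 r2 rt1 rt2 : {poly R[i]})
    (psi psi1 psit psit1 : R -> R[i] -> R[i]) (N Nt : R -> R)
    (C C1 S S1 Ct Ct1 St St1 : R -> R[i] -> R[i]) (x : R) :
  primitive 0 pi N (weight s) -> N 0 = 0 ->
  primitive 0 pi Nt (weight st) -> Nt 0 = 0 ->
  normalized r1 r2 -> normalized rt1 rt2 ->
  is_psi s r1 r2 psi psi1 -> is_psi st rt1 rt2 psit psit1 ->
  weyl_equal psi psi1 psit psit1 ->
  (forall l, [/\ system_solution s l (C^~ l) (C1^~ l), C 0 l = 1 & C1 0 l = 0]) ->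
  (forall l, [/\ system_solution s l (S^~ l) (S1^~ l), S 0 l = 0 & S1 0 l = 1]) ->
  (forall l, [/\ system_solution st l (Ct^~ l) (Ct1^~ l), Ct 0 l = 1 & Ct1 0 l = 0]) ->
  (forall l, [/\ system_solution st l (St^~ l) (St1^~ l), St 0 l = 0 & St1 0 l = 1]) ->
  0 <= x <= pi -> entire (C x) -> entire (S x) -> entire (Ct x) -> entire (St x) ->
  forall l, St x l * C x l - Ct x l * S x l = 0.
Proof.
move=> pN N0 pNt Nt0 nr nrt psiP psitP wE CP SP CtP StP xpi eC eS eCt eSt.
pose f l := St x l * C x l - Ct x l * S x l.
have ef : entire f by apply: entireB; exact: entireM.
have /andP[x0 xpi'] := xpi.
pose A := expR (2 * N pi + 2 * Nt pi).
have A0 : 0 < A by exact: expR_gt0.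
(* Valid on the whole plane: it gives the growth, and the decay where
   [re kappa = 0]. *)
have upper kappa : 1 <= cabs kappa -> 0 <= re kappa ->
    cabs kappa * cabs (f (- kappa ^+ 2)) <= 2 * A * expR (2 * re kappa * x).
  move=> k1 k0; set l := - _.
  have [Cs c0 c10] := CP l; have [Ss s0 s10] := SP l.
  have [Cts ct0 ct10] := CtP l; have [Sts st0 st10] := StP l.
  have bC := cosine_upper pN N0 Cs c0 c10 k1 k0 xpi.
  have bS := sine_upper pN N0 Ss s0 s10 k1 k0 xpi.
  have bCt := cosine_upper pNt Nt0 Cts ct0 ct10 k1 k0 xpi.
  have bSt := sine_upper pNt Nt0 Sts st0 st10 k1 k0 xpi.
  have kk0 := cabs_ge0 kappa.
  have E : A * expR (2 * re kappa * x) =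
      expR (re kappa * x + 2 * N pi) * expR (re kappa * x + 2 * Nt pi).
    by rewrite /A -!expRD; congr expR; ring.
  have h1 : cabs kappa * (cabs (St x l) * cabs (C x l)) <= A * expR (2 * re kappa * x).
    by rewrite E mulrA [leRHS]mulrC ler_pM ?mulr_ge0 ?cabs_ge0.
  have h2 : cabs kappa * (cabs (Ct x l) * cabs (S x l)) <= A * expR (2 * re kappa * x).
    by rewrite E mulrCA [leRHS]mulrC ler_pM ?mulr_ge0 ?cabs_ge0.
  have := ler_wpM2l kk0 (cabsB (St x l * C x l) (Ct x l * S x l)).
  by rewrite !cabsM mulrDr /f; lra.
have growth sg : 0 < sg -> exists B, forall z, cabs (f z) <= B * expR (sg * cabs z).
  move=> sg0; have [M M0 MP] := entire_bounded ef 1.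
  exists (M + 2 * A * expR (pi ^+ 2 / sg)) => z.
  have e1 : 1 <= expR (sg * cabs z) by rewrite -expR0 ler_expR mulr_ge0 ?cabs_ge0// ltW.
  have B0 : 0 <= 2 * A * expR (pi ^+ 2 / sg) by rewrite !mulr_ge0 ?expR_ge0.
  have [z1|/ltW z1] := leP (cabs z) 1.
    apply: le_trans (MP z z1) _; rewrite mulrDl.
    have : M <= M * expR (sg * cabs z) by rewrite ler_peMr.
    have : 0 <= 2 * A * expR (pi ^+ 2 / sg) * expR (sg * cabs z) by rewrite mulr_ge0 ?expR_ge0.
    lra.
  have [kappa kz k0] := sqrt_opp z.
  have kE : cabs kappa ^+ 2 = cabs z by rewrite -kz cabsN cabsX.
  have k1 : 1 <= cabs kappa.
    by rewrite -(@ler_pXn2r _ 2)// ?nnegrE ?cabs_ge0// kE expr1n.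
  have := upper kappa k1 k0; rewrite kz => up.
  have fz : cabs (f z) <= cabs kappa * cabs (f z) by rewrite ler_peMl ?cabs_ge0.
  apply: le_trans fz _; apply: le_trans up _.
  rewrite [leRHS]mulrDl; apply: (@le_trans _ _ (2 * A * expR (pi ^+ 2 / sg) * expR (sg * cabs z))).
    rewrite -[leRHS]mulrA ler_wpM2l// ?mulr_ge0 ?(ltW A0)//.
    rewrite -expRD ler_expR.
    have rk : re kappa <= cabs kappa by apply: le_trans (ler_re_cabs _); exact: ler_norm.
    have h : 2 * re kappa * x <= 2 * cabs kappa * pi.
      by rewrite ler_pM ?mulr_ge0// ler_wpM2l.
    apply: le_trans h _; rewrite -kE -subr_ge0.
    rewrite (_ : _ - _ = (pi - sg * cabs kappa) ^+ 2 / sg); last by field; lra.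
    by rewrite divr_ge0 ?sqr_ge0// ltW.
  by rewrite lerDr mulr_ge0 ?expR_ge0.
have [T T1 TP] := psi_quotient_decays pN N0 nr psiP.
have [Tt Tt1 TtP] := psi_quotient_decays pNt Nt0 nrt psitP.
pose G := 4 * growth_const N + 4 * growth_const Nt.
have gc (n : R -> R) : 0 <= growth_const n by rewrite /growth_const mulr_ge0 ?expR_ge0.
pose B := 2 * A + G * A.
have G0 : 0 <= G by rewrite /G addr_ge0 ?mulr_ge0.
have B0 : 0 < B by rewrite /B ltr_pwDl ?mulr_gt0// mulr_ge0// ltW.
have NP n : primitive 0 pi n (weight s) \/ primitive 0 pi n (weight st) -> n 0 = 0 -> 0 <= n pi.
  move=> pn n0; rewrite -[leLHS]n0; case: pn => pn; apply: (primitive_ge0 pn) => //;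
  by apply: aeW => z _; rewrite /weight addr_ge0// sqr_ge0.
have NP1 := NP _ (or_introl pN) N0; have NP2 := NP _ (or_intror pNt) Nt0.
have decaying kappa : T <= re kappa -> Tt <= re kappa ->
    cabs kappa * cabs (f (- kappa ^+ 2)) <= B.
  move=> kT kTt; set l := - _.
  have k0 : 0 <= re kappa by lra.
  have rk : re kappa <= cabs kappa by apply: le_trans (ler_re_cabs _); exact: ler_norm.
  have k1 : 1 <= cabs kappa by lra.
  have [p10 pd] := TP kappa kT; have [pt10 ptd] := TtP kappa kTt.
  rewrite -/l in p10 pd pt10 ptd.
  have [Cs c0 c10] := CP l; have [Ss s0 s10] := SP l.
  have [Cts ct0 ct10] := CtP l; have [Sts st0 st10] := StP l.
  have bC := cosine_upper pN N0 Cs c0 c10 k1 k0 xpi.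
  have bCt := cosine_upper pNt Nt0 Cts ct0 ct10 k1 k0 xpi.
  have [ps _ _] := psiP l; have [pst _ _] := psitP l.
  have expand (t : R -> R[i]) (n : R -> R) (a b y y1 z z1 : R -> R[i]) :
      primitive 0 pi n (weight t) -> n 0 = 0 ->
      system_solution t l a b -> system_solution t l y y1 -> system_solution t l z z1 ->
      y 0 = 1 -> y1 0 = 0 -> z 0 = 0 -> z1 0 = 1 ->
      a x = a 0 * y x + b 0 * z x.
    move=> pn n0 sa sy sz y0 y10 z0 z10.
    have d := system_solutionD 1 (- 1) sa (system_solutionD (a 0) (b 0) sy sz).
    have [||h _] := solution_unique pn n0 d k1 k0 _ _ xpi.
    - by rewrite y0 z0; ring.
    - by rewrite y10 z10; ring.
    by apply/eqP; rewrite -subr_eq0 -h; apply/eqP; ring.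
  have ex := expand _ _ _ _ _ _ _ _ pN N0 (solution_system ps) Cs Ss c0 c10 s0 s10.
  have ext := expand _ _ _ _ _ _ _ _ pNt Nt0 (solution_system pst) Cts Sts ct0 ct10 st0 st10.
  have wl := wE l p10 pt10; rewrite /weyl in wl.
  have fE : f l = psit x l / psit1 0 l * C x l - Ct x l * (psi x l / psi1 0 l).
    have -> : psi x l / psi1 0 l = psi 0 l / psi1 0 l * C x l + S x l.
      by rewrite ex; field.
    have -> : psit x l / psit1 0 l = psit 0 l / psit1 0 l * Ct x l + St x l.
      by rewrite ext; field.
    by rewrite (oppr_inj wl) /f; ring.
  have kk0 := cabs_ge0 kappa.
  have ek : expR (- (re kappa * x)) * expR (re kappa * x + 2 * N pi) <= A.
    rewrite -expRD ler_expR; lra.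
  have ekt : expR (- (re kappa * x)) * expR (re kappa * x + 2 * Nt pi) <= A.
    rewrite -expRD ler_expR; lra.
  have h1 : cabs kappa * cabs (psit x l / psit1 0 l) * cabs (C x l) <= 4 * growth_const Nt * A.
    apply: (@le_trans _ _ (4 * growth_const Nt * expR (- (re kappa * x)) * expR (re kappa * x + 2 * N pi))).
      by rewrite ler_pM ?mulr_ge0 ?cabs_ge0// ptd.
    by rewrite -mulrA ler_wpM2l// mulr_ge0.
  have h2 : cabs kappa * cabs (psi x l / psi1 0 l) * cabs (Ct x l) <= 4 * growth_const N * A.
    apply: (@le_trans _ _ (4 * growth_const N * expR (- (re kappa * x)) * expR (re kappa * x + 2 * Nt pi))).
      by rewrite ler_pM ?mulr_ge0 ?cabs_ge0// pd.
    by rewrite -mulrA ler_wpM2l// mulr_ge0.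
  have := ler_wpM2l kk0 (cabsB (psit x l / psit1 0 l * C x l) (Ct x l * (psi x l / psi1 0 l))).
  rewrite -fE (cabsM _ (C x l)) (cabsM (Ct x l)) => h3.
  by rewrite /B /G; lra.
apply: (@entire_vanish _ f ef growth) => e e0.
pose m := T + Tt.
exists (1 + 2 * m ^+ 2 + (B / e) ^+ 2) => u t uax tr.
have m2 := sqr_ge0 m; have Be2 := sqr_ge0 (B / e).
have t0 : 0 < t by lra.
have [kappa kz k0] := sqrt_opp (u * t%:C).
have kE : cabs kappa ^+ 2 = t.
  by rewrite -cabsX -cabsN kz cabsM cabs_axis// mul1r cabs_real gtr0_norm.
have k1 : 1 <= cabs kappa.
  by rewrite -(@ler_pXn2r _ 2)// ?nnegrE ?cabs_ge0// kE expr1n; lra.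
have kB : B / e <= cabs kappa.
  by rewrite -(@ler_pXn2r _ 2)// ?nnegrE ?cabs_ge0 ?divr_ge0 ?(ltW B0) ?(ltW e0)// kE; lra.
have main : cabs kappa * cabs (f (- kappa ^+ 2)) <= B.
  have [u1|u1] := eqVneq u 1.
    rewrite u1 mul1r in kz; have rk0 := positive_axis_re kz t0.
    apply: le_trans (upper kappa k1 k0) _; rewrite rk0 mulr0 mul0r expR0 mulr1.
    by rewrite /B lerDl mulr_ge0// ltW.
  have uax' : u \in [:: 'i; - 1; - 'i] by move: uax; rewrite inE (negbTE u1).
  have := axis_re_large uax' kz (ltW t0) k0 => tk.
  have mk : m <= re kappa.
    have m0 : 0 <= m by rewrite /m; lra.
    by rewrite -(@ler_pXn2r _ 2)//; lra.
  by apply: decaying; rewrite /m in mk; lra.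
rewrite -kz -(ler_pM2l (_ : 0 < cabs kappa)); last lra.
apply: le_trans main _; by rewrite -ler_pdivrMr.
Qed.

End WeylUniqueness.

Section BoundaryData.
Context {R : realType}.
Local Notation pi := (@pi R).

(** The combination [psit1 0 psi - psi1 0 psit] solves the common equation and has
    zero data at 0, as the Weyl functions agree; so it vanishes at [pi], for all
    large negative [lambda]. *)
Lemma boundary_polynomials (s st : R -> R[i]) (r1 r2 rt1 rt2 : {poly R[i]})
    (psi psi1 psit psit1 : R -> R[i] -> R[i]) :
  L2_0pi s -> L2_0pi st ->
  {ae (@lebesgue_measure R), forall x, x \in `]0, pi[ -> s x = st x} ->
  normalized r1 r2 -> normalized rt1 rt2 ->
  is_psi s r1 r2 psi psi1 -> is_psi st rt1 rt2 psit psit1 ->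
  weyl_equal psi psi1 psit psit1 -> r1 * rt2 = r2 * rt1.
Proof.
move=> sL2 stL2 sst nr nrt psiP psitP wE.
have pi0 : 0 <= pi by exact: ltW (pi_gt0 _).
have [N [pN N0]] := weight_primitive sL2; have [Nt [pNt Nt0]] := weight_primitive stL2.
have [T T1 TP] := psi_quotient_decays pN N0 nr psiP.
have [Tt Tt1 TtP] := psi_quotient_decays pNt Nt0 nrt psitP.
apply/eqP; rewrite -subr_eq0; apply/negP => /negP nz.
have [Z Z1 ZP] := poly_nonzero_large nz.
pose k := T + Tt + Z; pose kappa : R[i] := k%:C; pose l := - kappa ^+ 2.
have rk : re kappa = k by [].
have k0 : 0 <= k by rewrite /k; lra.
have ck : cabs kappa = k by rewrite cabs_real ger0_norm.
have [|p10 _] := TP kappa; first by rewrite rk /k; lra.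
have [|pt10 _] := TtP kappa; first by rewrite rk /k; lra.
rewrite -/l in p10 pt10.
have [ps pp p1p] := psiP l; have [pst ptp pt1p] := psitP l.
have tS : system_solution s l (psit^~ l) (psit1^~ l).
  have [d1 d2] := solution_system pst.
  split; [apply: cprimitive_ae_eq d1 _|apply: cprimitive_ae_eq d2 _];
    by apply: ae_imply sst => x h xi; rewrite /rhs1 /rhs2 h.
have d := system_solutionD (psit1 0 l) (- psi1 0 l) (solution_system ps) tS.
have wl := wE l p10 pt10; rewrite /weyl in wl; move/oppr_inj in wl.
have [|||||y0 y10] := solution_unique pN N0 d _ _ _ _ (x := pi).
- by rewrite ck /k; lra.
- by rewrite rk.
- rewrite (_ : psi 0 l = psi 0 l / psi1 0 l * psi1 0 l); last by field.
  by rewrite wl; field.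
- by ring.
- by rewrite lexx pi0.
rewrite /= pp ptp in y0; rewrite p1p pt1p in y10.
have : (r1 * rt2 - r2 * rt1).[l] != 0.
  apply: ZP; rewrite cabsN cabsX ck expr2.
  have : 1 * k <= k * k by rewrite ler_wpM2r// /k; lra.
  by rewrite mul1r {1}/k; lra.
rewrite hornerD hornerN !hornerM => /negP; apply; apply/eqP.
apply: (mulfI pt10); rewrite mulr0.
transitivity ((psit1 0 l * r1.[l] + - psi1 0 l * rt1.[l]) * rt2.[l] +
  (psit1 0 l * - r2.[l] + - psi1 0 l * - rt2.[l]) * rt1.[l]); first by ring.
by rewrite y0 y10; ring.
Qed.

End BoundaryData.

Theorem theorem2p3 (R : realType)
    (sigma sigmat : R -> R[i]) (r1 r2 rt1 rt2 : {poly R[i]})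
    (psi psi1 psit psit1 : R -> R[i] -> R[i])
    (sigma_L2 : L2_0pi sigma) (sigmat_L2 : L2_0pi sigmat)
    (r_coprime : coprimep r1 r2) (rt_coprime : coprimep rt1 rt2)
    (r_normalized : normalized r1 r2) (rt_normalized : normalized rt1 rt2)
    (psiP : is_psi sigma r1 r2 psi psi1)
    (psitP : is_psi sigmat rt1 rt2 psit psit1)
    (weylE : weyl_equal psi psi1 psit psit1) :
  {ae (@lebesgue_measure R), forall x : R, x \in `]0, pi[ ->
    sigma x = sigmat x} /\
  r1 = rt1 /\ r2 = rt2.
Proof.
have [N [pN N0]] := weight_primitive sigma_L2.
have [Nt [pNt Nt0]] := weight_primitive sigmat_L2.
have [C [C1 [CP eC]]] := picard_entire sigma_L2 1 0 pN N0.
have [S [S1 [SP eS]]] := picard_entire sigma_L2 0 1 pN N0.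
have [Ct [Ct1 [CtP eCt]]] := picard_entire sigmat_L2 1 0 pNt Nt0.
have [St [St1 [StP eSt]]] := picard_entire sigmat_L2 0 1 pNt Nt0.
have solP s y y1 (c d : R[i]) :
  (forall l, [/\ cprimitive 0 pi (y^~ l) (rhs1 s (y^~ l) (y1^~ l)),
       cprimitive 0 pi (y1^~ l) (rhs2 s (y^~ l) (y1^~ l) (fun x => l * y x l)),
       y 0 l = c & y1 0 l = d]) ->
  forall l, [/\ system_solution s l (y^~ l) (y1^~ l), y 0 l = c & y1 0 l = d].
  by move=> H l; have [] := H l.
have sst : {ae (@lebesgue_measure R), forall x : R, x \in `]0, pi[ ->
    sigma x = sigmat x}.
  have [Cs c0 c10] := solP _ _ _ _ _ CP 0; have [Ss s0 s10] := solP _ _ _ _ _ SP 0.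
  have [Cts ct0 ct10] := solP _ _ _ _ _ CtP 0.
  have [Sts st0 st10] := solP _ _ _ _ _ StP 0.
  apply: (eq_potentials_of_transfer_vanish Cs Ss Cts Sts) => // x xpi.
  have [eCx _] := eC x xpi; have [eSx _] := eS x xpi.
  have [eCtx _] := eCt x xpi; have [eStx _] := eSt x xpi.
  exact: (weyl_transfer_vanish pN N0 pNt Nt0 r_normalized rt_normalized psiP psitP
    weylE (solP _ _ _ _ _ CP) (solP _ _ _ _ _ SP) (solP _ _ _ _ _ CtP)
    (solP _ _ _ _ _ StP) xpi).
split=> //.
apply: normalized_proportional => //.
exact: (boundary_polynomials sigma_L2 sigmat_L2 sst r_normalized rt_normalized psiP psitP weylE).
Qed.
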